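(* Let $(M,c,\sigma)$ be Poincar\'e--Einstein. Let $\mathcal A$ be a tractor $k$-form of weight $w_0$ and $\mathcal F$ a tractor $k$-form of weight $w_0-1$, with $h_0:=d+2w_0\in\{3,5,7,\dots\}$. Then along $\Sigma$ the following identities hold: $$\mathscr X y^{h_0-1}\mathcal A=-(h_0-2)^2\,y^{h_0-3}\,\overline{\mathscr D}\mathcal A,\qquad \mathscr X^\star y^{h_0-1}\mathcal A=-(h_0-2)^2\,y^{h_0-3}\,\overline{\mathscr D}^\star\mathcal A,$$ $$y^{h_0-1}\mathscr X\mathcal F=-(h_0-2)^2\,\overline{\mathscr D}\,y^{h_0-3}\mathcal F,\qquad y^{h_0-1}\mathscr X^\star\mathcal F=-(h_0-2)^2\,\overline{\mathscr D}^\star y^{h_0-3}\mathcal F .$$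
   Context: Conformal conventions. $M$ is a smooth manifold of dimension $d=n+1\ge3$ with boundary $\Sigma$ and conformal class $c$. $\mathcal EM[w]$: conformal densities of weight $w$ (families $\mu_g$, $g\in c$, with $\mu_{\Omega^2g}=\Omega^w\mu_g$); each scale $g\in c$ trivialises them; indices are moved with the conformal metric $\boldsymbol g$. $\mathcal E^kM[w]=\Lambda^kT^*M\otimes\mathcal EM[w]$. In a scale $g$: $\varepsilon,\iota$ are exterior/interior multiplication, $\mathbf d=\varepsilon(\nabla)$, $\boldsymbol\delta=\iota(\nabla)$, $\boldsymbol\Delta=\mathbf d\boldsymbol\delta+\boldsymbol\delta\mathbf d$; $\mathrm{Ric}=(d-2)P+Jg$, $J=P^a{}_a$, and $\mathbb P$ is the endomorphism $P^a{}_b$ extended to forms as a derivation. Poincar\'e--Einstein: $\sigma\in\Gamma\mathcal EM[1]$ is positive in the interior, vanishes exactly on $\Sigma$ with $\nabla\sigma\ne0$ there, and $g^o=\sigma^{-2}\boldsymbol g$ satisfies $\mathrm{Ric}(g^o)=-n g^o$. In a scale $g$: $\nu=\nabla\sigma$, $\rho=-\frac1d(\nabla^a\nabla_a\sigma+J\sigma)$. Tractor forms. For $g\in c$, $\mathcal T^kM[w]\cong\mathcal E^{k-1}M[w+k]\oplus\mathcal E^kM[w+k]\oplus\mathcal E^{k-2}M[w+k-2]\oplus\mathcal E^{k-1}M[w+k-2]$; sections are $\mathcal F=(F^+,F,F^{+-},F^-)$ (north, west, east, south slots), called tractor $k$-forms of weight $w$. Under $\hat g=\Omega^2g$, $\Upsilon=\mathbf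 d\log\Omega$: $\hat F^+=F^+$, $\hat F=F+\varepsilon(\Upsilon)F^+$, $\hat F^{+-}=F^{+-}-\iota(\Upsilon)F^+$, $\hat F^-=F^-+\frac12(\varepsilon(\Upsilon)\iota(\Upsilon)-\iota(\Upsilon)\varepsilon(\Upsilon))F^+-\iota(\Upsilon)F-\varepsilon(\Upsilon)F^{+-}$. Invariant operators on $\mathcal T^kM[w]$: $\mathscr X\mathcal F=(0,0,-F^+,F)\in\Gamma\mathcal T^{k+1}M[w+1]$; $\mathscr X^\star\mathcal F=(0,F^+,0,F^{+-})\in\Gamma\mathcal T^{k-1}M[w+1]$; $\mathscr I\mathcal F=(-\varepsilon(\nu)F^++\sigma F,\ \varepsilon(\nu)F,\ -\rho F^++\varepsilon(\nu)F^{+-}+\sigma F^-,\ \rho F-\varepsilon(\nu)F^-)$; $\mathscr I^\star\mathcal F=(-\iota(\nu)F^+-\sigma F^{+-},\ \rho F^++\iota(\nu)F+\sigma F^-,\ \iota(\nu)F^{+-},\ \rho F^{+-}-\iota(\nu)F^-)$; $\mathscr D:\Gamma\mathcal T^kM[w]\to\Gamma\mathcal T^{k+1}M[w-1]$ with slots north: $(d+2w-2)\big((w+k)F-\mathbf dF^+\big)$; west: $(d+2w-2)\mathbf dF$; east: $\big(\boldsymbol\Delta+(w+k-2)(J-2\mathbb P)\big)F^+-2\boldsymbol\delta F+(d+2w)\big(\mathbf dF^{+-}+(w+k-2)F^-\big)$; south: $[J-2\mathbb P,\mathbf d]F^+-\big(\boldsymbol\Delta+(w+k)(J-2\mathbb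 P)\big)F-(d+2w)\mathbf dF^-$; $\mathscr D^\star:\Gamma\mathcal T^kM[w]\to\Gamma\mathcal T^{k-1}M[w-1]$ with slots north: $-(d+2w-2)\big(\boldsymbol\delta F^++(d+w-k+2)F^{+-}\big)$; west: $\big(-\boldsymbol\Delta+(d+w-k)(J-2\mathbb P)\big)F^++(d+2w)\boldsymbol\delta F-2\mathbf dF^{+-}+(d+2w)(d+w-k)F^-$; east: $(d+2w-2)\boldsymbol\delta F^{+-}$; south: $[J-2\mathbb P,\boldsymbol\delta]F^++\big(-\boldsymbol\Delta+(d+w-k+2)(J-2\mathbb P)\big)F^{+-}-(d+2w)\boldsymbol\delta F^-$. $y:=-(\mathscr I^\star\mathscr D+\mathscr D\mathscr I^\star):\Gamma\mathcal T^kM[w]\to\Gamma\mathcal T^kM[w-1]$ (on a Poincar\'e--Einstein structure this equals $-(\mathscr I\mathscr D^\star+\mathscr D^\star\mathscr I)$). On $\mathcal T^kM[w]$ define, for $w\neq1-\frac d2,\ 1-\frac n2,\ 2-\frac d2$ (which covers all uses in the claim with $w\ne1-\frac n2$), $$\overline{\mathscr D}=\frac{d+2w-3}{d+2w-2}\Big(\mathscr D+\mathscr Iy+\frac{\mathscr Xy^2}{(d+2w-3)(d+2w-4)}\Big),\quad \overline{\mathscr D}^\star=\frac{d+2w-3}{d+2w-2}\Big(\mathscr D^\star+\mathscr I^\star y+\frac{\mathscr X^\star y^2}{(d+2w-3)(d+2w-4)}\Big),$$ and for $w=1-\frac n2$, $\overline{\mathscr D}=-\mathscr Xy^2$, $\overline{\mathscr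 D}^\star=-\mathscr X^\star y^2$. *)

(* Defs.v *)
From HB Require Import structures.
From mathcomp Require Import all_boot all_order all_algebra.
From mathcomp Require Import all_classical all_reals all_analysis.

Set Implicit Arguments.
Unset Strict Implicit.
Unset Printing Implicit Defensive.

Import Order.TTheory GRing.Theory Num.Theory.
Import numFieldNormedType.Exports.

Local Open Scope classical_set_scope.
Local Open Scope ring_scope.

(** Throughout [n] is the dimension of the boundary and [d = n.+1] that of the
    manifold. Tensor fields are given by their components in the charts of an
    atlas; components are functions on the whole of ['rV[R]_n.+1], but only
    their values on the images of the charts are meaningful. *)

Section HalfSpace.
Context {R : realType} {n : nat}.
Local Notation d := n.+1.
Local Notation vec := 'rV[R]_d.

Definition basis_vec (i : 'I_d) : vec := delta_mx 0 i.

Definition halfspace : set vec := [set x | 0 <= x 0 ord0].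

(** The difference quotient is restricted to steps that stay in the half-space,
    so that at a boundary point the normal derivative is one-sided. *)
Definition pd (i : 'I_d) (f : vec -> R) (x : vec) : R :=
  lim ((fun h : R => h^-1 * (f (h *: basis_vec i + x) - f x))
         @ within [set h | halfspace (h *: basis_vec i + x)] 0^').

Fixpoint iter_partial (s : seq 'I_d) (f : vec -> R) : vec -> R :=
  if s is i :: s' then fun x => 'D_(basis_vec i) (iter_partial s' f) x else f.

Definition Cinfty (V : set vec) (f : vec -> R) : Prop :=
  forall (s : seq 'I_d) (x : vec), V x ->
    {for x, continuous (iter_partial s f)} /\
    forall i : 'I_d, derivable (iter_partial s f) x (basis_vec i).

(** Smoothness up to the boundary: local extendability to an open subset of
    Euclidean space. *)
Definition smooth_on (U : set vec) (f : vec -> R) : Prop :=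
  forall x : vec, U x ->
    exists (V : set vec) (h : vec -> R),
      [/\ open V, V x, Cinfty V h & forall z : vec, V z -> U z -> h z = f z].

Definition gradient (f : vec -> R) (x : vec) : vec := \row_i pd i f x.

End HalfSpace.

(** An inhomogeneous exterior form is the family of its components [F S], the coefficient
    of [dx^{i_1} /\ ... /\ dx^{i_k}] for [S = {i_1 < ... < i_k}]. *)

Section Exterior.
Context {R : realType} {n : nat}.
Local Notation d := n.+1.

Definition ealg : Type := {ffun {set 'I_d} -> R}.
HB.instance Definition _ := GRing.Lmodule.on ealg.

Definition ins_sign (i : 'I_d) (S : {set 'I_d}) : R :=
  (-1) ^+ #|[set j in S | (j < i)%N]|.

Definition eone : ealg := [ffun S => (S == finset.set0)%:R].

(** [u] is the row of components of a covector. *)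
Definition wedge (u : 'rV[R]_d) (F : ealg) : ealg :=
  [ffun S : {set 'I_d} =>
     \sum_(i in S) ins_sign i S * u 0 i * F (S :\ i)%SET].

(** [v] is the row of components of a vector. *)
Definition contract (v : 'rV[R]_d) (F : ealg) : ealg :=
  [ffun S : {set 'I_d} =>
     \sum_(i | i \notin S) ins_sign i S * v 0 i * F (i |: S)%SET].

(** Interior multiplication by a covector, whose index is raised with the
    metric [g]. *)
Definition icontract (g : 'M[R]_d) (u : 'rV[R]_d) (F : ealg) : ealg :=
  contract (u *m invmx g) F.

Definition homogeneous (k : int) (F : ealg) : Prop :=
  forall S : {set 'I_d}, (#|S| : int) != k -> F S = 0.

(** [J i j] is the derivative of the [j]-th new coordinate along the [i]-th old
    one, so the covector [dy^j] has components [(col j J)^T]. *)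
Definition pullback (J : 'M[R]_d) (F : ealg) : ealg :=
  \sum_(T : {set 'I_d})
    F T *: foldr (fun j : 'I_d => wedge (col j J)^T) eone (enum T).

End Exterior.
Arguments ealg : clear implicits.

Section Riemann.
Context {R : realType} {n : nat}.
Local Notation d := n.+1.
Local Notation vec := 'rV[R]_d.

Definition lscalar : Type := vec -> R.
Definition lmetric : Type := vec -> 'M[R]_d.
Definition lform : Type := vec -> ealg R n.
HB.instance Definition _ := GRing.Lmodule.on lform.

Variable g : lmetric.

(** [christoffel c a b] is Gamma^c_{ab} of the Levi-Civita connection. *)
Definition christoffel (c a b : 'I_d) (x : vec) : R :=
  2^-1 * \sum_e invmx (g x) c e *
    (pd a (fun z => g z e b) x + pd b (fun z => g z e a) x
     - pd e (fun z => g z a b) x).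

Definition ricci (x : vec) : 'M[R]_d := \matrix_(a, b)
  \sum_c (pd c (christoffel c a b) x - pd b (christoffel c a c) x
    + \sum_e (christoffel c c e x * christoffel e a b x
              - christoffel c b e x * christoffel e a c x)).

Definition scalar_curvature (x : vec) : R := \tr (invmx (g x) *m ricci x).

(** [schoutenJ] and [schouten] solve Ric = (d - 2) P + J g with J = tr_g P. *)
Definition schoutenJ (x : vec) : R :=
  scalar_curvature x / (2 * (d%:R - 1)).

Definition schouten (x : vec) : 'M[R]_d :=
  (d%:R - 2)^-1 *: (ricci x - schoutenJ x *: g x).

Definition nabla (a : 'I_d) (F : lform) : lform := fun x =>
  [ffun S => pd a (fun z => F z S) x]
  - \sum_b \sum_c christoffel c a b x *:
      wedge (basis_vec b) (contract (basis_vec c) (F x)).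

Definition dform (F : lform) : lform := fun x =>
  \sum_a wedge (basis_vec a) (nabla a F x).

(** No sign: the codifferential is the divergence [iota(nabla)]. *)
Definition codiff (F : lform) : lform := fun x =>
  \sum_a icontract (g x) (basis_vec a) (nabla a F x).

Definition form_laplacian (F : lform) : lform :=
  dform (codiff F) + codiff (dform F).

(** The trace nabla^a nabla_a of the Hessian. *)
Definition laplacian (f : lscalar) (x : vec) : R :=
  \sum_a \sum_b invmx (g x) a b *
    (pd a (pd b f) x - \sum_c christoffel c a b x * pd c f x).

(** The endomorphism [P^a_b] of covectors, extended to forms as a derivation. *)
Definition schouten_der (F : lform) : lform := fun x =>
  \sum_b wedge (basis_vec b)
    (contract (row b (schouten x *m invmx (g x))) (F x)).

Definition JmP (F : lform) : lform := fun x =>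
  schoutenJ x *: F x - 2 *: schouten_der F x.

Definition eps (u : vec -> vec) (F : lform) : lform := fun x =>
  wedge (u x) (F x).

Definition iot (u : vec -> vec) (F : lform) : lform := fun x =>
  icontract (g x) (u x) (F x).

Definition smul (f : lscalar) (F : lform) : lform := fun x => f x *: F x.

End Riemann.
Arguments lscalar : clear implicits.
Arguments lmetric : clear implicits.
Arguments lform : clear implicits.

Section LocalTractors.
Context {R : realType} {n : nat}.
Local Notation d := n.+1.
Local Notation dR := (d%:R : R).

Definition ltractor : Type :=
  (lform R n * lform R n * lform R n * lform R n)%type.
HB.instance Definition _ := GRing.Lmodule.on ltractor.

Definition slots (N W E S : lform R n) : ltractor := (N, W, E, S).
Definition north (T : ltractor) : lform R n := T.1.1.1.
Definition west (T : ltractor) : lform R n := T.1.1.2.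
Definition east (T : ltractor) : lform R n := T.1.2.
Definition south (T : ltractor) : lform R n := T.2.

(** The metric [g] of a scale and the component of the defining density in that
    scale; [w] and [k] are the weight and degree of the argument. *)
Variables (g : lmetric R n) (s : lscalar R n).

Let nu := gradient s.
Definition rho : lscalar R n := fun x =>
  - dR^-1 * (laplacian g s x + schoutenJ g x * s x).

Local Notation "'δ' F" := (codiff g F) (at level 30, F at level 30).
Local Notation "'∂' F" := (dform g F) (at level 30, F at level 30).
Local Notation Δ := (form_laplacian g).
Local Notation Q := (JmP g).
Local Notation "k %:r" := (k%:~R : R) (at level 2, format "k %:r").

Definition lX (T : ltractor) : ltractor :=
  slots 0 0 (- north T) (west T).

Definition lXs (T : ltractor) : ltractor :=
  slots 0 (north T) 0 (east T).

Definition lI (T : ltractor) : ltractor := slots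
  (- eps nu (north T) + smul s (west T))
  (eps nu (west T))
  (- smul rho (north T) + eps nu (east T) + smul s (south T))
  (smul rho (west T) - eps nu (south T)).

Definition lIs (T : ltractor) : ltractor := slots
  (- iot g nu (north T) - smul s (east T))
  (smul rho (north T) + iot g nu (west T) + smul s (south T))
  (iot g nu (east T))
  (smul rho (east T) - iot g nu (south T)).

Definition lD (w : R) (k : int) (T : ltractor) : ltractor := slots
  ((dR + 2 * w - 2) *: ((w + k%:r) *: west T - ∂ (north T)))
  ((dR + 2 * w - 2) *: ∂ (west T))
  (Δ (north T) + (w + k%:r - 2) *: Q (north T) - 2 *: δ (west T)
   + (dR + 2 * w) *: (∂ (east T) + (w + k%:r - 2) *: south T))
  ((Q (∂ (north T)) - ∂ (Q (north T)))
   - (Δ (west T) + (w + k%:r) *: Q (west T))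
   - (dR + 2 * w) *: ∂ (south T)).

Definition lDs (w : R) (k : int) (T : ltractor) : ltractor := slots
  (- (dR + 2 * w - 2) *: (δ (north T) + (dR + w - k%:r + 2) *: east T))
  (- Δ (north T) + (dR + w - k%:r) *: Q (north T)
   + (dR + 2 * w) *: δ (west T) - 2 *: ∂ (east T)
   + ((dR + 2 * w) * (dR + w - k%:r)) *: south T)
  ((dR + 2 * w - 2) *: δ (east T))
  ((Q (δ (north T)) - δ (Q (north T)))
   + (- Δ (east T) + (dR + w - k%:r + 2) *: Q (east T))
   - (dR + 2 * w) *: δ (south T)).

(** I^* preserves the weight and lowers the degree by one. *)
Definition ly (w : R) (k : int) (T : ltractor) : ltractor :=
  - (lIs (lD w k T) + lD w (k - 1) (lIs T)).

(** [m]-fold iterate of y; each application lowers the weight by one. *)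
Fixpoint lypow (w : R) (k : int) (m : nat) (T : ltractor) : ltractor :=
  if m is m'.+1 then lypow (w - 1) k m' (ly w k T) else T.

(** The first branch is the case w = 1 - n/2. At the weights 1 - d/2 and
    2 - d/2, where the operators are not defined, the second one is a junk
    value, division by zero being total. *)
Definition lDbar (w : R) (k : int) (T : ltractor) : ltractor :=
  let h := dR + 2 * w in
  if w == 1 - n%:R / 2 then - lX (lypow w k 2 T)
  else ((h - 3) / (h - 2)) *:
         (lD w k T + lI (ly w k T)
          + ((h - 3) * (h - 4))^-1 *: lX (lypow w k 2 T)).

Definition lDbars (w : R) (k : int) (T : ltractor) : ltractor :=
  let h := dR + 2 * w in
  if w == 1 - n%:R / 2 then - lXs (lypow w k 2 T)
  else ((h - 3) / (h - 2)) *: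
         (lDs w k T + lIs (ly w k T)
          + ((h - 3) * (h - 4))^-1 *: lXs (lypow w k 2 T)).

(** The change of slots of a tractor form under g |-> Omega^2 g, with
    [U = d log Omega], before trivialisation of the densities. *)
Definition slot_change (U : 'rV[R]_d -> 'rV[R]_d) (T : ltractor) : ltractor :=
  slots
    (north T)
    (west T + eps U (north T))
    (east T - iot g U (north T))
    (south T
     + 2^-1 *: (eps U (iot g U (north T)) - iot g U (eps U (north T)))
     - iot g U (west T) - eps U (east T)).

End LocalTractors.
Arguments ltractor : clear implicits.

Record manifold (R : realType) (n : nat) := Manifold {
  pt :> topologicalType ;
  mfd_hausdorff : hausdorff_space pt ;
  mfd_second_countable : @second_countable pt ;
  chart : Type ;
  dom : chart -> set pt ;
  coord : chart -> pt -> 'rV[R]_n.+1 ;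
  icoord : chart -> 'rV[R]_n.+1 -> pt ;
  dom_open : forall a, open (dom a) ;
  dom_cover : forall p, exists a, dom a p ;
  coordK : forall a p, dom a p -> icoord a (coord a p) = p ;
  coord_image : forall a, exists2 V : set 'rV[R]_n.+1,
    open V & coord a @` dom a = V `&` halfspace ;
  coord_continuous : forall a, {within dom a, continuous (coord a)} ;
  icoord_continuous : forall a,
    {within coord a @` dom a, continuous (icoord a)} ;
  transition_smooth : forall (a b : chart) (i : 'I_n.+1),
    smooth_on (coord a @` (dom a `&` dom b))
      (fun x => coord b (icoord a x) 0 i)
}.

Section Fields.
Context {R : realType} {n : nat}.
Variable M : manifold R n.
Local Notation d := n.+1.
Local Notation vec := 'rV[R]_d.
Local Notation im a := (coord a @` dom a).

Definition bdry : set M :=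
  [set p | exists a : chart M, dom a p /\ coord a p 0 ord0 = 0].

Definition in_chart (f : M -> R) (a : chart M) : lscalar R n :=
  fun x => f (icoord a x).

Definition smooth_function (f : M -> R) : Prop :=
  forall a : chart M, smooth_on (im a) (in_chart f a).

(** [jac a b x i j] is the derivative of the [j]-th coordinate of [b] along the
    [i]-th coordinate of [a]. *)
Definition jac (a b : chart M) (x : vec) : 'M[R]_d :=
  \matrix_(i, j) pd i (fun z => coord b (icoord a z) 0 j) x.

Definition metric : Type := chart M -> lmetric R n.

Definition is_metric (g : metric) : Prop :=
  [/\ forall (a : chart M) (i j : 'I_d), smooth_on (im a) (fun x => g a x i j),
      forall (a : chart M) (x : vec), im a x -> (g a x)^T = g a x,
      forall (a : chart M) (x : vec), im a x ->
        forall v : vec, v != 0 -> 0 < (v *m g a x *m v^T) 0 0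
    & forall (a b : chart M) (p : M), dom a p -> dom b p ->
        let J := jac a b (coord a p) in
        g a (coord a p) = J *m g b (coord b p) *m J^T].

Definition form : Type := chart M -> lform R n.

Definition is_form (k : int) (F : form) : Prop :=
  [/\ forall (a : chart M) (S : {set 'I_d}),
        smooth_on (im a) (fun x => F a x S),
      forall (a : chart M) (x : vec), im a x -> homogeneous k (F a x)
    & forall (a b : chart M) (p : M), dom a p -> dom b p ->
        F a (coord a p) = pullback (jac a b (coord a p)) (F b (coord b p))].

Definition rescaling (Omega : M -> R) (g g' : metric) : Prop :=
  [/\ smooth_function Omega, forall p, 0 < Omega p
    & forall (a : chart M) (p : M), dom a p ->
        g' a (coord a p) = Omega p ^+ 2 *: g a (coord a p)].

Definition conformal_class (c : set metric) : Prop :=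
  exists2 g0 : metric, is_metric g0 &
    forall g : metric, c g <-> exists Omega : M -> R, rescaling Omega g0 g.

Definition is_density (c : set metric) (w : R) (mu : metric -> M -> R) : Prop :=
  (forall g : metric, c g -> smooth_function (mu g)) /\
  forall (g g' : metric) (Omega : M -> R), c g -> c g' ->
    rescaling Omega g g' -> forall p : M, mu g' p = Omega p `^ w * mu g p.

Definition poincare_einstein (c : set metric) (sigma : metric -> M -> R) : Prop :=
  [/\ conformal_class c,
      is_density c 1 sigma,
      forall (g : metric) (p : M), c g -> ~ bdry p -> 0 < sigma g p,
      forall (g : metric) (p : M), c g -> bdry p ->
        sigma g p = 0 /\
        forall a : chart M, dom a p ->
          gradient (in_chart (sigma g) a) (coord a p) != 0
    & forall (g : metric) (a : chart M) (p : M), c g -> dom a p -> ~ bdry p ->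
        let go : lmetric R n :=
          fun x => in_chart (sigma g) a x ^- 2 *: g a x in
        ricci go (coord a p) = - n%:R *: go (coord a p)].

(** A section is its family of slots in every scale and every chart. *)
Definition tractor : Type := metric -> chart M -> ltractor R n.
HB.instance Definition _ := GRing.Lmodule.on tractor.

Definition is_tractor (c : set metric) (k : int) (w : R) (T : tractor) : Prop :=
  (forall g : metric, c g ->
     [/\ is_form (k - 1) (fun a => north (T g a)),
         is_form k (fun a => west (T g a)),
         is_form (k - 2) (fun a => east (T g a))
       & is_form (k - 1) (fun a => south (T g a))]) /\
  forall (g g' : metric) (Omega : M -> R), c g -> c g' ->
    rescaling Omega g g' ->
    forall (a : chart M) (p : M), dom a p ->
    let x := coord a p in
    let U := gradient (in_chart (fun q => ln (Omega q)) a) in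
    let T' := slot_change (g a) U (T g a) in
    let m := w + k%:~R in
    [/\ north (T g' a) x = Omega p `^ m *: north T' x,
        west (T g' a) x = Omega p `^ m *: west T' x,
        east (T g' a) x = Omega p `^ (m - 2) *: east T' x
      & south (T g' a) x = Omega p `^ (m - 2) *: south T' x].

Definition tX (T : tractor) : tractor := fun g a => lX (T g a).
Definition tXs (T : tractor) : tractor := fun g a => lXs (T g a).

Section Scale.
Variable sigma : metric -> M -> R.

Definition typow (w : R) (k : int) (m : nat) (T : tractor) : tractor :=
  fun g a => lypow (g a) (in_chart (sigma g) a) w k m (T g a).

Definition tDbar (w : R) (k : int) (T : tractor) : tractor :=
  fun g a => lDbar (g a) (in_chart (sigma g) a) w k (T g a).

Definition tDbars (w : R) (k : int) (T : tractor) : tractor :=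
  fun g a => lDbars (g a) (in_chart (sigma g) a) w k (T g a).

End Scale.

Definition eq_along_bdry (c : set metric) (T1 T2 : tractor) : Prop :=
  forall (g : metric) (a : chart M) (p : M), c g -> dom a p -> bdry p ->
    let x := coord a p in
    [/\ north (T1 g a) x = north (T2 g a) x,
        west (T1 g a) x = west (T2 g a) x,
        east (T1 g a) x = east (T2 g a) x
      & south (T1 g a) x = south (T2 g a) x].

End Fields.

(* Main.v *)
(** In the scale [g], the Einstein equation for [sigma^-2 g] says in the interior
    that [Hess sigma + sigma P + rho g = 0] and [|nu|^2 + 2 sigma rho = 1]; by
    smoothness both persist up to the boundary. Together with [d^2 = 0] and
    [delta^2 = 0] they determine the commutation relations between [d], [delta],
    [eps(nu)], [iota(nu)], [sigma], [rho], [J - 2P] and the form degree, and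
    every relation between the tractor operators used here follows from them by
    normal ordering: [D^2 = 0], [X I* + I* X = sigma], [y] commutes with [D] and
    [I], and, for [h = d + 2w],
    [(h - 2) D sigma = h sigma D + 2 X y + h (h - 2) I].
    By induction on [m],
    [y^m X = h/(h-2m) X y^m - m h I y^(m-1) + 2m/(h-2m) sigma D y^(m-1)
       - m (m-1) D y^(m-2)],
    where no denominator vanishes for odd [h]. Where [sigma = 0], solving this
    for [X y^m] or substituting the definition of [Dbar] on the right gives the
    theorem. The starred identities follow in the same way after exchanging [I]
    and [I*]. *)
Require Import Defs.
From HB Require Import structures.
From mathcomp Require Import all_boot all_order all_algebra.
From mathcomp Require Import ring lra.

Set Implicit Arguments.
Unset Strict Implicit.
Unset Printing Implicit Defensive.

Import Order.TTheory GRing.Theory Num.Theory.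
Local Open Scope ring_scope.

(** The relations between the tractor operators are long, so the operators on forms become letters
    of a rewriting system, and each slot reduces to identities between coefficients polynomial in d,
    w and k. This needs operators on an honest module, whereas components in a chart mean nothing
    off its image and [pd] is not even additive on arbitrary functions. Hence the ring [smfun] of
    functions smooth up to the boundary and cut to 0 off the domain, and the relation [represents]
    leading back to components. In that ring sigma is not a unit but a nonzerodivisor; the metric
    sigma^-2 g only exists over the smaller ring of the interior, and what passes between the two
    rings are values at points. The powers h0 - 1 and h0 - 3 come from the one case in which I
    y^(m-1) and D y^(m-2) have the same coefficient in y^m X, namely h = m - 1: there the two terms
    assemble into the part D + I y of [Dbar]. For the last two identities h = h0 - 2 and m = h0 - 1;
    for the first two the formula is applied to y^2 A, with h = h0 - 4 and m = h0 - 3. The factor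
    (h0 - 2)^2 is what then remains. *)

Section NormalOrdering.
Context {K : comPzRingType} {V : lmodType K} {letter : Type}.
Variables (eqb : letter -> letter -> bool)
  (eqbP : forall a b, eqb a b -> a = b).
Variable act : letter -> {linear V -> V}.
Variable rule : letter -> letter -> option (seq (K * seq letter)).
Variable eigen : letter -> nat -> option K.
Variable env : seq V.

Definition word_act (w : seq letter) (x : V) : V :=
  foldr (fun a y => act a y) x w.

Hypothesis ruleP : forall a b r x, rule a b = Some r ->
  act a (act b x) = \sum_(t <- r) t.1 *: word_act t.2 x.
Hypothesis eigenP : forall a i c, eigen a i = Some c -> act a env`_i = c *: env`_i.

Inductive opexp : Type :=
  | OAtom of nat | OZero | OAdd of opexp & opexp | OOpp of opexp
  | OScale of K & opexp | OAct of letter & opexp.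

Fixpoint oeval (e : opexp) : V :=
  match e with
  | OAtom i => env`_i
  | OZero => 0
  | OAdd e1 e2 => oeval e1 + oeval e2
  | OOpp e1 => - oeval e1
  | OScale a e1 => a *: oeval e1
  | OAct a e1 => act a (oeval e1)
  end.

Definition term : Type := K * (seq letter * nat).

Fixpoint terms (e : opexp) : seq term :=
  match e with
  | OAtom i => [:: (1, ([::], i))]
  | OZero => [::]
  | OAdd e1 e2 => terms e1 ++ terms e2
  | OOpp e1 => map (fun t => (- t.1, t.2)) (terms e1)
  | OScale a e1 => map (fun t => (a * t.1, t.2)) (terms e1)
  | OAct a e1 => map (fun t => (t.1, (a :: t.2.1, t.2.2))) (terms e1)
  end.

Definition teval (ts : seq term) : V :=
  \sum_(t <- ts) t.1 *: word_act t.2.1 env`_t.2.2.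

Lemma teval_terms (e : opexp) : oeval e = teval (terms e).
Proof.
rewrite /teval; elim: e => [i||e1 IH1 e2 IH2|e IH|a e IH|a e IH] /=.
- by rewrite big_seq1 scale1r.
- by rewrite big_nil.
- by rewrite big_cat IH1 IH2.
- by rewrite big_map IH -sumrN; apply: eq_bigr => t _; rewrite scaleNr.
- by rewrite big_map IH scaler_sumr; apply: eq_bigr => t _; rewrite scalerA.
- by rewrite big_map IH linear_sum; apply: eq_bigr => t _; rewrite linearZZ.
Qed.

(** Rewrites the leftmost reducible pair. An eigenvalue is used only on the last letter, when no
    pair is reducible any more; the degree operator, which the rules push to the right, ends
    there. *)
Fixpoint step (i : nat) (w : seq letter) : option (seq (K * seq letter)) :=
  match w with
  | [::] => None
  | a :: w1 =>
    match w1 with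
    | [::] => if eigen a i is Some c then Some [:: (c, [::])] else None
    | b :: w2 =>
      if rule a b is Some r then Some (map (fun t => (t.1, t.2 ++ w2)) r)
      else if step i w1 is Some r then Some (map (fun t => (t.1, a :: t.2)) r)
      else None
    end
  end.

Lemma stepP (i : nat) (w : seq letter) r : step i w = Some r ->
  word_act w env`_i = \sum_(t <- r) t.1 *: word_act t.2 env`_i.
Proof.
elim: w r => [//|a [|b w] IH] r.
  by rewrite /=; case Ea: eigen => [c|//] [<-]; rewrite big_seq1 (eigenP Ea).
rewrite [step _ _]/=; case Er: (rule a b) => [q|].
  case=> <-; rewrite big_map [LHS]/= (ruleP _ Er); apply: eq_bigr => t _ /=.
  by rewrite /word_act foldr_cat.
case Es: (step i (b :: w)) => [q|]; rewrite [step i _]/= in Es; rewrite Es // => -[<-].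
rewrite big_map [LHS]/= [act b _](IH _ Es) linear_sum.
by apply: eq_bigr => t _; rewrite linearZZ.
Qed.

Fixpoint normalize (fuel : nat) (ts : seq term) : seq term :=
  if fuel is f.+1 then
    flatten (map (fun t =>
      if step t.2.2 t.2.1 is Some r
      then normalize f (map (fun x => (t.1 * x.1, (x.2, t.2.2))) r)
      else [:: t]) ts)
  else ts.

(** Holds for every [fuel], since a word that is not fully reduced is kept as it stands. Neither
    termination nor confluence is claimed: a poor set of rules could make [vanish] unprovable, but
    never prove anything false. *)
Lemma teval_normalize (fuel : nat) (ts : seq term) :
  teval (normalize fuel ts) = teval ts.
Proof.
elim: fuel ts => [//|f IH] ts; rewrite /teval [normalize _ _]/=.
rewrite big_flatten big_map; apply: eq_bigr => t _.
case Es: step => [r|]; last by rewrite big_seq1.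
rewrite -/(teval _) IH /teval big_map (stepP Es) scaler_sumr.
by apply: eq_bigr => x _; rewrite scalerA.
Qed.

Fixpoint eqw (w1 w2 : seq letter) : bool :=
  match w1, w2 with
  | [::], [::] => true
  | a :: w1', b :: w2' => if eqb a b then eqw w1' w2' else false
  | _, _ => false
  end.

Definition same_key (t u : term) : bool :=
  if Nat.eqb t.2.2 u.2.2 then eqw t.2.1 u.2.1 else false.

Lemma same_keyP t u : same_key t u -> t.2 = u.2.
Proof.
rewrite /same_key; case: t u => a [w i] [b [v j]] /=.
case: (PeanoNat.Nat.eqb_spec i j) => // -> H; congr (_, _).
elim: w v H => [|x w IH] [|y v] //=.
by case Exy: (eqb x y) => // /IH ->; rewrite (eqbP Exy).
Qed.

(** A proposition, with one equation per distinct word, because the coefficients contain the symbols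
    d, w, k and are left to [ring]. Connectives are spelled out with [if] to compute under the
    explicit [cbv] lists of [lin_coefs] and [calc]. *)
Fixpoint vanish (fuel : nat) (ts : seq term) : Prop :=
  match fuel, ts with
  | _, [::] => True
  | f.+1, t :: ts' =>
      foldr (fun u c => u.1 + c) t.1 (filter (same_key t) ts') = 0
      /\ vanish f (filter (fun u => if same_key t u then false else true) ts')
  | 0%N, _ => False
  end.

Lemma teval_vanish (fuel : nat) (ts : seq term) : vanish fuel ts -> teval ts = 0.
Proof.
elim: fuel ts => [|f IH] [|t ts] //=; rewrite ?/teval ?big_nil // big_cons.
case=> sum0 /IH rest0; rewrite (bigID (same_key t)) /= addrA.
have -> : \sum_(u <- ts | ~~ same_key t u) u.1 *: word_act u.2.1 env`_u.2.2 = 0.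
  rewrite -[RHS]rest0 /teval big_filter; apply: eq_bigl => u.
  by case: same_key.
rewrite addr0 -[RHS](scale0r (word_act t.2.1 env`_t.2.2)) -[in RHS]sum0.
rewrite -big_filter.
have: all (same_key t) (filter (same_key t) ts) by exact: filter_all.
elim: (filter _ _) => [|u us IHu] /=; first by rewrite big_nil addr0.
case/andP=> /same_keyP tu /IHu eqs.
by rewrite big_cons addrCA eqs scalerDl tu.
Qed.

(** The two numbers only have to be large enough: 60 bounds a chain of rewritings of one word, 1000
    the number of distinct words. *)
Lemma normal_order_eq (e1 e2 : opexp) :
  vanish 1000 (normalize 60 (terms (OAdd e1 (OOpp e2)))) -> oeval e1 = oeval e2.
Proof.
move/teval_vanish; rewrite teval_normalize -teval_terms /= => /eqP.
by rewrite subr_eq0 => /eqP.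
Qed.

End NormalOrdering.

(* Up to conversion, since the same structure may be reached by several paths. *)
Ltac op_index x env :=
  match env with
  | ?y :: _ => let u := constr:(erefl x : x = y) in constr:(0%N)
  | _ :: ?r => let i := op_index x r in constr:((S i))
  end.
Ltac op_atoms letter_of t env :=
  lazymatch t with
  | @GRing.add _ ?a ?b =>
      let e := op_atoms letter_of a env in op_atoms letter_of b e
  | @GRing.opp _ ?a => op_atoms letter_of a env
  | @GRing.scale _ _ _ ?a => op_atoms letter_of a env
  | @GRing.zero _ => env
  | _ =>
    match t with
    | @GRing.Linear.sort _ _ _ _ ?f ?a =>
        let l := letter_of f in op_atoms letter_of a env
    | _ => let i := op_index t env in env
    | _ => constr:(t :: env)
    end
  end.
Ltac op_reify letter_of t env :=
  lazymatch t with
  | @GRing.add _ ?a ?b =>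
      let x := op_reify letter_of a env in
      let y := op_reify letter_of b env in open_constr:(OAdd x y)
  | @GRing.opp _ ?a =>
      let x := op_reify letter_of a env in open_constr:(OOpp x)
  | @GRing.scale _ _ ?c ?a =>
      let x := op_reify letter_of a env in open_constr:(OScale c x)
  | @GRing.zero _ => open_constr:(OZero)
  | _ =>
    match t with
    | @GRing.Linear.sort _ _ _ _ ?f ?a =>
        let l := letter_of f in
        let x := op_reify letter_of a env in open_constr:(OAct l x)
    | _ => let i := op_index t env in open_constr:(OAtom i)
    end
  end.

Section LinearCombinations.
Context {K : comPzRingType} {V : lmodType K}.

(** The case of an empty alphabet: every application of an operator is an atom, and only the module
    axioms are used. This is the tactic [lin]. *)
Lemma linear_combination_eq (env : seq V) (e1 e2 : @opexp K void) :
  vanish (fun _ _ => true) 1000 (terms (OAdd e1 (OOpp e2))) ->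
  oeval (fun a : void => match a with end) env e1
  = oeval (fun a : void => match a with end) env e2.
Proof.
have norm0 f ts : normalize (fun (_ _ : void) => None) (fun _ _ => None) f ts
    = ts :> seq (@term K void).
  elim: f ts => [//|f IH] ts /=; elim: ts => [//|t ts IHt] /=; rewrite IHt.
  by case: t => a [[|[]] i].
rewrite -[terms _](norm0 60%N) => van.
by apply: normal_order_eq van => //; case.
Qed.

End LinearCombinations.

Ltac no_letter f := lazymatch f with tt => constr:(tt) end.
Ltac lin_coefs :=
  lazymatch goal with
  | |- @eq ?T ?a ?b =>
      let e0 := constr:(@nil T) in
      let e1 := op_atoms no_letter a e0 in
      let env := op_atoms no_letter b e1 in
      let x := op_reify no_letter a env in
      let y := op_reify no_letter b env in
      apply: (@linear_combination_eq _ _ env x y);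
      cbv [vanish terms map cat filter same_key eqw foldr Nat.eqb fst snd];
      repeat split
  end.
Ltac lin := lin_coefs; ring.

(** * The calculus of forms on a Poincare-Einstein structure *)

(* [fnu] and [fiota] stand for eps(nu) and iota(nu), [fs] and [frho] for the
   multiplications by sigma and rho, [fdrho] and [fgrho] for eps(d rho) and
   iota(d rho), [fQ] for J - 2P, and [fN] for the form degree. *)
Record form_calculus (K : numFieldType) (V : lmodType K) (dm : K) := FormCalculus {
  fd : {linear V -> V};
  fdel : {linear V -> V};
  fnu : {linear V -> V};
  fiota : {linear V -> V};
  fs : {linear V -> V};
  frho : {linear V -> V};
  fdrho : {linear V -> V};
  fgrho : {linear V -> V};
  fQ : {linear V -> V};
  fN : {linear V -> V};
  fd_d : forall F, fd (fd F) = 0;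
  fdel_del : forall F, fdel (fdel F) = 0;
  fd_s : forall F, fd (fs F) = fs (fd F) + fnu F;
  fdel_s : forall F, fdel (fs F) = fs (fdel F) + fiota F;
  fnu_s : forall F, fnu (fs F) = fs (fnu F);
  fiota_s : forall F, fiota (fs F) = fs (fiota F);
  frho_s : forall F, frho (fs F) = fs (frho F);
  fQ_s : forall F, fQ (fs F) = fs (fQ F);
  fN_s : forall F, fN (fs F) = fs (fN F);
  fd_rho : forall F, fd (frho F) = frho (fd F) + fdrho F;
  fdel_rho : forall F, fdel (frho F) = frho (fdel F) + fgrho F;
  fnu_rho : forall F, fnu (frho F) = frho (fnu F);
  fiota_rho : forall F, fiota (frho F) = frho (fiota F);
  fQ_rho : forall F, fQ (frho F) = frho (fQ F);
  fN_rho : forall F, fN (frho F) = frho (fN F);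
  fd_nu : forall F, fd (fnu F) = - fnu (fd F);
  fdel_iota : forall F, fdel (fiota F) = - fiota (fdel F);
  fnu_nu : forall F, fnu (fnu F) = 0;
  fiota_iota : forall F, fiota (fiota F) = 0;
  (* The geometry sits in four relations: here |nu|^2 = 1 - 2 sigma rho; in [fdel_nu] the equation
     Hess sigma = - sigma P - rho g; in [fQ_nu] and [fQ_iota] its consequence d rho = P(nu). *)
  fiota_nu : forall F,
    fiota (fnu F) = F - 2 *: fs (frho F) - fnu (fiota F);
  fdel_nu : forall F,
    fdel (fnu F) = fd (fiota F) + fiota (fd F) - fnu (fdel F)
      - fs (fQ F) + 2 *: frho (fN F) - dm *: frho F;
  fQ_nu : forall F, fQ (fnu F) = fnu (fQ F) - 2 *: fdrho F;
  fQ_iota : forall F, fQ (fiota F) = fiota (fQ F) + 2 *: fgrho F;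
  fN_d : forall F, fN (fd F) = fd (fN F) + fd F;
  fN_del : forall F, fN (fdel F) = fdel (fN F) - fdel F;
  fN_nu : forall F, fN (fnu F) = fnu (fN F) + fnu F;
  fN_iota : forall F, fN (fiota F) = fiota (fN F) - fiota F;
  fN_Q : forall F, fN (fQ F) = fQ (fN F)
}.

Inductive letter :=
  Ld | Ldel | Lnu | Liota | Ls | Lrho | Ldrho | Lgrho | LQ | LN | LL.

Definition letter_code (a : letter) : nat :=
  match a with
  | Ld => 0 | Ldel => 1 | Lnu => 2 | Liota => 3 | Ls => 4 | Lrho => 5
  | Ldrho => 6 | Lgrho => 7 | LQ => 8 | LN => 9 | LL => 10
  end.

Definition letter_eqb (a b : letter) : bool :=
  Nat.eqb (letter_code a) (letter_code b).

Lemma letter_eqbP (a b : letter) : letter_eqb a b -> a = b.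
Proof. by case: a; case: b. Qed.

(* Moves [s], then [rho], to the left, the degree operator to the right, and
   rewrites [d iota] as [L - iota d], where [L] commutes with [d]. *)
Definition letter_rule {K : numFieldType} (dm : K) (a b : letter) :
    option (seq (K * seq letter)) :=
  match a, b with
  | Ld, Ld | Ldel, Ldel | Lnu, Lnu | Liota, Liota => Some [::]
  | Ld, Ls => Some [:: (1, [:: Ls; Ld]); (1, [:: Lnu])]
  | Ldel, Ls => Some [:: (1, [:: Ls; Ldel]); (1, [:: Liota])]
  | Lnu, Ls => Some [:: (1, [:: Ls; Lnu])]
  | Liota, Ls => Some [:: (1, [:: Ls; Liota])]
  | Lrho, Ls => Some [:: (1, [:: Ls; Lrho])]
  | LQ, Ls => Some [:: (1, [:: Ls; LQ])]
  | Ld, Lrho => Some [:: (1, [:: Lrho; Ld]); (1, [:: Ldrho])]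
  | Ldel, Lrho => Some [:: (1, [:: Lrho; Ldel]); (1, [:: Lgrho])]
  | Lnu, Lrho => Some [:: (1, [:: Lrho; Lnu])]
  | Liota, Lrho => Some [:: (1, [:: Lrho; Liota])]
  | LQ, Lrho => Some [:: (1, [:: Lrho; LQ])]
  | Ld, Lnu => Some [:: (-1, [:: Lnu; Ld])]
  | Ldel, Liota => Some [:: (-1, [:: Liota; Ldel])]
  | Liota, Lnu =>
      Some [:: (1, [::]); (-2, [:: Ls; Lrho]); (-1, [:: Lnu; Liota])]
  | Ld, Liota => Some [:: (1, [:: LL]); (-1, [:: Liota; Ld])]
  | Ldel, Lnu => Some [:: (1, [:: LL]); (-1, [:: Lnu; Ldel]);
      (-1, [:: Ls; LQ]); (2, [:: Lrho; LN]); (- dm, [:: Lrho])]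
  | LQ, Lnu => Some [:: (1, [:: Lnu; LQ]); (-2, [:: Ldrho])]
  | LQ, Liota => Some [:: (1, [:: Liota; LQ]); (2, [:: Lgrho])]
  | Ld, LL => Some [:: (1, [:: LL; Ld])]
  | Ldel, LL => Some [:: (1, [:: LL; Ldel]); (1, [:: Liota; LQ]);
      (1, [:: Ls; Ldel; LQ]); (-1, [:: Ls; LQ; Ldel]); (-2, [:: Lgrho; LN]);
      (dm, [:: Lgrho]); (-2, [:: Lrho; Ldel])]
  | LN, Ld => Some [:: (1, [:: Ld; LN]); (1, [:: Ld])]
  | LN, Ldel => Some [:: (1, [:: Ldel; LN]); (-1, [:: Ldel])]
  | LN, Lnu => Some [:: (1, [:: Lnu; LN]); (1, [:: Lnu])]
  | LN, Liota => Some [:: (1, [:: Liota; LN]); (-1, [:: Liota])]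
  | LN, LQ => Some [:: (1, [:: LQ; LN])]
  | LN, Ls => Some [:: (1, [:: Ls; LN])]
  | LN, Lrho => Some [:: (1, [:: Lrho; LN])]
  | _, _ => None
  end.

Section TractorCalculus.
Context {K : numFieldType} {V : lmodType K} {dm : K}.
Variable C : form_calculus V dm.
Local Notation d := (fd C).
Local Notation del := (fdel C).
Local Notation nu := (fnu C).
Local Notation iota := (fiota C).
Local Notation s := (fs C).
Local Notation rho := (frho C).
Local Notation drho := (fdrho C).
Local Notation grho := (fgrho C).
Local Notation Q := (fQ C).
Local Notation N := (fN C).

(** The Lie derivative along the gradient of sigma, by Cartan's formula. It is made a letter to
    complete the rewriting system: the word [del del nu] can be reduced in two ways, and they agree
    only once [del] can be moved past it. *)
Definition flie : {linear V -> V} := (d \o iota) \+ (iota \o d).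

Lemma flieE F : flie F = d (iota F) + iota (d F).
Proof. by []. Qed.

Definition letter_act (a : letter) : {linear V -> V} :=
  match a with
  | Ld => d | Ldel => del | Lnu => nu | Liota => iota | Ls => s
  | Lrho => rho | Ldrho => drho | Lgrho => grho | LQ => Q | LN => N
  | LL => flie
  end.

(* Applying [del] to [fdel_nu] computes [del (flie F)]. *)
Lemma fdel_lie F : del (flie F) = flie (del F) + iota (Q F) + s (del (Q F))
  - s (Q (del F)) - 2 *: grho (N F) + dm *: grho F - 2 *: rho (del F).
Proof.
have LE X : flie X = del (nu X) + nu (del X) + s (Q X) - 2 *: rho (N X) + dm *: rho X.
  by rewrite fdel_nu flieE; lin.
rewrite !LE !(linearD del) !(linearN del) !(linearZZ del) !fdel_del !fdel_s.
rewrite !fdel_rho fN_del (linearB rho) (linear0 nu); lin.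
Qed.

Lemma fd_lie F : d (flie F) = flie (d F).
Proof. by rewrite !flieE (linearD d) !fd_d linear0 addr0 add0r. Qed.

Lemma fd_iota F : d (iota F) = flie F - iota (d F).
Proof. by rewrite flieE addrK. Qed.

Lemma letter_ruleP (a b : letter) r x : letter_rule dm a b = Some r ->
  letter_act a (letter_act b x)
  = \sum_(t <- r) t.1 *: word_act letter_act t.2 x.
Proof.
case: a; case: b => //= -[<-]; rewrite !(big_nil, big_cons) /word_act;
  cbn [fst snd foldr letter_act];
  first [ rewrite fd_d
     | rewrite fdel_del
     | rewrite fd_s
     | rewrite fdel_s
     | rewrite fnu_s
     | rewrite fiota_s
     | rewrite frho_s
     | rewrite fQ_s
     | rewrite fN_s
     | rewrite fd_rho
     | rewrite fdel_rho
     | rewrite fnu_rho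
     | rewrite fiota_rho
     | rewrite fQ_rho
     | rewrite fN_rho
     | rewrite fd_nu
     | rewrite fdel_iota
     | rewrite fnu_nu
     | rewrite fiota_iota
     | rewrite fiota_nu
     | rewrite fQ_nu
     | rewrite fQ_iota
     | rewrite fN_d
     | rewrite fN_del
     | rewrite fN_nu
     | rewrite fN_iota
     | rewrite fN_Q
     | rewrite fd_lie
     | rewrite fdel_lie
     | rewrite fd_iota
     | rewrite fdel_nu flieE]; lin.
Qed.

Local Notation T := (V * V * V * V)%type.

(** The operators [lX], [lI], [lD], ... over an abstract module, with weight and degree in [K] so
    that [ring] may treat both as indeterminates. *)
Definition aX (t : T) : T := let: (n, w, e, z) := t in (0, 0, - n, w).
Definition aXs (t : T) : T := let: (n, w, e, z) := t in (0, n, 0, e).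
Definition aS (t : T) : T := let: (n, w, e, z) := t in (s n, s w, s e, s z).
Definition aI (t : T) : T := let: (n, w, e, z) := t in
  (- nu n + s w, nu w, - rho n + nu e + s z, rho w - nu z).
Definition aIs (t : T) : T := let: (n, w, e, z) := t in
  (- iota n - s e, rho n + iota w + s z, iota e, rho e - iota z).
Definition lap (F : V) : V := d (del F) + del (d F).
Definition aD (w k : K) (t : T) : T := let: (n, f, e, z) := t in
  ((dm + 2 * w - 2) *: ((w + k) *: f - d n),
   (dm + 2 * w - 2) *: d f,
   lap n + (w + k - 2) *: Q n - 2 *: del f
     + (dm + 2 * w) *: (d e + (w + k - 2) *: z),
   (Q (d n) - d (Q n)) - (lap f + (w + k) *: Q f) - (dm + 2 * w) *: d z).
Definition aDs (w k : K) (t : T) : T := let: (n, f, e, z) := t in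
  (- (dm + 2 * w - 2) *: (del n + (dm + w - k + 2) *: e),
   - lap n + (dm + w - k) *: Q n + (dm + 2 * w) *: del f - 2 *: d e
     + ((dm + 2 * w) * (dm + w - k)) *: z,
   (dm + 2 * w - 2) *: del e,
   (Q (del n) - del (Q n)) + (- lap e + (dm + w - k + 2) *: Q e)
     - (dm + 2 * w) *: del z).
Definition ay (w k : K) (t : T) : T := - (aIs (aD w k t) + aD w (k - 1) (aIs t)).

Definition of_degree (k : K) (t : T) : Prop := let: (n, f, e, z) := t in
  [/\ N n = (k - 1) *: n, N f = k *: f, N e = (k - 2) *: e & N z = (k - 1) *: z].

Definition slot_degree (k : K) (i : nat) : K :=
  match i with 0 => k - 1 | 1 => k | 2 => k - 2 | _ => k - 1 end.

Definition slot_eigen (k : K) (a : letter) (i : nat) : option K :=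
  if a is LN then Some (slot_degree k i) else None.

Lemma slot_eigenP (k : K) (n f e z : V) (a : letter) (i : nat) (c : K) :
  of_degree k (n, f, e, z) -> slot_eigen k a i = Some c ->
  letter_act a [:: n; f; e; z]`_i = c *: [:: n; f; e; z]`_i.
Proof.
move=> [Nn Nf Ne Nz]; case: a => //= -[<-].
(* Beyond the fourth slot [nth] returns 0, which is an eigenvector for any value. *)
by case: i => [|[|[|[|i]]]] //=; rewrite nth_nil linear0 scaler0.
Qed.

Definition slots_eq (n f e z : V) (k : K) (deg : of_degree k (n, f, e, z)) :=
  @normal_order_eq K V letter letter_eqb letter_eqbP letter_act
    (letter_rule dm) (slot_eigen k) [:: n; f; e; z] letter_ruleP
    (fun a i c => @slot_eigenP k n f e z a i c deg).

End TractorCalculus.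

Ltac letter_of f :=
  lazymatch f with
  | fd _ => constr:(Ld) | fdel _ => constr:(Ldel) | fnu _ => constr:(Lnu)
  | fiota _ => constr:(Liota) | fs _ => constr:(Ls) | frho _ => constr:(Lrho)
  | fdrho _ => constr:(Ldrho) | fgrho _ => constr:(Lgrho)
  | fQ _ => constr:(LQ) | fN _ => constr:(LN)
  end.
Ltac calc deg :=
  lazymatch type of deg with
  | of_degree _ _ (?n, ?f, ?e, ?z) =>
    lazymatch goal with
    | |- @eq ?T ?a ?b =>
      let env := constr:([:: n; f; e; z]) in
      let x := op_reify letter_of a env in
      let y := op_reify letter_of b env in
      apply: (@slots_eq _ _ _ _ _ _ _ _ _ deg x y);
      cbv [vanish normalize terms step map cat flatten filter same_key eqw foldr
           Nat.eqb fst snd letter_eqb letter_code letter_rule slot_eigen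
           slot_degree];
      repeat split; ring
    end
  end.

Section Slots.
Context {K : numFieldType} {V : lmodType K}.
Local Notation T := (V * V * V * V)%type.

Lemma slotsD (a b c d a' b' c' d' : V) :
  (a, b, c, d) + (a', b', c', d') = (a + a', b + b', c + c', d + d') :> T.
Proof. by []. Qed.

Lemma slotsN (a b c d : V) : - (a, b, c, d) = (- a, - b, - c, - d) :> T.
Proof. by []. Qed.

Lemma slotsZ (x : K) (a b c d : V) :
  x *: (a, b, c, d) = (x *: a, x *: b, x *: c, x *: d) :> T.
Proof. by []. Qed.

Lemma slots0 : 0 = (0, 0, 0, 0) :> T.
Proof. by []. Qed.

Lemma slots_ext (a b c d a' b' c' d' : V) : a = a' -> b = b' -> c = c' -> d = d' ->
  (a, b, c, d) = (a', b', c', d') :> T.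
Proof. by move=> -> -> -> ->. Qed.

End Slots.

Ltac by_slots :=
  rewrite ?/ay; cbn [ay aX aXs aS aI aIs aD aDs lap];
  repeat progress (rewrite ?slots0 ?slotsD ?slotsN ?slotsZ;
    cbn [ay aX aXs aS aI aIs aD aDs lap]);
  rewrite /lap; apply: slots_ext; cbn [fst snd].

(** * Relations between the tractor operators *)

Section Relations.
Context {K : numFieldType} {V : lmodType K} {dm : K}.
Variable C : form_calculus V dm.
Local Notation T := (V * V * V * V)%type.

Lemma aD_aD (w k : K) (t : T) : of_degree C k t -> aD C (w - 1) (k + 1) (aD C w k t) = 0.
Proof.
case: t => [[[n f] e] z] deg; by_slots.
all: calc deg.
Qed.
Lemma aDs_aDs (w k : K) (t : T) : of_degree C k t -> aDs C (w - 1) (k - 1) (aDs C w k t) = 0.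
Proof.
case: t => [[[n f] e] z] deg; by_slots.
all: calc deg.
Qed.

(** The second formula for y, on which the starred half rests: it makes y commute with [aI] just as
    the definition makes it commute with [aIs], and it lets one and the same y serve both
    families. *)
Lemma ay_adjoint (w k : K) (t : T) : of_degree C k t ->
  ay C w k t = - (aI C (aDs C w k t) + aDs C w (k + 1) (aI C t)).
Proof.
case: t => [[[n f] e] z] deg; by_slots.
all: calc deg.
Qed.

Lemma aD_aS (w k : K) (t : T) : of_degree C k t ->
  (dm + 2 * w - 2) *: aD C (w + 1) k (aS C t)
  = (dm + 2 * w) *: aS C (aD C w k t) + 2 *: aX (ay C w k t)
    + ((dm + 2 * w) * (dm + 2 * w - 2)) *: aI C t.
Proof.
case: t => [[[n f] e] z] deg; by_slots.
all: calc deg.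
Qed.

Lemma aDs_aS (w k : K) (t : T) : of_degree C k t ->
  (dm + 2 * w - 2) *: aDs C (w + 1) k (aS C t)
  = (dm + 2 * w) *: aS C (aDs C w k t) + 2 *: aXs (ay C w k t)
    + ((dm + 2 * w) * (dm + 2 * w - 2)) *: aIs C t.
Proof.
case: t => [[[n f] e] z] deg; by_slots.
all: calc deg.
Qed.

(** [aX] keeps only the north and west slots of [aD], which carry the factor h - 2; the terms of
    [aD] that see the output of [aX] carry the factor h + 2 of the raised weight. *)
Lemma aD_aX (w k : K) (t : T) : of_degree C k t ->
  (dm + 2 * w - 2) *: aD C (w + 1) (k + 1) (aX t)
  = - (dm + 2 * w + 2) *: aX (aD C w k t).
Proof. by case: t => [[[n f] e] z] deg; by_slots; calc deg. Qed.

Lemma aDs_aXs (w k : K) (t : T) : of_degree C k t ->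
  (dm + 2 * w - 2) *: aDs C (w + 1) (k - 1) (aXs t)
  = - (dm + 2 * w + 2) *: aXs (aDs C w k t).
Proof. by case: t => [[[n f] e] z] deg; by_slots; calc deg. Qed.

Lemma aX_aIs (k : K) (t : T) : of_degree C k t ->
  aX (aIs C t) + aIs C (aX t) = aS C t.
Proof. by case: t => [[[n f] e] z] deg; by_slots; calc deg. Qed.

Lemma aXs_aI (k : K) (t : T) : of_degree C k t ->
  aXs (aI C t) + aI C (aXs t) = aS C t.
Proof. by case: t => [[[n f] e] z] deg; by_slots; calc deg. Qed.

Lemma aI_aI (k : K) (t : T) : of_degree C k t -> aI C (aI C t) = 0.
Proof. by case: t => [[[n f] e] z] deg; by_slots; calc deg. Qed.

Lemma aIs_aIs (k : K) (t : T) : of_degree C k t -> aIs C (aIs C t) = 0.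
Proof. by case: t => [[[n f] e] z] deg; by_slots; calc deg. Qed.

(** The scale tractor has length one; on slots this is [fiota_nu]. *)
Lemma aI_aIs (k : K) (t : T) : of_degree C k t ->
  aI C (aIs C t) + aIs C (aI C t) = t.
Proof. by case: t => [[[n f] e] z] deg; by_slots; calc deg. Qed.

End Relations.

(** * Powers of y *)

(* The relations common to (X, I, I*, D) and (X*, I*, I, D-star), which are
   (lXX, lII, lJJ, lDD); the operators lXX and lDD change the degree by [e]. *)
Record ladder (K : numFieldType) (T : lmodType K) (dm e : K) := Ladder {
  ldeg : K -> T -> Prop;
  lS : {linear T -> T};
  lXX : {linear T -> T};
  lII : {linear T -> T};
  lJJ : {linear T -> T};
  lDD : K -> K -> {linear T -> T};
  lyy : K -> K -> {linear T -> T};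
  ldeg_J : forall k f, ldeg k f -> ldeg (k - e) (lJJ f);
  ldeg_S : forall k f, ldeg k f -> ldeg k (lS f);
  ldeg_X : forall k f, ldeg k f -> ldeg (k + e) (lXX f);
  ldeg_D : forall w k f, ldeg k f -> ldeg (k + e) (lDD w k f);
  ldeg_y : forall w k f, ldeg k f -> ldeg k (lyy w k f);
  lyyE : forall w k f, ldeg k f ->
    lyy w k f = - (lJJ (lDD w k f) + lDD w (k - e) (lJJ f));
  lJJ_J : forall k f, ldeg k f -> lJJ (lJJ f) = 0;
  lDD_D : forall w k f, ldeg k f -> lDD (w - 1) (k + e) (lDD w k f) = 0;
  lXX_J : forall k f, ldeg k f -> lXX (lJJ f) + lJJ (lXX f) = lS f;
  lDD_X : forall w k f, ldeg k f ->
    (dm + 2 * w - 2) *: lDD (w + 1) (k + e) (lXX f)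
    = - (dm + 2 * w + 2) *: lXX (lDD w k f);
  lDD_S : forall w k f, ldeg k f ->
    (dm + 2 * w - 2) *: lDD (w + 1) k (lS f)
    = (dm + 2 * w) *: lS (lDD w k f) + 2 *: lXX (lyy w k f)
      + ((dm + 2 * w) * (dm + 2 * w - 2)) *: lII f;
  lyy_I : forall w k f, ldeg k f -> lyy w (k + e) (lII f) = lII (lyy w k f);
  lJJ_I : forall k f, ldeg k f -> lJJ (lII f) + lII (lJJ f) = f;
  lJJ_S : forall f, lJJ (lS f) = lS (lJJ f)
}.

Section Ladder.
Context {K : numFieldType} {T : lmodType K} {dm e : K}.
Variable Y : ladder T dm e.
Local Notation G := (ldeg Y).
Local Notation S := (lS Y).
Local Notation X := (lXX Y).
Local Notation I := (lII Y).
Local Notation J := (lJJ Y).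
Local Notation D := (lDD Y).
Local Notation y := (lyy Y).

Lemma scale_cancel (a : K) (u v : T) : a != 0 -> a *: u = a *: v -> u = v.
Proof. by move=> a0 /(congr1 ( *:%R a^-1)); rewrite !scalerA mulVf // !scale1r. Qed.

(** y is minus the anticommutator of [J] and [D]; as [D] squares to zero, both orders give - D J
    D. *)
Lemma y_D w k f : G k f -> y (w - 1) (k + e) (D w k f) = D (w - 1) k (y w k f).
Proof.
move=> Gf; rewrite !lyyE //; last exact: ldeg_D.
rewrite addrK (lDD_D _ Gf) linear0 add0r linearN linearD.
have := lDD_D w (ldeg_J Gf); rewrite subrK => ->.
by rewrite addr0.
Qed.

Lemma y_J w k f : G k f -> y w (k - e) (J f) = J (y w k f).
Proof.
move=> Gf; rewrite !lyyE //; last exact: ldeg_J.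
rewrite (lJJ_J Gf) linear0 addr0 linearN linearD.
by rewrite (lJJ_J (ldeg_D w Gf)) add0r.
Qed.

(** After [lDD_S] the two terms in [X] combine by X J + J X = S, and the two terms in [I] by J I + I
    J = 1. The value h = 2 is excluded because [lDD_S] determines D S only up to the factor h -
    2. *)
Lemma y_S w k f : dm + 2 * w != 2 -> G k f ->
  y (w + 1) k (S f) = S (y w k f) - (dm + 2 * w) *: f.
Proof.
move=> h2 Gf; have h20 : dm + 2 * w - 2 != 0 by rewrite subr_eq0.
have GJ := ldeg_J Gf; have Gy := ldeg_y w Gf.
apply: (scale_cancel h20); rewrite lyyE; last exact: ldeg_S.
rewrite lJJ_S scalerN scalerDr -(linearZZ J) (lDD_S w Gf) (lDD_S w GJ).
rewrite (y_J _ Gf) !(linearD J) !(linearZZ J) lJJ_S.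
have -> : J (X (y w k f)) = S (y w k f) - X (J (y w k f)).
  by rewrite -(lXX_J Gy); lin.
have -> : J (I f) = f - I (J f) by rewrite -{2}(lJJ_I Gf) addrK.
rewrite (lyyE w Gf) !(linearN S) !(linearD S).
by lin.
Qed.

(** The start of the induction on the power of y. The factor h - 2 is the one under which [lDD_S]
    and [lDD_X] are known. *)
Lemma y_X w k f : G k f ->
  (dm + 2 * w - 2) *: y (w + 1) (k + e) (X f)
  = (dm + 2 * w) *: X (y w k f) - ((dm + 2 * w) * (dm + 2 * w - 2)) *: I f
    + 2 *: S (D w k f).
Proof.
move=> Gf; rewrite !lyyE //; last exact: ldeg_X.
have DX := lDD_X w Gf.
have DXJ := lDD_X w (ldeg_J Gf); rewrite subrK in DXJ.
have JX g j : G j g -> J (X g) = S g - X (J g).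
  by move=> Gg; rewrite -(lXX_J Gg); lin.
have DS := lDD_S w Gf.
rewrite addrK (JX _ _ Gf) (linearB (D _ _)) scalerN scalerDr scalerBr DXJ DS.
rewrite -(linearZZ J) DX (linearZZ J) (JX _ _ (ldeg_D w Gf)).
rewrite (lyyE _ Gf) !(linearN X) !(linearD X).
by lin.
Qed.
Lemma y_X_div w k f : G k f -> dm + 2 * w - 2 != 0 ->
  let h := dm + 2 * w in
  y (w + 1) (k + e) (X f)
  = (h / (h - 2)) *: X (y w k f) - h *: I f + (2 / (h - 2)) *: S (D w k f).
Proof.
move=> Gf h2 h; apply: (scale_cancel h2); rewrite y_X // -/h.
by rewrite !scalerDr !scalerN !scalerA; lin_coefs; field.
Qed.

Lemma subr1n (w : K) (m : nat) : w - 1 - m%:R = w - m.+1%:R.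
Proof. by rewrite -addrA -opprD nat1r. Qed.

Fixpoint ypow (w k : K) (m : nat) (f : T) : T :=
  if m is m'.+1 then ypow (w - 1) k m' (y w k f) else f.

Lemma ldeg_ypow w k m f : G k f -> G k (ypow w k m f).
Proof. by elim: m w f => [//|m IH] w f Gf /=; apply/IH/ldeg_y. Qed.

Lemma ypowSr w k m f : ypow w k m.+1 f = y (w - m%:R) k (ypow w k m f).
Proof.
elim: m w f => [|m IH] w f; first by rewrite /= subr0.
by rewrite -[LHS]/(ypow (w - 1) k m.+1 (y w k f)) IH /= subr1n.
Qed.

Lemma ypow_add w k a b f :
  ypow w k (a + b) f = ypow (w - a%:R) k b (ypow w k a f).
Proof.
elim: a w f => [|a IH] w f; first by rewrite subr0.
by rewrite addSn /= IH subr1n.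
Qed.

Lemma ypow_D w k m f : G k f ->
  ypow (w - 1) (k + e) m (D w k f) = D (w - m%:R) k (ypow w k m f).
Proof.
elim: m w f => [|m IH] w f Gf /=; first by rewrite subr0.
rewrite y_D // IH; last exact: ldeg_y.
by rewrite subr1n.
Qed.

Lemma ypow_I w k m f : G k f -> ypow w (k + e) m (I f) = I (ypow w k m f).
Proof.
by elim: m w f => [//|m IH] w f Gf /=; rewrite lyy_I // IH //; apply: ldeg_y.
Qed.

(** D y^(m-1), shifted by one so that it makes sense at m = 0; the value 0 there is met only with
    the coefficient m (m + 1) of the commutation formula, which vanishes as well. *)
Definition Dypow (w k : K) (m : nat) (f : T) : T :=
  if m is m'.+1 then D (w - m'%:R) k (ypow w k m' f) else 0.

Lemma y_Dypow w k m f : G k f ->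
  y (w - m.+1%:R) (k + e) (Dypow w k m.+1 f) = Dypow w k m.+2 f.
Proof.
move=> Gf; rewrite /Dypow -natr1 opprD addrA y_D; last exact: ldeg_ypow.
by rewrite ypowSr.
Qed.

Lemma ypow_X w k m f : G k f ->
  (forall j : nat, dm + 2 * w - 2 * j%:R != 0) ->
  let h := dm + 2 * w in
  ypow (w + 1) (k + e) m.+1 (X f)
  = (h / (h - 2 * m.+1%:R)) *: X (ypow w k m.+1 f)
    - (m.+1%:R * h) *: I (ypow w k m f)
    + (2 * m.+1%:R / (h - 2 * m.+1%:R)) *: S (Dypow w k m.+1 f)
    - (m.+1%:R * m%:R) *: Dypow w k m f.
Proof.
move=> Gf hn0 h; elim: m => [|m IH].
  have := hn0 1; rewrite mulr1 => h2.
  by rewrite /= y_X_div // subr0 -/h; lin_coefs; field; rewrite -/h ?mulr1.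
have hm (j : nat) : h - 2 * j%:R != 0 by exact: hn0.
have hE : dm + 2 * (w - m.+1%:R) = h - 2 * m.+1%:R by rewrite /h; ring.
have h2E : h - 2 * m.+1%:R - 2 = h - 2 * m.+2%:R by rewrite -[m.+2%:R]natr1; ring.
have wE : w + 1 - m.+1%:R = w - m.+1%:R + 1 by ring.
rewrite ypowSr IH wE; set g := ypow w k m.+1 f.
have Gg : G k g by exact: ldeg_ypow.
rewrite !(linearD (y _ _)) !(linearN (y _ _)) !(linearZZ (y _ _)).
have yX := y_X_div (w := w - m.+1%:R) Gg; rewrite hE h2E in yX.
have GZ : G (k + e) (Dypow w k m.+1 f) by exact/ldeg_D/ldeg_ypow.
(* Here h has dropped to h - 2(m + 1), so the value excluded in [y_S] is the case j = m + 2 of the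
   hypothesis on denominators. *)
have yS := y_S (w := w - m.+1%:R) _ GZ; rewrite hE -subr_eq0 h2E in yS.
rewrite yX ?yS //; have -> : w - m.+1%:R + 1 = w - m%:R by rewrite -natr1; ring.
rewrite lyy_I; last exact: ldeg_ypow.
rewrite -ypowSr -/g y_Dypow // -ypowSr.
have -> : D (w - m.+1%:R) k g = Dypow w k m.+2 f by [].
have -> : (m.+1%:R * m%:R) *: y (w - m%:R) (k + e) (Dypow w k m f)
    = (m.+1%:R * m%:R) *: Dypow w k m.+1 f.
  by case: (m) => [|m']; [rewrite mulr0 !scale0r | rewrite y_Dypow].
move: (hm m.+1) (hm m.+2); rewrite -[m.+2%:R]natr1 -[m.+1%:R]natr1 => h1 h2.
have h3 : h - 2 * (m%:R + 1) - 2 != 0.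
  by rewrite (_ : _ - 2 = h - 2 * (m%:R + 1 + 1)) //; ring.
by lin_coefs; field; rewrite -/h ?h3 h1.
Qed.

Lemma ypowD w k m f g : ypow w k m (f + g) = ypow w k m f + ypow w k m g.
Proof. by elim: m w f g => [//|m IH] w f g /=; rewrite linearD IH. Qed.

Lemma ypowZ w k m a f : ypow w k m (a *: f) = a *: ypow w k m f.
Proof. by elim: m w f => [//|m IH] w f /=; rewrite linearZZ IH. Qed.

(** The generic branch alone. The exceptional weight h = 3 is treated where [lDbar] itself
    appears. *)
Definition Dbar (w k : K) (f : T) : T :=
  let h := dm + 2 * w in
  ((h - 3) / (h - 2)) *:
    (D w k f + I (y w k f) + ((h - 3) * (h - 4))^-1 *: X (ypow w k 2 f)).

(* Along the boundary [S], which is multiplication by the defining density,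
   vanishes. *)
Lemma X_ypow_Dbar w k m f : G k f ->
  dm + 2 * w = m.+4%:R ->
  (forall j : nat, dm + 2 * w - 2 * j%:R != 0) ->
  exists u, X (ypow w k m.+3 f)
    = - (dm + 2 * w - 2) ^+ 2 *: ypow (w - 1) (k + e) m.+1 (Dbar w k f) + S u.
Proof.
(* For m = 0 one has h = 4, a zero of the denominator h - 4 of [Dbar]; the hypothesis with j = 2
   rules it out. *)
case: m => [|m] Gf hE hn0; first by have := hn0 2; rewrite hE -natrM subrr eqxx.
set g := ypow w k 2 f; have Gg : G k g by exact: ldeg_ypow.
have hg (j : nat) : dm + 2 * (w - 2) - 2 * j%:R != 0.
  by rewrite (_ : _ - _ = dm + 2 * w - 2 * j.+2%:R) // -addn2 natrD; ring.
have gE (j : nat) : ypow (w - 2) k j g = ypow w k j.+2 f by rewrite -(ypow_add w k 2).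
have w2E : w - 2 + 1 = w - 1 by ring.
have wE : w - 2 - m%:R = w - m.+2%:R by rewrite -addn2 natrD; ring.
(* At y^2 f the number h is lowered to h - 4, and the power of y is h - 3, so [I] and [D] both get
   the coefficient -(h - 3)(h - 4). After division by (h - 3)(h - 4) they cancel the terms D + I y
   of [Dbar], and X y^(h-1) remains with the factor -1/(h - 2)^2. *)
have := ypow_X m.+1 Gg hg; rewrite w2E !gE /Dypow wE !gE => yXg.
rewrite /Dbar ypowZ !ypowD ypowZ ypow_D // ypow_I; last exact: ldeg_y.
rewrite -/g yXg.
have -> : ypow (w - 1) k m.+2 (y w k f) = ypow w k m.+3 f by [].
have hgE : dm + 2 * (w - 2) = m.+1%:R.
  by rewrite mulrBr addrA hE -addn4 natrD; ring.
rewrite hE hgE.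
have E2 : m.+1.+4%:R - 2 = m%:R + 3 :> K by rewrite -addn4 -addn1 !natrD; ring.
have E3 : m.+1.+4%:R - 3 = m%:R + 2 :> K by rewrite -addn4 -addn1 !natrD; ring.
have E4 : m.+1.+4%:R - 4 = m%:R + 1 :> K by rewrite -addn4 -addn1 !natrD; ring.
have Eg : m.+1%:R - 2 * m.+2%:R = - (m%:R + 3) :> K.
  by rewrite -addn2 -addn1 !natrD; ring.
have n1 : m%:R + 1 != 0 :> K by rewrite natr1 pnatr_eq0.
have n2 : m%:R + 2 != 0 :> K by rewrite -natrD pnatr_eq0 addn2.
have n3 : m%:R + 3 != 0 :> K by rewrite -natrD pnatr_eq0 addn3.
rewrite E2 E3 E4 Eg -[m.+2%:R]natr1 -[m.+1%:R]natr1.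
(* Chosen to cancel the term in [S] of the commutation formula. *)
exists ((- 2 * (m%:R + 2) / (m%:R + 1)) *:
  D (w - 2 - (m%:R + 1)) k (ypow w k m.+3 f)).
by rewrite (linearZZ S); lin_coefs; field; rewrite ?n1 ?n2 ?n3.
Qed.

(** With power m + 2 and h = m + 1, both [I] and [D] have the coefficient -(m + 1)(m + 2) and [X]
    has -(m + 1)/(m + 3). Up to the term in [S] this is -(m + 1)^2 times [Dbar] at the weight
    reached after m steps, where h has become 1 - m. *)
Lemma ypow_X_Dbar w k m f : G k f ->
  dm + 2 * w = m.+1%:R ->
  (forall j : nat, dm + 2 * w - 2 * j%:R != 0) ->
  exists u, ypow (w + 1) (k + e) m.+2 (X f)
    = - (dm + 2 * w) ^+ 2 *: Dbar (w - m%:R) k (ypow w k m f) + S u.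
Proof.
move=> Gf hE hn0; rewrite (ypow_X m.+1 Gf hn0) /Dbar.
have -> : dm + 2 * (w - m%:R) = 1 - m%:R.
  by rewrite mulrBr addrA hE -natr1; ring.
have -> : ypow (w - m%:R) k 2 (ypow w k m f) = ypow w k m.+2 f.
  by rewrite -ypow_add addn2.
rewrite hE -ypowSr /Dypow.
have n1 : m%:R + 1 != 0 :> K by rewrite natr1 pnatr_eq0.
have n2 : m%:R + 2 != 0 :> K by rewrite -natrD pnatr_eq0 addn2.
have n3 : m%:R + 3 != 0 :> K by rewrite -natrD pnatr_eq0 addn3.
rewrite -[m.+2%:R]natr1 -[m.+1%:R]natr1.
exists ((- 2 * (m%:R + 2) / (m%:R + 3)) *:
  D (w - (m%:R + 1)) k (ypow w k m.+1 f)).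
have E1 : m%:R + 1 - 2 * (m%:R + 1 + 1) = - (m%:R + 3) :> K by ring.
have E2 : 1 - m%:R - 3 = - (m%:R + 2) :> K by ring.
have E3 : 1 - m%:R - 2 = - (m%:R + 1) :> K by ring.
by rewrite (linearZZ S); lin_coefs; field; rewrite ?E1 ?E2 ?E3 ?oppr_eq0 ?n1 ?n2 ?n3.
Qed.
End Ladder.

Section TractorLadders.
Context {K : numFieldType} {V : lmodType K} {dm : K}.
Variable C : form_calculus V dm.
Local Notation T := (V * V * V * V)%type.

Let aS_linear : linear (aS C).
Proof.
move=> a [[[n f] e] z] [[[n' f'] e'] z']; by_slots; rewrite linearP; lin.
Qed.
HB.instance Definition _ := GRing.isLinear.Build K T T _ (aS C) aS_linear.

Let aX_linear : linear (@aX K V).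
Proof. by move=> a [[[n f] e] z] [[[n' f'] e'] z']; by_slots; lin. Qed.
HB.instance Definition _ := GRing.isLinear.Build K T T _ (@aX K V) aX_linear.

Let aXs_linear : linear (@aXs K V).
Proof. by move=> a [[[n f] e] z] [[[n' f'] e'] z']; by_slots; lin. Qed.
HB.instance Definition _ := GRing.isLinear.Build K T T _ (@aXs K V) aXs_linear.

Let aI_linear : linear (aI C).
Proof.
move=> a [[[n f] e] z] [[[n' f'] e'] z']; by_slots;
  rewrite ?(linearP (fnu C)) ?(linearP (fs C)) ?(linearP (frho C)); lin.
Qed.
HB.instance Definition _ := GRing.isLinear.Build K T T _ (aI C) aI_linear.

Let aIs_linear : linear (aIs C).
Proof.
move=> a [[[n f] e] z] [[[n' f'] e'] z']; by_slots;
  rewrite ?(linearP (fiota C)) ?(linearP (fs C)) ?(linearP (frho C)); lin.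
Qed.
HB.instance Definition _ := GRing.isLinear.Build K T T _ (aIs C) aIs_linear.

Let aD_linear w k : linear (aD C w k).
Proof.
move=> a [[[n f] e] z] [[[n' f'] e'] z']; by_slots;
  rewrite ?(linearP (fd C)) ?(linearP (fdel C)) ?(linearP (fQ C))
          ?(linearP (fd C)) ?(linearP (fdel C)); lin.
Qed.
HB.instance Definition _ w k :=
  GRing.isLinear.Build K T T _ (aD C w k) (aD_linear w k).

Let aDs_linear w k : linear (aDs C w k).
Proof.
move=> a [[[n f] e] z] [[[n' f'] e'] z']; by_slots;
  rewrite ?(linearP (fd C)) ?(linearP (fdel C)) ?(linearP (fQ C))
          ?(linearP (fd C)) ?(linearP (fdel C)); lin.
Qed.
HB.instance Definition _ w k :=
  GRing.isLinear.Build K T T _ (aDs C w k) (aDs_linear w k).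

Let ay_linear w k : linear (ay C w k).
Proof.
move=> a t u; rewrite /ay !linearP scalerN scalerDr opprD opprD !opprD.
by rewrite addrACA.
Qed.
HB.instance Definition _ w k :=
  GRing.isLinear.Build K T T _ (ay C w k) (ay_linear w k).

Lemma of_degree_aS k t : of_degree C k t -> of_degree C k (aS C t).
Proof. by case: t => [[[n f] e] z] deg; split; calc deg. Qed.

Lemma of_degree_aX k t : of_degree C k t -> of_degree C (k + 1) (aX t).
Proof. by case: t => [[[n f] e] z] deg; split; calc deg. Qed.

Lemma of_degree_aXs k t : of_degree C k t -> of_degree C (k - 1) (aXs t).
Proof. by case: t => [[[n f] e] z] deg; split; calc deg. Qed.

Lemma of_degree_aI k t : of_degree C k t -> of_degree C (k + 1) (aI C t).
Proof. by case: t => [[[n f] e] z] deg; split; calc deg. Qed.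

Lemma of_degree_aIs k t : of_degree C k t -> of_degree C (k - 1) (aIs C t).
Proof. by case: t => [[[n f] e] z] deg; split; calc deg. Qed.

Lemma of_degree_aD w k t : of_degree C k t -> of_degree C (k + 1) (aD C w k t).
Proof. by case: t => [[[n f] e] z] deg; split; rewrite /lap; calc deg. Qed.

Lemma of_degree_aDs w k t : of_degree C k t -> of_degree C (k - 1) (aDs C w k t).
Proof. by case: t => [[[n f] e] z] deg; split; rewrite /lap; calc deg. Qed.

Lemma of_degreeD k t u :
  of_degree C k t -> of_degree C k u -> of_degree C k (t + u).
Proof.
case: t u => [[[n f] e] z] [[[n' f'] e'] z'].
move=> [H1 H2 H3 H4] [H1' H2' H3' H4']; rewrite slotsD.
by split; rewrite linearD ?H1 ?H1' ?H2 ?H2' ?H3 ?H3' ?H4 ?H4' -scalerDr.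
Qed.

Lemma of_degreeZ k a t : of_degree C k t -> of_degree C k (a *: t).
Proof.
case: t => [[[n f] e] z] [H1 H2 H3 H4]; rewrite slotsZ.
by split; rewrite linearZZ ?H1 ?H2 ?H3 ?H4 !scalerA mulrC.
Qed.

Lemma of_degree_ay w k t : of_degree C k t -> of_degree C k (ay C w k t).
Proof.
move=> deg; rewrite /ay -scaleN1r; apply/of_degreeZ/of_degreeD.
  by rewrite -[k in of_degree C k](addrK 1); apply/of_degree_aIs/of_degree_aD.
by rewrite -[k in of_degree C k](subrK 1); apply/of_degree_aD/of_degree_aIs.
Qed.

Lemma ay_aI w k t : of_degree C k t -> ay C w (k + 1) (aI C t) = aI C (ay C w k t).
Proof.
move=> deg; rewrite !ay_adjoint //; last exact: of_degree_aI.
rewrite (aI_aI deg) linear0 addr0 (linearN (aI C)) (linearD (aI C)).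
by rewrite /= (aI_aI (of_degree_aDs w deg)) add0r.
Qed.

Lemma ay_aIs w k t : of_degree C k t -> ay C w (k - 1) (aIs C t) = aIs C (ay C w k t).
Proof.
move=> deg; rewrite /ay (aIs_aIs deg) linear0 addr0.
by rewrite (linearN (aIs C)) (linearD (aIs C)) /= (aIs_aIs (of_degree_aD w deg)) add0r.
Qed.

Lemma aIs_aS t : aIs C (aS C t) = aS C (aIs C t).
Proof.
case: t => [[[n f] e] z]; by_slots;
  rewrite ?(linearD (fs C)) ?(linearD (fs C)) ?(linearN (fs C))
    ?(linearN (fs C)) ?fiota_s ?frho_s ?fiota_s //.
Qed.

Lemma aI_aS t : aI C (aS C t) = aS C (aI C t).
Proof.
case: t => [[[n f] e] z]; by_slots;
  rewrite ?(linearD (fs C)) ?(linearD (fs C)) ?(linearN (fs C))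
    ?(linearN (fs C)) ?fnu_s ?frho_s ?fnu_s //.
Qed.

Definition tractor_ladder : ladder T dm 1 := @Ladder K T dm 1 (of_degree C)
  (aS C) (@aX K V) (aI C) (aIs C) (fun w k => aD C w k) (fun w k => ay C w k)
  of_degree_aIs of_degree_aS of_degree_aX of_degree_aD of_degree_ay
  (fun w k f _ => erefl) (@aIs_aIs _ _ _ C) (@aD_aD _ _ _ C) (@aX_aIs _ _ _ C)
  (@aD_aX _ _ _ C) (@aD_aS _ _ _ C) ay_aI
  (fun k f deg => etrans (addrC _ _) (aI_aIs deg)) aIs_aS.

Lemma of_degree_aIN k t : of_degree C k t -> of_degree C (k - -1) (aI C t).
Proof. by rewrite opprK; apply: of_degree_aI. Qed.

Lemma ay_adjointN w k t : of_degree C k t ->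
  ay C w k t = - (aI C (aDs C w k t) + aDs C w (k - -1) (aI C t)).
Proof. by rewrite opprK; apply: ay_adjoint. Qed.

(** The roles of [aI] and [aIs] are exchanged and the degree shift is -1; that y stays the same is
    [ay_adjoint]. *)
Definition tractor_ladder_star : ladder T dm (-1) := @Ladder K T dm (-1)
  (of_degree C) (aS C) (@aXs K V) (aIs C) (aI C)
  (fun w k => aDs C w k) (fun w k => ay C w k)
  of_degree_aIN of_degree_aS of_degree_aXs of_degree_aDs of_degree_ay
  ay_adjointN (@aI_aI _ _ _ C) (@aDs_aDs _ _ _ C) (@aXs_aI _ _ _ C)
  (@aDs_aXs _ _ _ C) (@aDs_aS _ _ _ C) ay_aIs
  (@aI_aIs _ _ _ C) aI_aS.

End TractorLadders.

(** * Forms over a ring of functions with commuting derivations *)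

Section Deltas.
Context {A : pzSemiRingType} {I : finType}.

Lemma sum_delta_r (f : I -> A) (i : I) : \sum_j f j * (j == i)%:R = f i.
Proof.
rewrite (bigD1 i) //= eqxx mulr1 big1 ?addr0 // => j /negbTE ->.
by rewrite mulr0.
Qed.

Lemma sum_delta_l (f : I -> A) (i : I) : \sum_j (j == i)%:R * f j = f i.
Proof.
rewrite (bigD1 i) //= eqxx mul1r big1 ?addr0 // => j /negbTE ->.
by rewrite mul0r.
Qed.

End Deltas.

Section ExteriorOperators.
Context {A : comNzRingType} {n : nat}.
Local Notation Om := {ffun {set 'I_n} -> A^o}.

Definition below (i : 'I_n) (S : {set 'I_n}) : nat := #|[set j in S | (j < i)%N]|.

Definition esgn (i : 'I_n) (S : {set 'I_n}) : A := (-1) ^+ below i S.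

Lemma esgn_sqr i S : esgn i S * esgn i S = 1.
Proof. by rewrite -expr2 sqrr_sign. Qed.

Lemma esgn_setD1 (i j : 'I_n) (S : {set 'I_n}) : j \in S ->
  esgn i S = (-1) ^+ (j < i)%N * esgn i (S :\ j).
Proof.
move=> jS; rewrite /esgn -exprD /below; congr (_ ^+ _).
have [ji|ji] := boolP (j < i)%N; last first.
  congr #|pred_of_set _|; apply/setP => l; rewrite !inE.
  by case: (eqVneq l j) => //= ->; rewrite (negbTE ji) andbF.
rewrite (cardsD1 j) !inE jS ji; congr (_ + #|pred_of_set _|)%N.
by apply/setP => l; rewrite !inE andbA.
Qed.

Lemma esgn_setU1 (i j : 'I_n) (S : {set 'I_n}) : j \notin S ->
  esgn i (j |: S) = (-1) ^+ (j < i)%N * esgn i S.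
Proof. by move=> jS; rewrite (@esgn_setD1 _ j) ?setU11 // setU1K. Qed.

Lemma esgn_self (i : 'I_n) (S : {set 'I_n}) : esgn i (S :\ i) = esgn i S.
Proof.
have [iS|iS] := boolP (i \in S); first by rewrite (esgn_setD1 i iS) ltnn mul1r.
by congr esgn; apply/setP => l; rewrite !inE; case: (eqVneq l i) => //= ->;
  rewrite (negbTE iS).
Qed.

Lemma sign_ltn_opp (i j : 'I_n) : i != j ->
  (-1) ^+ (j < i)%N = - (-1) ^+ (i < j)%N :> A.
Proof.
move=> ij; have : val i != val j by [].
by case: ltngtP => //= _ _; rewrite ?expr0 ?expr1 ?opprK.
Qed.

Definition eE (i : 'I_n) (F : Om) : Om :=
  [ffun S : {set 'I_n} => if i \in S then esgn i S * F (S :\ i) else 0].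
Definition eI (i : 'I_n) (F : Om) : Om :=
  [ffun S : {set 'I_n} => if i \in S then 0 else esgn i S * F (i |: S)].

Let eE_linear i : linear (eE i).
Proof.
move=> a F G; apply/ffunP => S; rewrite !ffunE; case: ifP => _; last by rewrite scaler0 addr0.
by rewrite mulrDr /GRing.scale /=; ring.
Qed.
HB.instance Definition _ i := GRing.isLinear.Build A Om Om _ (eE i) (eE_linear i).

Let eI_linear i : linear (eI i).
Proof.
move=> a F G; apply/ffunP => S; rewrite !ffunE; case: ifP => _; first by rewrite scaler0 addr0.
by rewrite mulrDr /GRing.scale /=; ring.
Qed.
HB.instance Definition _ i := GRing.isLinear.Build A Om Om _ (eI i) (eI_linear i).

Lemma eE_eE i j F : eE i (eE j F) = - eE j (eE i F).
Proof.
apply/ffunP => S; rewrite !ffunE !inE.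
have [<-|ij] := eqVneq i j; first by rewrite ?eqxx /=; case: ifP; rewrite ?mulr0 oppr0.
rewrite /=.
case: (boolP (i \in S)) => iS; case: (boolP (j \in S)) => jS; rewrite ?mulr0 ?oppr0 //.
rewrite (esgn_setD1 i jS) (esgn_setD1 j iS) (sign_ltn_opp ij).
have -> : S :\ i :\ j = S :\ j :\ i by apply/setP => l; rewrite !inE andbCA.
ring.
Qed.

Lemma eI_eI i j F : eI i (eI j F) = - eI j (eI i F).
Proof.
apply/ffunP => S; rewrite !ffunE !inE.
have [<-|ij] := eqVneq i j; first by rewrite ?eqxx /=; case: ifP; rewrite ?mulr0 oppr0.
rewrite /=.
case: (boolP (i \in S)) => iS; case: (boolP (j \in S)) => jS; rewrite ?mulr0 ?oppr0 //.
rewrite (esgn_setU1 j iS) (esgn_setU1 i jS) (sign_ltn_opp ij) setUCA.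
ring.
Qed.

Lemma eE_eI i j F : eE i (eI j F) = (i == j)%:R *: F - eI j (eE i F).
Proof.
apply/ffunP => S; rewrite !ffunE !inE /GRing.scale /=.
have [<-|ij] := eqVneq i j.
  case: (boolP (i \in S)) => iS /=.
    by rewrite mul1r ?eqxx subr0 setD1K // mulrA esgn_self esgn_sqr mul1r.
  rewrite ?eqxx /= setU1K // mul1r mulrA -{2}[S](setU1K iS) esgn_self.
  by rewrite esgn_sqr mul1r subrr.
rewrite mul0r sub0r /=.
case: (boolP (i \in S)) => iS; case: (boolP (j \in S)) => jS;
  rewrite ?mulr0 ?oppr0 //.
rewrite (esgn_setD1 j iS) (esgn_setU1 i jS) (sign_ltn_opp ij).
have -> : (j |: S) :\ i = j |: S :\ i.
  by apply/setP => l; rewrite !inE; case: (eqVneq l j) => //= ->; rewrite eq_sym ij.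
have := sqrr_sign A (i < j)%N; rewrite expr2; move: (_ ^+ _) => x xx.
rewrite -[LHS]mul1r -xx.
ring.
Qed.

End ExteriorOperators.

(** The canonical anticommutation relations are all that is kept of the exterior algebra until
    components reappear in [form_fermions]. *)
Record fermions (A : comNzRingType) (V : lmodType A) (n : nat) := Fermions {
  fermE : 'I_n -> {linear V -> V};
  fermI : 'I_n -> {linear V -> V};
  fermEE : forall i j F, fermE i (fermE j F) = - fermE j (fermE i F);
  fermII : forall i j F, fermI i (fermI j F) = - fermI j (fermI i F);
  fermEI : forall i j F,
    fermE i (fermI j F) = (i == j)%:R *: F - fermI j (fermE i F)
}.

Section Fermions.
Context {A : comNzRingType} {V : lmodType A} {n : nat}.
Variable Z : fermions V n.
Local Notation E := (fermE Z).
Local Notation I := (fermI Z).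

Lemma fermIE i j F : I i (E j F) = (i == j)%:R *: F - E j (I i F).
Proof. by rewrite fermEI eq_sym opprB addrCA subrr addr0. Qed.

(* [W u] is exterior multiplication by the covector [u], [C v] interior
   multiplication by the vector [v], and [op m] the derivation extending the
   endomorphism [m]. *)
Definition eW (u : 'rV[A]_n) (F : V) : V := \sum_i u 0 i *: E i F.
Definition eC (v : 'rV[A]_n) (F : V) : V := \sum_i v 0 i *: I i F.
Definition eop (m : 'M[A]_n) (F : V) : V :=
  \sum_b \sum_c m b c *: E b (I c F).

Lemma eW_linear u : linear (eW u).
Proof.
move=> a F G; rewrite /eW scaler_sumr -big_split; apply: eq_bigr => i _ /=.
by rewrite (linearD (_ i)) (linearZZ (_ i)) scalerDr !scalerA mulrC.
Qed.
HB.instance Definition _ u := GRing.isLinear.Build A V V _ (eW u) (eW_linear u).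

Lemma eC_linear u : linear (eC u).
Proof.
move=> a F G; rewrite /eC scaler_sumr -big_split; apply: eq_bigr => i _ /=.
by rewrite (linearD (_ i)) (linearZZ (_ i)) scalerDr !scalerA mulrC.
Qed.
HB.instance Definition _ u := GRing.isLinear.Build A V V _ (eC u) (eC_linear u).

Lemma eop_linear m : linear (eop m).
Proof.
move=> a F G; rewrite /eop scaler_sumr -big_split; apply: eq_bigr => b _ /=.
rewrite scaler_sumr -big_split; apply: eq_bigr => c _ /=.
rewrite (linearD (I c)) (linearD (E b)) (linearZZ (I c)) (linearZZ (E b)).
by rewrite scalerDr !scalerA mulrC.
Qed.
HB.instance Definition _ m := GRing.isLinear.Build A V V _ (eop m) (eop_linear m).

Lemma eWP a u v F : eW (a *: u + v) F = a *: eW u F + eW v F.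
Proof.
rewrite /eW scaler_sumr -big_split; apply: eq_bigr => i _ /=.
by rewrite !mxE scalerDl scalerA.
Qed.

Lemma eCP a u v F : eC (a *: u + v) F = a *: eC u F + eC v F.
Proof.
rewrite /eC scaler_sumr -big_split; apply: eq_bigr => i _ /=.
by rewrite !mxE scalerDl scalerA.
Qed.

Lemma eopP a u v F : eop (a *: u + v) F = a *: eop u F + eop v F.
Proof.
rewrite /eop scaler_sumr -big_split; apply: eq_bigr => b _ /=.
rewrite scaler_sumr -big_split; apply: eq_bigr => c _ /=.
by rewrite !mxE scalerDl scalerA.
Qed.

Lemma eW0 F : eW 0 F = 0.
Proof. by rewrite /eW big1 // => i _; rewrite mxE scale0r. Qed.
Lemma eC0 F : eC 0 F = 0.
Proof. by rewrite /eC big1 // => i _; rewrite mxE scale0r. Qed.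
Lemma eop0 F : eop 0 F = 0.
Proof. by rewrite /eop big1 // => i _; rewrite big1 // => j _; rewrite mxE scale0r. Qed.
Lemma eWD u v F : eW (u + v) F = eW u F + eW v F.
Proof. by rewrite -[u]scale1r eWP !scale1r. Qed.
Lemma eCD u v F : eC (u + v) F = eC u F + eC v F.
Proof. by rewrite -[u]scale1r eCP !scale1r. Qed.
Lemma eopD u v F : eop (u + v) F = eop u F + eop v F.
Proof. by rewrite -[u]scale1r eopP !scale1r. Qed.
Lemma eWZ a u F : eW (a *: u) F = a *: eW u F.
Proof. by rewrite -[_ *: u]addr0 eWP eW0 addr0. Qed.
Lemma eCZ a u F : eC (a *: u) F = a *: eC u F.
Proof. by rewrite -[_ *: u]addr0 eCP eC0 addr0. Qed.
Lemma eopZ a u F : eop (a *: u) F = a *: eop u F.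
Proof. by rewrite -[_ *: u]addr0 eopP eop0 addr0. Qed.
Lemma eWN u F : eW (- u) F = - eW u F.
Proof. by rewrite -[- u]scaleN1r eWZ scaleN1r. Qed.
Lemma eCN u F : eC (- u) F = - eC u F.
Proof. by rewrite -[- u]scaleN1r eCZ scaleN1r. Qed.
Lemma eopN u F : eop (- u) F = - eop u F.
Proof. by rewrite -[- u]scaleN1r eopZ scaleN1r. Qed.

Lemma eC_E v i F : eC v (E i F) = v 0 i *: F - E i (eC v F).
Proof.
rewrite /eC (linear_sum (E i)) /=.
under eq_bigr do rewrite fermIE scalerBr scalerA.
rewrite sumrB -scaler_suml sum_delta_r; congr (_ - _).
by apply: eq_bigr => j _; rewrite (linearZZ (E i)).
Qed.

Lemma eE_eC v i F : E i (eC v F) = v 0 i *: F - eC v (E i F).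
Proof. by rewrite eC_E opprB addrCA subrr addr0. Qed.

Lemma eC_eW v u F : eC v (eW u F) = (\sum_i v 0 i * u 0 i) *: F - eW u (eC v F).
Proof.
rewrite {1}/eW (linear_sum (eC v)) scaler_suml -sumrN -big_split; apply: eq_bigr => i _ /=.
by rewrite (linearZZ (eC v)) /= eC_E scalerBr scalerA mulrC.
Qed.

Lemma eW_eW_anti u v F : eW u (eW v F) = - eW v (eW u F).
Proof.
rewrite /eW -sumrN; under eq_bigr => i _.
  rewrite (linear_sum (E i)) scaler_sumr; over.
rewrite exchange_big; apply: eq_bigr => i _ /=.
rewrite (linear_sum (E i)) scaler_sumr -sumrN; apply: eq_bigr => j _ /=.
by rewrite (linearZZ (E i)) (linearZZ (E j)) fermEE !scalerN !scalerA mulrC.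
Qed.

Lemma eC_eC_anti u v F : eC u (eC v F) = - eC v (eC u F).
Proof.
rewrite /eC -sumrN; under eq_bigr => i _.
  rewrite (linear_sum (I i)) scaler_sumr; over.
rewrite exchange_big; apply: eq_bigr => i _ /=.
rewrite (linear_sum (I i)) scaler_sumr -sumrN; apply: eq_bigr => j _ /=.
by rewrite (linearZZ (I i)) (linearZZ (I j)) fermII !scalerN !scalerA mulrC.
Qed.

Lemma eC_mul u (m : 'M_n) F : eC (u *m m) F = \sum_b u 0 b *: eC (row b m) F.
Proof.
rewrite /eC; under [RHS]eq_bigr do rewrite scaler_sumr.
rewrite exchange_big; apply: eq_bigr => c _ /=.
by rewrite mxE scaler_suml; apply: eq_bigr => i _; rewrite scalerA mxE.
Qed.

Lemma eop_row m F : eop m F = \sum_b E b (eC (row b m) F).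
Proof.
apply: eq_bigr => b _; rewrite /eC (linear_sum (E b)); apply: eq_bigr => c _.
by rewrite (linearZZ (E b)) mxE.
Qed.

Lemma eop_E m i F : eop m (E i F) = E i (eop m F) + \sum_b m b i *: E b F.
Proof.
rewrite !eop_row (linear_sum (E i)) -big_split; apply: eq_bigr => b _ /=.
by rewrite eC_E (linearB (E b)) (linearZZ (E b)) mxE (fermEE Z b i) opprK addrC.
Qed.

Lemma eop_I m i F : eop m (I i F) = I i (eop m F) - eC (row i m) F.
Proof.
rewrite !eop_row (linear_sum (I i)) /=.
under [X in _ = X - _]eq_bigr do rewrite fermIE.
rewrite sumrB /=.
have -> : \sum_b (i == b)%:R *: eC (row b m) F = eC (row i m) F.
  rewrite (bigD1 i) //= eqxx scale1r big1 ?addr0 // => j /negbTE.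
  by rewrite eq_sym => ->; rewrite scale0r.
rewrite addrAC subrr sub0r -sumrN; apply: eq_bigr => b _.
rewrite -(linearN (E b)); congr (E b _).
rewrite /eC (linear_sum (I i)) -sumrN; apply: eq_bigr => c _.
by rewrite fermII (linearZZ (I i)) scalerN.
Qed.

Lemma eop_W m u F : eop m (eW u F) = eW u (eop m F) + eW (u *m m^T) F.
Proof.
rewrite {1}/eW (linear_sum (eop m)) /=.
under eq_bigr do rewrite (linearZZ (eop m)) /= eop_E scalerDr.
rewrite big_split; congr (_ + _).
under eq_bigr do rewrite scaler_sumr.
rewrite exchange_big; apply: eq_bigr => b _ /=.
rewrite mxE scaler_suml; apply: eq_bigr => i _.
by rewrite scalerA mxE.
Qed.

Lemma eop_C m v F : eop m (eC v F) = eC v (eop m F) - eC (v *m m) F.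
Proof.
rewrite {1}/eC (linear_sum (eop m)) /=.
under eq_bigr do rewrite (linearZZ (eop m)) /= eop_I scalerBr.
rewrite sumrB; congr (_ - _).
under eq_bigr do rewrite scaler_sumr.
rewrite exchange_big; apply: eq_bigr => c _ /=.
rewrite mxE scaler_suml; apply: eq_bigr => i _.
by rewrite scalerA mxE.
Qed.

(** [eop] represents the Lie algebra gl_n. This yields the flatness of [fnab], and the fact that
    [eop 1%:M], the form degree, commutes with every [eop m]. *)
Lemma eop_eop m m' F :
  eop m (eop m' F) = eop m' (eop m F) + eop (m *m m') F - eop (m' *m m) F.
Proof.
rewrite (eop_row m') (linear_sum (eop m)) /=.
under eq_bigr do rewrite eop_E eop_C (linearB (E _)).
rewrite big_split sumrB /= -eop_row -!addrA; congr (_ + _).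
rewrite addrC; congr (_ - _); last first.
  by rewrite eop_row; apply: eq_bigr => b _; rewrite row_mul.
rewrite exchange_big eop_row; apply: eq_bigr => a _ /=.
rewrite row_mul eC_mul (linear_sum (E a)); apply: eq_bigr => b _.
by rewrite (linearZZ (E a)) mxE.
Qed.

End Fermions.

(** Coordinate derivatives of functions and, componentwise, of forms; they commute with [fermE] and
    [fermI] because the coordinate coframe has constant components. *)
Record form_derivations (A : comNzRingType) (V : lmodType A) (n : nat)
    (Z : fermions V n) := FormDerivations {
  pA : 'I_n -> {additive A -> A};
  pV : 'I_n -> {additive V -> V};
  pAM : forall i x y, pA i (x * y) = pA i x * y + x * pA i y;
  pAC : forall i j x, pA i (pA j x) = pA j (pA i x);
  pVZ : forall i x F, pV i (x *: F) = pA i x *: F + x *: pV i F;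
  pVC : forall i j F, pV i (pV j F) = pV j (pV i F);
  pVE : forall i j F, pV i (fermE Z j F) = fermE Z j (pV i F);
  pVI : forall i j F, pV i (fermI Z j F) = fermI Z j (pV i F)
}.

Section MatrixDerivations.
Context {A : comNzRingType} {V : lmodType A} {n : nat} {Z : fermions V n}.
Variable Y : form_derivations Z.
Local Notation p := (pA Y).

Lemma pA1 i : p i 1 = 0.
Proof.
have := pAM Y i 1 1; rewrite !mul1r mulr1 => e.
by apply: (@addrI _ (p i 1)); rewrite addr0 -e.
Qed.

Definition pm {a b : nat} (i : 'I_n) (m : 'M[A]_(a, b)) : 'M[A]_(a, b) :=
  map_mx (p i) m.

Lemma pmM {a b c : nat} i (m : 'M[A]_(a, b)) (m' : 'M[A]_(b, c)) :
  pm i (m *m m') = pm i m *m m' + m *m pm i m'.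
Proof.
apply/matrixP => x y; rewrite !mxE raddf_sum -big_split; apply: eq_bigr => z _.
by rewrite /= !mxE pAM.
Qed.

Lemma pm1 i : pm i (1%:M : 'M[A]_n) = 0.
Proof.
by apply/matrixP => x y; rewrite !mxE; case: (x == y); rewrite ?pA1 ?raddf0.
Qed.

Lemma pmC {a b : nat} i j (m : 'M[A]_(a, b)) : pm i (pm j m) = pm j (pm i m).
Proof. by apply/matrixP => x y; rewrite !mxE pAC. Qed.

Lemma pm_tr {a b : nat} i (m : 'M[A]_(a, b)) : pm i m^T = (pm i m)^T.
Proof. by apply/matrixP => x y; rewrite !mxE. Qed.

Lemma pm_trace i (m : 'M[A]_n) : p i (\tr m) = \tr (pm i m).
Proof. by rewrite raddf_sum; apply: eq_bigr => x _; rewrite mxE. Qed.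

Lemma pm_row {a b : nat} i j (m : 'M[A]_(a, b)) : pm i (row j m) = row j (pm i m).
Proof. by apply/matrixP => x y; rewrite !mxE. Qed.

Lemma pV_W i u F : pV Y i (eW Z u F) = eW Z (pm i u) F + eW Z u (pV Y i F).
Proof.
rewrite raddf_sum -big_split; apply: eq_bigr => j _ /=.
by rewrite pVZ pVE mxE.
Qed.

Lemma pV_C i u F : pV Y i (eC Z u F) = eC Z (pm i u) F + eC Z u (pV Y i F).
Proof.
rewrite raddf_sum -big_split; apply: eq_bigr => j _ /=.
by rewrite pVZ pVI mxE.
Qed.

Lemma pV_op i m F : pV Y i (eop Z m F) = eop Z (pm i m) F + eop Z m (pV Y i F).
Proof.
rewrite raddf_sum -big_split; apply: eq_bigr => j _ /=.
rewrite raddf_sum -big_split; apply: eq_bigr => k _ /=.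
by rewrite pVZ pVE pVI mxE.
Qed.

End MatrixDerivations.

Section Metric.
Context {A : comNzRingType} {V : lmodType A} {n : nat} {Z : fermions V n}.
Variable Y : form_derivations Z.
Local Notation E := (fermE Z).
Local Notation I := (fermI Z).
Local Notation W := (eW Z).
Local Notation C := (eC Z).
Local Notation op := (eop Z).
Local Notation p := (pA Y).
Local Notation D := (pV Y).
Local Notation pm := (pm Y).
Variables (hf : A) (hf2 : hf + hf = 1).
Variables (g G : 'M[A]_n).
Hypotheses (g_sym : g^T = g) (G_sym : G^T = G) (gG : g *m G = 1%:M).

Lemma Gg : G *m g = 1%:M. Proof. exact: mulmx1C. Qed.

Lemma g_symE a b : g a b = g b a. Proof. by rewrite -{1}g_sym mxE. Qed.
Lemma G_symE a b : G a b = G b a. Proof. by rewrite -{1}G_sym mxE. Qed.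

Lemma eq_oppK (x : V) : x = - x -> x = 0.
Proof.
move=> /eqP; rewrite -subr_eq0 opprK => /eqP xx.
by rewrite -[x]scale1r -hf2 scalerDl -scalerDr xx scaler0.
Qed.

Lemma antisym_sum0 (X : 'I_n -> 'I_n -> V) : (forall a b, X a b = - X b a) ->
  \sum_a \sum_b X a b = 0.
Proof.
move=> anti; apply: eq_oppK; rewrite {1}exchange_big -sumrN.
by apply: eq_bigr => a _; rewrite -sumrN; apply: eq_bigr => b _.
Qed.

(* The lowered Christoffel symbols: [chrL a b e] is Gamma_{e,ab}. *)
Definition chrL (a : 'I_n) : 'M[A]_n :=
  \matrix_(b, e) (hf * (p a (g e b) + p b (g e a) - p e (g a b))).
Definition chr (a : 'I_n) : 'M[A]_n := chrL a *m G.

Lemma chrL_sym a b e : chrL a b e = chrL b a e.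
Proof. by rewrite !mxE (g_symE b a); ring. Qed.

Lemma chr_sym a b c : chr a b c = chr b a c.
Proof. by rewrite !mxE; apply: eq_bigr => e _; rewrite chrL_sym. Qed.

(** Compatibility of the Levi-Civita connection with the metric, with lowered indices. *)
Lemma chrL_compat a : chrL a + (chrL a)^T = pm a g.
Proof.
apply/matrixP => b e; rewrite !mxE (g_symE e a) (g_symE b a) (g_symE e b).
rewrite -[RHS]mul1r -hf2; ring.
Qed.

Lemma pm_G a : pm a G = - (G *m pm a g *m G).
Proof.
have := congr1 (pm a) gG; rewrite pmM pm1 => /(congr1 (mulmx G)).
rewrite mulmx0 mulmxDr !mulmxA Gg mul1mx => /eqP; rewrite addrC addr_eq0.
by move/eqP.
Qed.

Lemma pm_G_chr a : pm a G + G *m chr a = - ((chr a)^T *m G).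
Proof.
rewrite pm_G -chrL_compat /chr trmx_mul G_sym mulmxDr mulmxDl !mulmxA.
by rewrite opprD addrAC addNr add0r.
Qed.

Definition nab (a : 'I_n) (F : V) : V := D a F - op (chr a) F.

Definition gd (F : V) : V := \sum_a E a (nab a F).
Definition gdel (F : V) : V := \sum_a C (row a G) (nab a F).

Lemma nabD a F F' : nab a (F + F') = nab a F + nab a F'.
Proof. by rewrite /nab raddfD (linearD (op _)) opprD addrACA. Qed.

Lemma nabZ a x F : nab a (x *: F) = p a x *: F + x *: nab a F.
Proof. by rewrite /nab pVZ (linearZZ (op _)) scalerBr addrA. Qed.

Lemma nab_W a u F : nab a (W u F) = W u (nab a F) + W (pm a u - u *m (chr a)^T) F.
Proof. by rewrite /nab pV_W eop_W (linearB (W u)) /= eWD eWN; lin. Qed.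

Lemma nab_C a v F : nab a (C v F) = C v (nab a F) + C (pm a v + v *m chr a) F.
Proof. by rewrite /nab pV_C eop_C (linearB (C v)) /= eCD; lin. Qed.

(** Vanishing torsion: the Christoffel symbols are symmetric in the two indices that meet
    anticommuting factors. The exterior derivative is thus free of the metric. *)
Lemma gdE F : gd F = \sum_a E a (D a F).
Proof.
rewrite /gd /nab; under eq_bigr do rewrite (linearB (E _)).
rewrite sumrB /=; suff -> : \sum_a E a (op (chr a) F) = 0 by rewrite subr0.
under eq_bigr do rewrite eop_row (linear_sum (E _)) /=; apply: antisym_sum0 => a b.
rewrite fermEE; congr (- E b (E a _)); apply: eq_bigr => c _.
by rewrite [X in X *: _ = _]mxE [X in _ = X *: _]mxE chr_sym.
Qed.

Lemma gd_gd F : gd (gd F) = 0.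
Proof.
rewrite !gdE; under eq_bigr do rewrite raddf_sum (linear_sum (E _)) /=.
by apply: antisym_sum0 => a b; rewrite !pVE fermEE pVC.
Qed.

Lemma gdZ x F : gd (x *: F) = W (\row_a p a x) F + x *: gd F.
Proof.
rewrite !gdE scaler_sumr -big_split; apply: eq_bigr => a _ /=.
by rewrite pVZ (linearD (E a)) !(linearZZ (E a)) mxE.
Qed.

Lemma gdelZ x F : gdel (x *: F) = C ((\row_a p a x) *m G) F + x *: gdel F.
Proof.
rewrite eC_mul scaler_sumr -big_split; apply: eq_bigr => a _ /=.
by rewrite nabZ (linearD (C _)) !(linearZZ (C _)) mxE.
Qed.

Lemma mx_trace_chr a : \tr (chr a) = hf * \tr (pm a g *m G).
Proof.
rewrite -chrL_compat mulmxDl raddfD /= -[(chrL a)^T *m G]trmxK mxtrace_tr.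
rewrite trmx_mul trmxK G_sym [\tr (G *m _)]mxtrace_mulC -/(chr a).
by rewrite mulrDr -mulrDl hf2 mul1r.
Qed.

(** The trace is the logarithmic derivative of the volume density, hence closed. Without a logarithm
    in the ring, the two mixed derivatives are compared under the trace, by its cyclicity. *)
Lemma trace_chr_closed a b : p a (\tr (chr b)) = p b (\tr (chr a)).
Proof.
have hf0 i : p i hf = 0.
  have := congr1 (p i) hf2; rewrite raddfD /= pA1 => e.
  by rewrite -[LHS]mul1r -hf2 mulrDl -mulrDr e mulr0.
rewrite !mx_trace_chr !pAM !hf0 !mul0r !add0r !pm_trace !pmM !pm_G.
rewrite !mulmxN !raddfD /= !raddfN /= pmC; congr (hf * (_ - _)).
by rewrite !mulmxA -[X in \tr X = _]mulmxA mxtrace_mulC !mulmxA.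
Qed.

(* The flat connection which annihilates the raised coframe, twisted by the
   volume density; it exhibits the codifferential as a coordinate divergence. *)
Definition fnab (a : 'I_n) (F : V) : V :=
  D a F - op (pm a g *m G) F + \tr (chr a) *: F.

Local Notation c a := (C (row a G)).

Lemma fnab_C a i F : fnab a (c i F) = c i (fnab a F).
Proof.
rewrite /fnab pV_C eop_C pm_row pm_G (linearD (c i)) (linearB (c i)) /=.
rewrite (linearZZ (c i)) -row_mul raddfN /= eCN mulmxA; lin.
Qed.

(** The connection dg g^-1 is pure gauge: differentiating [G] produces exactly the commutator that
    [eop_eop] contributes. The trace part is closed. *)
Lemma fnabC a b F : fnab a (fnab b F) = fnab b (fnab a F).
Proof.
have fnab_expand i j : fnab i (fnab j F) = D i (D j F) - op (pm i (pm j g *m G)) F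
    - op (pm j g *m G) (D i F) + p i (\tr (chr j)) *: F + \tr (chr j) *: D i F
    - op (pm i g *m G) (D j F) + op (pm i g *m G) (op (pm j g *m G) F)
    - (\tr (chr j) * 1) *: op (pm i g *m G) F
    + \tr (chr i) *: (D j F - op (pm j g *m G) F + \tr (chr j) *: F).
  rewrite /fnab (raddfD (D i)) (raddfB (D i)) /= pV_op pVZ.
  rewrite (linearD (op (pm i g *m G))) (linearB (op (pm i g *m G))) /=.
  by rewrite (linearZZ (op (pm i g *m G))) /=; lin.
rewrite !fnab_expand trace_chr_closed (pVC Y a b).
rewrite (eop_eop Z (pm a g *m G)) !pmM !eopD !pm_G !mulmxN !eopN pmC !mulmxA.
lin.
Qed.

Lemma c_E a b F : c a (E b F) = G a b *: F - E b (c a F).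
Proof. by rewrite eC_E mxE. Qed.

Lemma gdel_fnab F : gdel F = \sum_a c a (fnab a F).
Proof.
apply/eqP; rewrite -subr_eq0 -sumrB; apply/eqP.
have opG m X : op (m *m G) X = \sum_b \sum_e m b e *: E b (c e X).
  rewrite eop_row; apply: eq_bigr => b _; rewrite row_mul eC_mul (linear_sum (E b)).
  by apply: eq_bigr => e _; rewrite (linearZZ (E b)) mxE.
have term a : c a (nab a F) - c a (fnab a F)
    = \sum_b \sum_e (chrL a e b * G a b) *: c e F
      - \sum_b \sum_e chrL a e b *: E b (c a (c e F)) - \tr (chr a) *: c a F.
  rewrite -(linearB (c a)) /nab /fnab -chrL_compat mulmxDl eopD -/(chr a).
  rewrite (_ : _ - _ - _ = op ((chrL a)^T *m G) F - \tr (chr a) *: F); last by lin.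
  rewrite (linearB (c a)) /= (linearZZ (c a)) opG; congr (_ - _).
  rewrite (linear_sum (c a)) -sumrB; apply: eq_bigr => b _ /=.
  rewrite (linear_sum (c a)) -sumrB; apply: eq_bigr => e _ /=.
  by rewrite (linearZZ (c a)) /= c_E scalerBr scalerA mxE.
under eq_bigr do rewrite term.
rewrite !sumrB.
(* This sum is symmetric in a, e against two anticommuting contractions. What is left of the
   difference is the trace of the Christoffel symbols, which the twist by the volume density
   compensates. *)
have -> : \sum_a \sum_b \sum_e chrL a e b *: E b (c a (c e F)) = 0.
  rewrite exchange_big big1 // => b _; apply: antisym_sum0 => a e.
  by rewrite chrL_sym eC_eC_anti (linearN (E b)) scalerN.
rewrite subr0; apply/eqP; rewrite subr_eq0; apply/eqP.
under eq_bigr do rewrite exchange_big.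
rewrite exchange_big; apply: eq_bigr => e _ /=.
under eq_bigr do rewrite -scaler_suml.
rewrite -scaler_suml; congr (_ *: _); apply: eq_bigr => a _.
rewrite [RHS]mxE; apply: eq_bigr => b _.
by rewrite chrL_sym (G_symE b).
Qed.

(** Takes the place of the Hodge star argument: the raised coframe contractions anticommute and are
    parallel for [fnab], whose components commute. *)
Lemma gdel_gdel F : gdel (gdel F) = 0.
Proof.
rewrite !gdel_fnab.
have fnab_sum a (X : 'I_n -> V) : fnab a (\sum_b X b) = \sum_b fnab a (X b).
  rewrite /fnab raddf_sum (linear_sum (op _)) scaler_sumr -sumrB -big_split.
  by [].
under eq_bigr do rewrite fnab_sum (linear_sum (c _)) /=.
apply: antisym_sum0 => a b.
by rewrite !fnab_C eC_eC_anti fnabC.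
Qed.

(* Cartan-type identity: the difference of the two Lie derivatives along [u] is
   algebraic, and involves only the covariant derivative of [u]. *)
Lemma gdel_W (u : 'rV[A]_n) (F : V) : (forall a b, p a (u 0 b) = p b (u 0 a)) ->
  let H := \matrix_(a, b) (p a (u 0 b) - \sum_c chr a b c * u 0 c) in
  gdel (W u F) = gd (C (u *m G) F) + C (u *m G) (gd F) - W u (gdel F)
    + \tr (G *m H) *: F - op (H *m G) F - op (H *m G) F.
Proof.
move=> u_closed H.
have H_sym : H^T = H.
  apply/matrixP => a b; rewrite !mxE u_closed; congr (_ - _).
  by apply: eq_bigr => e _; rewrite chr_sym.
have rowH a : pm a u - u *m (chr a)^T = row a H.
  apply/rowP => b; rewrite ![in RHS]mxE !mxE; congr (_ - _).
  by apply: eq_bigr => e _; rewrite mulrC mxE.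
have rowHG a : pm a (u *m G) + u *m G *m chr a = row a (H *m G).
  rewrite row_mul -rowH pmM -addrA -!mulmxA -mulmxDr pm_G_chr.
  by rewrite mulmxBl mulmxN !mulmxA.
have -> : gdel (W u F) = \sum_a (u *m G) 0 a *: nab a F - W u (gdel F)
    + \tr (G *m H) *: F - op (H *m G) F.
  have -> : \tr (G *m H) *: F = \sum_a (\sum_i G a i * H a i) *: F.
    rewrite -scaler_suml; congr (_ *: _); apply: eq_bigr => a _.
    by rewrite mxE; apply: eq_bigr => i _; rewrite -{1}H_sym [H^T _ _]mxE.
  have -> : op (H *m G) F = \sum_a W (row a H) (c a F).
    rewrite eop_row; under eq_bigr => b _.
      rewrite row_mul eC_mul (linear_sum (E b)); over.
    rewrite exchange_big; apply: eq_bigr => a _ /=; apply: eq_bigr => b _.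
    by rewrite (linearZZ (E b)) ![row _ _ _ _]mxE -{1}H_sym [H^T _ _]mxE.
  rewrite /gdel (linear_sum (W u)) -!sumrN -!big_split; apply: eq_bigr => a _ /=.
  rewrite nab_W rowH (linearD (c a)) /= !eC_eW !addrA; congr (_ *: _ - _ + _ *: _ - _).
    by rewrite mxE; apply: eq_bigr => i _; rewrite mxE mulrC G_symE.
  by apply: eq_bigr => i _; rewrite !(mxE _ (fun _ _ => G _ _)) ![row _ _ _ _]mxE.
have -> : gd (C (u *m G) F) = \sum_a (u *m G) 0 a *: nab a F - C (u *m G) (gd F)
    + op (H *m G) F.
  rewrite /gd (linear_sum (C _)) eop_row -!sumrN -!big_split; apply: eq_bigr => a _ /=.
  by rewrite nab_C rowHG (linearD (E a)) /= eE_eC.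
lin.
Qed.

End Metric.

Section RestrictScalars.
Context {K : fieldType} {A : comAlgType K} (V : lmodType A).

(** An alias, since [V] already is a module over the functions [A]. The derivatives d and delta are
    linear over the constants only, and [form_calculus] asks for one scalar field for all
    operators. *)
Definition restrict_scalars : Type := V.
HB.instance Definition _ := GRing.Zmodule.on restrict_scalars.

Definition restrict_scale (k : K) (F : restrict_scalars) : restrict_scalars :=
  (k%:A : A) *: (F : V).

Fact restrict_scaleA a b F :
  restrict_scale a (restrict_scale b F) = restrict_scale (a * b) F.
Proof. by rewrite /restrict_scale scalerA -scalerAl mul1r scalerA. Qed.
Fact restrict_scale1 : left_id 1 restrict_scale.
Proof. by move=> F; rewrite /restrict_scale scale1r scale1r. Qed.
Fact restrict_scaleDr : right_distributive restrict_scale +%R.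
Proof. by move=> a F F'; rewrite /restrict_scale -scalerDr. Qed.
Fact restrict_scaleDl F : {morph restrict_scale^~ F : a b / a + b}.
Proof. by move=> a b; rewrite /restrict_scale -scalerDl -scalerDl. Qed.
Fact restrict_scale0 F : restrict_scale 0 F = 0.
Proof. by rewrite /restrict_scale !scale0r. Qed.
HB.instance Definition _ := GRing.Nmodule_isLSemiModule.Build K restrict_scalars
  restrict_scaleA restrict_scale0 restrict_scale1 restrict_scaleDr restrict_scaleDl.

Lemma restrict_scaleE (k : K) (F : restrict_scalars) : k *: F = (k%:A : A) *: (F : V).
Proof. by []. Qed.

Lemma restrict_nat (m : nat) (F : restrict_scalars) : m%:R *: F = (m%:R : A) *: (F : V).
Proof. by rewrite -[m%:R in RHS](scaler_nat m (1 : A)). Qed.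

Fact restrict_linear_subproof (f : {linear V -> V}) :
  linear (f : restrict_scalars -> restrict_scalars).
Proof. by move=> k F F'; rewrite !restrict_scaleE linearP. Qed.
Definition restrict_linear (f : {linear V -> V}) : {linear restrict_scalars -> restrict_scalars} :=
  HB.pack (f : restrict_scalars -> restrict_scalars)
    (GRing.isLinear.Build K restrict_scalars restrict_scalars _ f (restrict_linear_subproof f)).

End RestrictScalars.

(** * The form calculus determined by the Einstein equation *)

Section EinsteinCalculus.
Context {K : numFieldType} {A : comAlgType K} {V : lmodType A} {n : nat}.
Context {Z : fermions V n}.
Variable Y : form_derivations Z.
Local Notation E := (fermE Z).
Local Notation W := (eW Z).
Local Notation C := (eC Z).
Local Notation op := (eop Z).
Local Notation p := (pA Y).
Hypothesis pK : forall i (k : K), p i (k%:A) = 0.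

Let hf : A := (2^-1 : K)%:A.
Lemma half_half : hf + hf = 1.
Proof.
by rewrite /hf -scalerDl; have := splitr (1 : K); rewrite div1r => <-; rewrite scale1r.
Qed.
Let hf2 := half_half.

Variables (g G : 'M[A]_n).
Hypotheses (g_sym : g^T = g) (G_sym : G^T = G) (gG : g *m G = 1%:M).
Local Notation chr := (chr Y hf g G).
Local Notation nab := (nab Y hf g G).
Local Notation gd := (gd Y hf g G).
Local Notation gdel := (gdel Y hf g G).

Variables (s rho J : A) (P : 'M[A]_n).
Let u : 'rV[A]_n := \row_a p a s.
Let v : 'rV[A]_n := u *m G.

Definition hessian : 'M[A]_n :=
  \matrix_(a, b) (p a (p b s) - \sum_c chr a b c * p c s).

Hypothesis s_regular : forall x, s * x = 0 -> x = 0.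
Hypothesis einstein : hessian + s *: P + rho *: g = 0.
Hypothesis unit_length : \sum_a v 0 a * u 0 a + 2 * s * rho = 1.
Hypothesis rhoE : n%:R * rho + \tr (G *m hessian) + J * s = 0.

Lemma hessian_sym : hessian^T = hessian.
Proof.
apply/matrixP => a b; rewrite !mxE pAC; congr (_ - _).
by apply: eq_bigr => c _; rewrite chr_sym.
Qed.

Lemma hessianE : hessian = - (s *: P) - rho *: g.
Proof. by rewrite -[RHS]addr0 -[in RHS]einstein; lin. Qed.

(** By the Einstein equation s P is a combination of the symmetric matrices [hessian] and [g], and s
    can be cancelled. *)
Lemma schouten_sym : P^T = P.
Proof.
apply/matrixP => a b; rewrite mxE; apply/eqP; rewrite -subr_eq0; apply/eqP.
apply: s_regular; have := congr1 (fun m : 'M_n => m b a - m a b) einstein.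
have := congr1 (fun m : 'M_n => m a b) hessian_sym; rewrite /= mxE.
move: hessian => h hE; rewrite !mxE hE (g_symE g_sym b a) subrr.
by move=> <-; ring.
Qed.

Lemma p_nat i (m : nat) : p i m%:R = 0.
Proof. by rewrite -(scaler_nat m (1 : A)) pK. Qed.

(* Differentiating [unit_length] gives the identity multiplied by [2 s]. *)
Lemma drho_schouten : \row_a p a rho = u *m G *m P.
Proof.
apply/rowP => a; apply/eqP; rewrite -subr_eq0; apply/eqP.
apply: s_regular; rewrite [X in _ * (X - _)]mxE.
have e1 : p a (\sum_b v 0 b * u 0 b) + 2 * (p a s * rho + s * p a rho) = 0.
  have := congr1 (p a) unit_length; rewrite raddfD pA1 /= !pAM p_nat => e.
  by rewrite -[RHS]e; ring.
have uE b : pm Y a u 0 b - \sum_c chr a b c * u 0 c = hessian a b.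
  have uc c : u 0 c = p c s by rewrite mxE.
  rewrite [RHS]mxE [pm _ _ _ _ _]mxE uc; congr (_ - _).
  by apply: eq_bigr => c _; rewrite uc.
have trT (x y : 'rV[A]_n) : \sum_b x 0 b * y 0 b = (x *m y^T) 0 0.
  by rewrite mxE; apply: eq_bigr => b _; rewrite mxE.
have e2 : p a (\sum_b v 0 b * u 0 b) = 2 * (v *m hessian) 0 a.
  have rH : pm Y a u = row a hessian + u *m (chr a)^T.
    apply/rowP => b; rewrite [in RHS]mxE [row _ _ _ _]mxE -uE -addrA -[LHS]addr0.
    congr (_ + _); rewrite [(_ *m _) _ _]mxE addrC -sumrB big1 // => c _.
    by rewrite [(chr a)^T _ _]mxE mulrC subrr.
  have -> : p a (\sum_b v 0 b * u 0 b) = (pm Y a (v *m u^T)) 0 0.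
    by rewrite mxE trT.
  have dv : pm Y a v = row a hessian *m G - v *m chr a.
    rewrite /v pmM rH mulmxDl -addrA; congr (_ + _).
    have -> : pm Y a G = - ((chr a)^T *m G) - G *m chr a.
      by rewrite -(pm_G_chr Y hf2 g_sym G_sym gG) addrK.
    by rewrite mulmxBr mulmxN !mulmxA addrA subrr add0r.
  rewrite pmM pm_tr rH dv raddfD /= trmx_mul trmxK mulmxBl mulmxDr !mulmxA.
  rewrite (_ : _ + _ = row a hessian *m G *m u^T + v *m (row a hessian)^T);
    last by lin.
  rewrite mxE.
  have hE b : hessian a b = hessian b a by rewrite -{1}hessian_sym [LHS]mxE.
  have -> : (row a hessian *m G *m u^T) 0 0 = (v *m hessian) 0 a.
    rewrite -mulmxA -[G in LHS]G_sym -trmx_mul -trT [RHS]mxE.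
    by apply: eq_bigr => b _; rewrite [row _ _ _ _]mxE hE mulrC.
  have -> : (v *m (row a hessian)^T) 0 0 = (v *m hessian) 0 a.
    rewrite -trT [RHS]mxE; apply: eq_bigr => b _.
    by rewrite [row _ _ _ _]mxE hE.
  by ring.
have e3 : (v *m hessian) 0 a = - s * (v *m P) 0 a - rho * p a s.
  rewrite hessianE mulmxBr mulmxN -!scalemxAr /v -!mulmxA (Gg gG) mulmx1 !mxE.
  by rewrite mulNr; congr (_ - _ * _); rewrite mxE.
move: e1; rewrite e2 e3 => e1.
suff : 2 * (s * (p a rho - (v *m P) 0 a)) = 0.
  move/(congr1 (fun x => hf * x)); rewrite mulr0 mulrA.
  by rewrite mulr_natr mulr2n hf2 mul1r.
by rewrite -[RHS]e1; ring.
Qed.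

Definition gQ (F : V) : V := J *: F - 2 *: op (P *m G) F.

Fact gQ_linear : linear gQ.
Proof.
move=> x F F'; rewrite /gQ (linearD (op _)) (linearZZ (op _)) /=.
by rewrite !scalerDr !scalerN !scalerA; lin.
Qed.
HB.instance Definition _ := GRing.isLinear.Build A V V _ gQ gQ_linear.

Lemma row_pK (k : K) : \row_a p a (k%:A) = 0.
Proof. by apply/rowP => a; rewrite !mxE pK. Qed.

Lemma gdD F F' : gd (F + F') = gd F + gd F'.
Proof. by rewrite -big_split; apply: eq_bigr => a _ /=; rewrite nabD (linearD (E a)). Qed.

Lemma gdelD F F' : gdel (F + F') = gdel F + gdel F'.
Proof. by rewrite -big_split; apply: eq_bigr => a _ /=; rewrite nabD (linearD (C _)). Qed.

(** Apply d^2 = 0 to [s *: F]. *)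
Lemma gd_W F : gd (W u F) = - W u (gd F).
Proof.
have := gd_gd Y hf2 G g_sym (s *: F).
rewrite gdZ // gdD gdZ // gd_gd // scaler0 addr0 => /eqP.
by rewrite addr_eq0 => /eqP.
Qed.

Lemma gdel_C F : gdel (C v F) = - C v (gdel F).
Proof.
have := gdel_gdel Y hf2 g_sym G_sym gG (s *: F).
rewrite gdelZ gdelD gdelZ gdel_gdel // scaler0 addr0 => /eqP.
by rewrite addr_eq0 => /eqP.
Qed.

(** The Cartan-type identity [gdel_W] for u = ds: the Hessian is replaced by - s P - rho g, and its
    trace is read off from [rhoE], the defining equation of rho. *)
Lemma gdel_W_einstein F : gdel (W u F) = gd (C v F) + C v (gd F) - W u (gdel F)
  - s *: gQ F + 2 *: (rho *: op 1%:M F) - n%:R *: (rho *: F).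
Proof.
rewrite gdel_W //; last by move=> a b; rewrite !mxE pAC.
have -> : \matrix_(a, b) (p a (u 0 b) - \sum_c chr a b c * u 0 c) = hessian.
  apply/matrixP => a b; rewrite [LHS]mxE [RHS]mxE; congr (_ - _).
    by congr (p a _); rewrite mxE.
  by apply: eq_bigr => c _; congr (_ * _); rewrite mxE.
have -> : \tr (G *m hessian) = - (n%:R * rho) - J * s.
  by rewrite -[LHS]subr0 -rhoE; ring.
have -> : hessian *m G = - (s *: (P *m G)) - rho *: 1%:M.
  by rewrite hessianE mulmxBl mulNmx -!scalemxAl gG.
by rewrite eopD !eopN !eopZ /gQ -/v; lin.
Qed.

Fact gd_linear : linear (gd : restrict_scalars V -> restrict_scalars V).
Proof.
move=> k F F'; rewrite restrict_scaleE.
by rewrite [LHS]gdD gdZ // row_pK eW0 add0r.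
Qed.

Fact gdel_linear : linear (gdel : restrict_scalars V -> restrict_scalars V).
Proof.
move=> k F F'; rewrite restrict_scaleE.
by rewrite [LHS]gdelD gdelZ row_pK mul0mx eC0 add0r.
Qed.

Local Notation op1 := (op 1%:M).

(** [eop 1%:M] is the form degree; it is parallel because the identity matrix is constant and
    central. *)
Lemma nab_op1 a F : nab a (op1 F) = op1 (nab a F).
Proof.
rewrite /nab pV_op pm1 eop0 add0r (linearB op1) /=; congr (_ - _).
by rewrite eop_eop mulmx1 mul1mx addrK.
Qed.

Lemma op1_gd F : op1 (gd F) = gd (op1 F) + gd F.
Proof.
rewrite /gd (linear_sum op1) -big_split; apply: eq_bigr => a _ /=.
rewrite eop_E nab_op1; congr (_ + _).
rewrite (bigD1 a) //= mxE eqxx scale1r big1 ?addr0 // => b /negbTE ba.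
by rewrite mxE ba scale0r.
Qed.

Lemma op1_gdel F : op1 (gdel F) = gdel (op1 F) - gdel F.
Proof.
rewrite /gdel (linear_sum op1) -sumrB; apply: eq_bigr => a _ /=.
by rewrite eop_C mulmx1 nab_op1.
Qed.

Lemma einstein_calculus : exists C : form_calculus (restrict_scalars V) (n%:R : K),
  [/\ [/\ forall F, fd C F = gd F & forall F, fdel C F = gdel F],
      [/\ forall F, fnu C F = W u F & forall F, fiota C F = eC Z v F],
      [/\ forall F, fs C F = s *: (F : V) & forall F, frho C F = rho *: (F : V)]
    & [/\ forall F, fQ C F = gQ F & forall F, fN C F = op1 F]].
Proof.
have d_s (F : V) : gd (s *: F) = s *: gd F + W u F by rewrite addrC; apply: gdZ.
have del_s (F : V) : gdel (s *: F) = s *: gdel F + eC Z v F.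
  by rewrite addrC; apply: gdelZ.
have d_rho (F : V) : gd (rho *: F) = rho *: gd F + W (\row_a p a rho) F.
  by rewrite addrC; apply: gdZ.
have del_rho (F : V) :
    gdel (rho *: F) = rho *: gdel F + eC Z ((\row_a p a rho) *m G) F.
  by rewrite addrC; apply: gdelZ.
have scale_swap (F : V) : rho *: (s *: F) = s *: (rho *: F).
  by rewrite !scalerA mulrC.
have iota_nu (F : V) :
    eC Z v (W u F) = F - 2 *: (s *: (rho *: F)) - W u (eC Z v F).
  rewrite eC_eW.
  have -> : \sum_i v 0 i * u 0 i = 1 - 2 * s * rho.
    by apply: (@addIr _ (2 * s * rho)); rewrite subrK; exact: unit_length.
  by rewrite scalerBl scale1r !scalerA.
have Q_nu (F : V) : gQ (W u F) = W u (gQ F) - 2 *: W (\row_a p a rho) F.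
  rewrite /gQ (linearB (W u)) !(linearZZ (W u)) /= eop_W trmx_mul G_sym.
  by rewrite schouten_sym mulmxA -drho_schouten; lin.
have Q_iota (F : V) :
    gQ (eC Z v F) = eC Z v (gQ F) + 2 *: eC Z ((\row_a p a rho) *m G) F.
  rewrite /gQ (linearB (eC Z v)) !(linearZZ (eC Z v)) /= eop_C mulmxA.
  by rewrite -drho_schouten; lin.
have N_nu (F : V) : op1 (W u F) = W u (op1 F) + W u F.
  by rewrite eop_W trmx1 mulmx1.
have N_iota (F : V) : op1 (eC Z v F) = eC Z v (op1 F) - eC Z v F.
  by rewrite eop_C mulmx1.
have N_Q (F : V) : op1 (gQ F) = gQ (op1 F).
  rewrite /gQ (linearB op1) !(linearZZ op1) /=; congr (_ - _ *: _).
  by rewrite (eop_eop Z 1%:M) mulmx1 mul1mx; lin.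
pose scale_linear (x : A) : {linear V -> V} := *:%R x.
pose D := HB.pack_for {linear restrict_scalars V -> restrict_scalars V} gd
  (GRing.isLinear.Build K (restrict_scalars V) (restrict_scalars V) _ gd gd_linear).
pose Ds := HB.pack_for {linear restrict_scalars V -> restrict_scalars V} gdel
  (GRing.isLinear.Build K (restrict_scalars V) (restrict_scalars V) _ gdel gdel_linear).
unshelve eexists (@FormCalculus K (restrict_scalars V) n%:R D Ds
  (restrict_linear (W u)) (restrict_linear (eC Z v))
  (restrict_linear (scale_linear s)) (restrict_linear (scale_linear rho))
  (restrict_linear (W (\row_a p a rho))) (restrict_linear (eC Z (\row_a p a rho *m G)))
  (restrict_linear gQ) (restrict_linear op1)
  _ _ _ _ _ _ _ _ _ _ _ _ _ _ _ _ _ _ _ _ _ _ _ _ _ _ _ _); last by split.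
all: move=> F /=; rewrite ?restrict_nat; move: F.
- exact (gd_gd Y hf2 G g_sym).
- exact (gdel_gdel Y hf2 g_sym G_sym gG).
- exact d_s.
- exact del_s.
- exact (fun F => linearZZ (W u) s F).
- exact (fun F => linearZZ (eC Z v) s F).
- exact scale_swap.
- exact (fun F => linearZZ gQ s F).
- exact (fun F => linearZZ op1 s F).
- exact d_rho.
- exact del_rho.
- exact (fun F => linearZZ (W u) rho F).
- exact (fun F => linearZZ (eC Z v) rho F).
- exact (fun F => linearZZ gQ rho F).
- exact (fun F => linearZZ op1 rho F).
- exact gd_W.
- exact gdel_C.
- exact (fun F => eq_oppK hf2 (eW_eW_anti Z u u F)).
- exact (fun F => eq_oppK hf2 (eC_eC_anti Z v v F)).
- exact iota_nu.
- exact gdel_W_einstein.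
- exact Q_nu.
- exact Q_iota.
- exact op1_gd.
- exact op1_gdel.
- exact N_nu.
- exact N_iota.
- exact N_Q.
Qed.

End EinsteinCalculus.

Section MatrixEntries.
Context {A : comNzRingType} {m n : nat}.
Implicit Types M N : 'M[A]_(m, n).

Lemma addmxE M N i j : (M + N) i j = M i j + N i j. Proof. exact: mxE. Qed.
Lemma oppmxE M i j : (- M) i j = - M i j. Proof. exact: mxE. Qed.
Lemma scalemxE (x : A) M i j : (x *: M) i j = x * M i j. Proof. exact: mxE. Qed.

End MatrixEntries.

(** * Conformal change of the Ricci tensor *)

Section Ricci.
Context {A : comNzRingType} {V : lmodType A} {n : nat} {Z : fermions V n}.
Variable Y : form_derivations Z.
Local Notation p := (pA Y).
Variable hf : A.

Definition ric (g G : 'M[A]_n) : 'M[A]_n := \matrix_(a, b)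
  \sum_c (p c (chr Y hf g G a b c) - p b (chr Y hf g G a c c)
    + \sum_e (chr Y hf g G c e c * chr Y hf g G a b e
              - chr Y hf g G b e c * chr Y hf g G a c e)).

Section Conformal.
Hypothesis hf2 : hf + hf = 1.
Variables (g G : 'M[A]_n).
Hypotheses (g_sym : g^T = g) (G_sym : G^T = G) (gG : g *m G = 1%:M).
Local Notation Gam := (chr Y hf g G).
Local Notation chrL := (chrL Y hf g).

Let gGE a c : \sum_e g a e * G e c = (a == c)%:R.
Proof. by have := congr1 (fun m : 'M_n => m a c) gG; rewrite !mxE. Qed.

Lemma chr_lower a b e : \sum_c g e c * Gam a b c = chrL a b e.
Proof.
have := congr1 (fun m : 'M_n => m b e) (mulmxA (chrL a) G g).
rewrite (Gg gG) mulmx1 => ->; rewrite [RHS]mxE; apply: eq_bigr => c _.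
by rewrite mulrC (g_symE g_sym).
Qed.

Variables (s t : A).
Hypothesis st : s * t = 1.
Variables U Vv : 'I_n -> A.
Hypothesis UE : forall a, U a = s * p a t.
Hypothesis VvE : forall c, Vv c = \sum_e U e * G e c.
(** The difference tensor of the Levi-Civita connections of t^2 g and g, with U = d log t and [Vv]
    the raised U. *)
Let X a b c : A := U a * (c == b)%:R + U b * (c == a)%:R - g a b * Vv c.

Lemma X_sym a b c : X a b c = X b a c.
Proof. by rewrite /X (g_symE g_sym b a); ring. Qed.

Lemma chr_conformal a b c :
  chr Y hf (t ^+ 2 *: g) (s ^+ 2 *: G) a b c = Gam a b c + X a b c.
Proof.
rewrite [LHS]mxE [Gam _ _ _]mxE.
have -> : X a b c = \sum_e (s * (p a t * g e b + p b t * g e a - p e t * g a b)) * G e c.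
  have E1 x y : \sum_e (s * (x * g e y)) * G e c = s * x * (c == y)%:R.
    rewrite eq_sym -gGE mulr_sumr; apply: eq_bigr => e _.
    by rewrite (g_symE g_sym y); ring.
  rewrite /X VvE mulr_sumr !UE -!E1 -big_split -sumrB; apply: eq_bigr => e _ /=.
  by rewrite UE; ring.
rewrite -big_split; apply: eq_bigr => e _ /=.
rewrite !mxE !expr2 !pAM.
have h : hf * 2 = 1 by rewrite mulr_natr mulr2n.
set L := p a (g e b) + p b (g e a) - p e (g a b).
set Q := p a t * g e b + p b t * g e a - p e t * g a b.
transitivity ((s * t) * (s * t) * (hf * L * G e c)
  + (hf * 2) * (s * t) * (s * Q * G e c)); last by rewrite st h; ring.
by rewrite /L /Q; ring.
Qed.

Lemma divergence (u : 'rV[A]_n) : let v := u *m G in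
  \sum_c (p c (v 0 c) + \sum_e v 0 e * Gam c e c)
  = \tr ((\matrix_(a, b) (p a (u 0 b) - \sum_c Gam a b c * u 0 c)) *m G).
Proof.
move=> v; apply: eq_bigr => c _.
have -> : p c (v 0 c) = (pm Y c v) 0 c by rewrite [RHS]mxE.
have -> : \sum_e v 0 e * Gam c e c = (v *m Gam c) 0 c by rewrite [RHS]mxE.
rewrite /v pmM.
have -> : pm Y c G = - ((Gam c)^T *m G) - G *m Gam c.
  by rewrite -(pm_G_chr Y hf2 g_sym G_sym gG) addrK.
rewrite [RHS]mxE mulmxBr mulmxN !mulmxA.
transitivity (((pm Y c u - u *m (Gam c)^T) *m G) 0 c).
  by rewrite mulmxBl !mxE; ring.
rewrite [LHS]mxE; apply: eq_bigr => e _; congr (_ * _).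
rewrite !mxE; congr (_ - _); apply: eq_bigr => i _.
by rewrite [(Gam c)^T _ _]mxE mulrC.
Qed.

Lemma X_contract a b (f : 'I_n -> A) :
  \sum_c X a b c * f c = U a * f b + U b * f a - g a b * \sum_c Vv c * f c.
Proof.
under eq_bigr do rewrite /X !mulrDl mulNr.
rewrite !big_split sumrN /= mulr_sumr; congr (_ + _ - _).
- rewrite -[f b](sum_delta_l f) mulr_sumr; apply: eq_bigr => c _; ring.
- rewrite -[f a](sum_delta_l f) mulr_sumr; apply: eq_bigr => c _; ring.
- by apply: eq_bigr => c _; rewrite mulrA.
Qed.

Lemma Vv_lower a : \sum_c g a c * Vv c = U a.
Proof.
under eq_bigr do rewrite VvE mulr_sumr.
rewrite exchange_big -[RHS](sum_delta_r U); apply: eq_bigr => e _ /=.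
rewrite eq_sym -gGE mulr_sumr; apply: eq_bigr => c _.
by rewrite (G_symE G_sym); ring.
Qed.

Lemma X_trace a : \sum_c X a c c = n%:R * U a.
Proof.
rewrite /X !big_split sumrN /= Vv_lower sum_delta_r addrK.
by rewrite -mulr_sumr (eq_bigr (fun=> 1)) ?sumr_const ?card_ord 1?mulrC // => c _; rewrite eqxx.
Qed.

Hypothesis U_closed : forall a b, p a (U b) = p b (U a).

(** The classical transformation law in dimension n, by substituting Gamma + X for Gamma: [S1], [S2]
    are the derivative terms, [T1] to [T6] the products. The terms g V Gamma left over in [T4] and
    [T5] add up, by metric compatibility ([compat]), to the derivative of g that [S1] produces. *)
Lemma ric_conformal a b :
  ric (t ^+ 2 *: g) (s ^+ 2 *: G) a b
  = ric g G a b
    - (n%:R - 2) * (p a (U b) - \sum_c U c * Gam a b c - U a * U b)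
    - g a b * (\sum_c (p c (Vv c) + \sum_e Vv e * Gam c e c)
               + (n%:R - 2) * \sum_c Vv c * U c).
Proof.
pose tau a := \sum_c Gam c a c.
have tauE e : \sum_c Gam e c c = tau e.
  by apply: eq_bigr => c _; rewrite (chr_sym _ _ _ g_sym).
have p_delta i c d : p i ((c == d)%:R : A) = 0.
  by case: (c == d); rewrite ?raddf0 ?pA1.
have S1 : \sum_c p c (X a b c) = p b (U a) + p a (U b)
    - \sum_c p c (g a b) * Vv c - g a b * \sum_c p c (Vv c).
  rewrite /X; under eq_bigr do rewrite raddfB raddfD /= !pAM !p_delta !mulr0 !addr0.
  rewrite sumrB !big_split /=.
  have -> : \sum_c p c (U a) * (c == b)%:R = p b (U a).
    exact: (sum_delta_r (fun c => p c (U a))).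
  have -> : \sum_c p c (U b) * (c == a)%:R = p a (U b).
    exact: (sum_delta_r (fun c => p c (U b))).
  by rewrite mulr_sumr opprD addrA.
have p_nat i (m : nat) : p i (m%:R : A) = 0.
  by elim: m => [|m IH]; rewrite ?raddf0 // -natr1 raddfD /= IH pA1 addr0.
have S2 : \sum_c p b (X a c c) = n%:R * p b (U a).
  by rewrite -raddf_sum X_trace /= pAM p_nat mul0r add0r.
have T1 : \sum_c \sum_e Gam c e c * X a b e
    = U a * tau b + U b * tau a - g a b * \sum_e Vv e * tau e.
  rewrite exchange_big -X_contract; apply: eq_bigr => e _ /=.
  by rewrite -mulr_suml mulrC.
have T2 : \sum_c \sum_e X c e c * Gam a b e = n%:R * \sum_e U e * Gam a b e.
  rewrite exchange_big mulr_sumr; apply: eq_bigr => e _ /=.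
  rewrite -mulr_suml mulrA -X_trace; congr (_ * _).
  by apply: eq_bigr => c _; rewrite X_sym.
have T3 : \sum_c \sum_e X c e c * X a b e
    = n%:R * (2 * U a * U b - g a b * \sum_c Vv c * U c).
  transitivity (n%:R * \sum_e X a b e * U e); last by rewrite X_contract; ring.
  rewrite exchange_big mulr_sumr; apply: eq_bigr => e _ /=.
  rewrite -mulr_suml mulrCA -X_trace mulrC; congr (_ * _).
  by apply: eq_bigr => c _; rewrite X_sym.
have T4 : \sum_c \sum_e Gam b e c * X a c e
    = U a * tau b + \sum_c U c * Gam a b c - \sum_c \sum_e g a c * (Vv e * Gam b e c).
  have -> : \sum_c \sum_e Gam b e c * X a c e
      = \sum_c (U a * Gam b c c + U c * Gam b a c - g a c * \sum_e Vv e * Gam b e c).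
    apply: eq_bigr => c _; rewrite -(X_contract a c (fun e => Gam b e c)).
    by apply: eq_bigr => e _; rewrite mulrC.
  rewrite sumrB big_split /= -mulr_sumr tauE; congr (_ + _ - _).
    by apply: eq_bigr => c _; rewrite (chr_sym _ _ _ g_sym).
  by apply: eq_bigr => c _; rewrite mulr_sumr.
have T5 : \sum_c \sum_e X b e c * Gam a c e
    = U b * tau a + \sum_c U c * Gam a b c - \sum_c \sum_e g b c * (Vv e * Gam a e c).
  have -> : \sum_c \sum_e X b e c * Gam a c e
      = \sum_e (U b * Gam a e e + U e * Gam a b e - g b e * \sum_c Vv c * Gam a c e).
    rewrite exchange_big; apply: eq_bigr => e _.
    by rewrite -(X_contract b e (fun c => Gam a c e)).
  rewrite sumrB big_split /= -mulr_sumr tauE; congr (_ + _ - _).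
  by apply: eq_bigr => c _; rewrite mulr_sumr.
have XV c : \sum_e Vv e * X b e c = (\sum_e Vv e * U e) * (c == b)%:R.
  transitivity (\sum_e (U b * Vv c * (e == c)%:R + (Vv e * U e) * (c == b)%:R
      - g b e * Vv e * Vv c)); last first.
    rewrite sumrB big_split /= -!mulr_suml Vv_lower.
    have -> : \sum_e U b * Vv c * (e == c)%:R = U b * Vv c.
      exact: (sum_delta_r (fun=> U b * Vv c)).
    by ring.
  apply: eq_bigr => e _; rewrite /X.
  by rewrite (eq_sym c e); case: (eqVneq e c) => [->|_]; rewrite ?mulr0n; ring.
have T6 : \sum_c \sum_e X b e c * X a c e
    = (n%:R + 2) * U a * U b - 2 * g a b * \sum_c Vv c * U c.
  transitivity (\sum_c (U a * X b c c + X a b c * U c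
      - g a c * \sum_e Vv e * X b e c)); last first.
    rewrite sumrB big_split /= -mulr_sumr X_trace X_contract.
    have -> : \sum_c g a c * \sum_e Vv e * X b e c = g a b * \sum_e Vv e * U e.
      under eq_bigr do rewrite XV mulrA.
      exact: (sum_delta_r (fun c => g a c * \sum_e Vv e * U e)).
    by ring.
  apply: eq_bigr => c _; rewrite [X a b c]X_sym [X b a c * _]mulrC.
  rewrite -(X_contract a c (fun e => X b e c)).
  by apply: eq_bigr => e _; rewrite mulrC.
have compat : \sum_c \sum_e g a c * (Vv e * Gam b e c)
    + \sum_c \sum_e g b c * (Vv e * Gam a e c) = \sum_c p c (g a b) * Vv c.
  rewrite [X in X + _]exchange_big [X in _ + X]exchange_big -big_split.
  apply: eq_bigr => e _ /=.
  transitivity (Vv e * (\sum_c g a c * Gam b e c + \sum_c g b c * Gam a e c)).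
    rewrite mulrDr !mulr_sumr; congr (_ + _);
      by apply: eq_bigr => c _; rewrite mulrCA.
  rewrite !chr_lower mulrC (chrL_sym _ _ g_sym b) (chrL_sym _ _ g_sym a).
  congr (_ * _); have := congr1 (fun m : 'M_n => m a b) (chrL_compat Y hf2 g_sym e).
  by rewrite [LHS]mxE [_^T _ _]mxE [RHS]mxE addrC.
rewrite [LHS]mxE [ric g G a b]mxE.
transitivity (\sum_c (p c (Gam a b c) - p b (Gam a c c)
    + \sum_e (Gam c e c * Gam a b e - Gam b e c * Gam a c e))
  + (\sum_c p c (X a b c) - \sum_c p b (X a c c)
     + \sum_c \sum_e Gam c e c * X a b e + \sum_c \sum_e X c e c * Gam a b e
     + \sum_c \sum_e X c e c * X a b e - \sum_c \sum_e Gam b e c * X a c e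
     - \sum_c \sum_e X b e c * Gam a c e - \sum_c \sum_e X b e c * X a c e)).
  rewrite -!sumrB -!big_split /= -!sumrB -big_split /=; apply: eq_bigr => c _.
  have chrp i x y z : p i (chr Y hf (t ^+ 2 *: g) (s ^+ 2 *: G) x y z)
      = p i (Gam x y z) + p i (X x y z) by rewrite chr_conformal [LHS]raddfD.
  rewrite !chrp.
  have -> : \sum_e (chr Y hf (t ^+ 2 *: g) (s ^+ 2 *: G) c e c
        * chr Y hf (t ^+ 2 *: g) (s ^+ 2 *: G) a b e
      - chr Y hf (t ^+ 2 *: g) (s ^+ 2 *: G) b e c
        * chr Y hf (t ^+ 2 *: g) (s ^+ 2 *: G) a c e)
    = \sum_e (Gam c e c * Gam a b e - Gam b e c * Gam a c e)
      + \sum_e Gam c e c * X a b e + \sum_e X c e c * Gam a b e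
      + \sum_e X c e c * X a b e - \sum_e Gam b e c * X a c e
      - \sum_e X b e c * Gam a c e - \sum_e X b e c * X a c e.
    rewrite -!big_split -!sumrB; apply: eq_bigr => e _ /=.
    by rewrite !chr_conformal; ring.
  by ring.
rewrite S1 S2 T1 T2 T3 T4 T5 T6 -compat (U_closed b a).
have -> : \sum_c (p c (Vv c) + \sum_e Vv e * Gam c e c)
    = \sum_c p c (Vv c) + \sum_e Vv e * tau e.
  rewrite big_split; congr (_ + _); rewrite exchange_big; apply: eq_bigr => e _.
  by rewrite -mulr_sumr.
by ring.
Qed.

End Conformal.

Section EinsteinRescaling.
Hypothesis hf2 : hf + hf = 1.
Variables (g G : 'M[A]_n).
Hypotheses (g_sym : g^T = g) (G_sym : G^T = G) (gG : g *m G = 1%:M).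
Local Notation Gam := (chr Y hf g G).
Variables (s t : A).
Hypothesis st : s * t = 1.
Let u : 'rV[A]_n := \row_a p a s.
Let v : 'rV[A]_n := u *m G.
Let H : 'M[A]_n := \matrix_(a, b) (p a (p b s) - \sum_c Gam a b c * p c s).
Variables (rho J : A) (P : 'M[A]_n).
Hypothesis natK : forall (m : nat) (x : A), m.+1%:R * x = 0 -> x = 0.
Hypothesis n_ge3 : (3 <= n)%N.
Hypothesis rhoE : n%:R * rho + (\tr (G *m H) + J * s) = 0.
Hypothesis JE : 2 * (n%:R - 1) * J = \tr (G *m ric g G).
Hypothesis PE : (n%:R - 2) *: P = ric g G - J *: g.
Hypothesis einstein : ric (t ^+ 2 *: g) (s ^+ 2 *: G)
  = - (n%:R - 1) *: (t ^+ 2 *: g).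

Lemma p_inverse a : p a t = - t ^+ 2 * p a s.
Proof.
have := congr1 (fun x => t * p a x) st; rewrite pAM pA1 mulr0 => e.
have -> : p a t = s * t * p a t by rewrite st mul1r.
by rewrite -[LHS]subr0 -e; ring.
Qed.

Let U a := - t * p a s.
Let Vv c := - t * v 0 c.

(** For t = 1/s one has U = - t ds, and the quadratic terms cancel in nabla U - U U = - t Hess s
    ([D1]). The Einstein equation thus says that Ric + (n - 2) t Hess s is pure trace. *)
Lemma einstein_rescaling_ric (chi := - t * \tr (G *m H)
    + (n%:R - 1) * t ^+ 2 * (\sum_a v 0 a * u 0 a - 1)) :
  ric g G + (n%:R - 2) * t *: H = chi *: g.
Proof.
have uE a : u 0 a = p a s by rewrite mxE.
have UE a : U a = s * p a t.
  by rewrite p_inverse /U expr2 -[- t](mul1r) -st; ring.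
have VE c : Vv c = \sum_e U e * G e c.
  by rewrite /Vv /v mxE mulr_sumr; apply: eq_bigr => e _; rewrite uE /U; ring.
have pU a b : p a (U b) = t ^+ 2 * p a s * p b s - t * p a (p b s).
  by rewrite /U pAM raddfN /= p_inverse; ring.
have Ucl a b : p a (U b) = p b (U a) by rewrite !pU pAC; ring.
have HH a b : H a b = p a (p b s) - \sum_c Gam a b c * p c s by rewrite mxE.
have := ric_conformal hf2 g_sym G_sym gG st UE VE Ucl.
have div := divergence hf2 g_sym G_sym gG u.
move=> /= in div.
set N := \sum_a v 0 a * u 0 a in chi *.
have D1 a b : p a (U b) - \sum_c U c * Gam a b c - U a * U b = - t * H a b.
  rewrite pU HH mulrBr mulr_sumr.
  have -> : \sum_c U c * Gam a b c = \sum_c - t * (Gam a b c * p c s).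
    by apply: eq_bigr => c _; rewrite /U; ring.
  by rewrite /U; ring.
have D2 : \sum_c (p c (Vv c) + \sum_e Vv e * Gam c e c)
    = t ^+ 2 * N - t * \tr (G *m H).
  have -> : \tr (G *m H) = \sum_c (p c (v 0 c) + \sum_e v 0 e * Gam c e c).
    rewrite div mxtrace_mulC; congr (\tr (_ *m _)); apply/matrixP => a b.
    rewrite HH [RHS]mxE uE; congr (_ - _); apply: eq_bigr => c _.
    by rewrite uE.
  rewrite !mulr_sumr -sumrB; apply: eq_bigr => c _.
  have -> : \sum_e Vv e * Gam c e c = - t * \sum_e v 0 e * Gam c e c.
    by rewrite mulr_sumr; apply: eq_bigr => e _; rewrite /Vv mulrA.
  by rewrite /Vv pAM raddfN /= p_inverse uE; ring.
have D3 : \sum_c Vv c * U c = t ^+ 2 * N.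
  by rewrite mulr_sumr; apply: eq_bigr => c _; rewrite /Vv /U uE; ring.
move=> conf; apply/matrixP => a b.
have := conf a b; rewrite D1 D2 D3 einstein => e.
rewrite addmxE !scalemxE.
have -> : ric g G a b = (- (n%:R - 1) *: (t ^+ 2 *: g)) a b
   + (n%:R - 2) * (- t * H a b)
   + g a b * (t ^+ 2 * N - t * \tr (G *m H) + (n%:R - 2) * (t ^+ 2 * N)).
  by rewrite e; ring.
by rewrite !scalemxE /chi; ring.
Qed.

Lemma einstein_rescaling : H + s *: P + rho *: g = 0
  /\ \sum_a v 0 a * u 0 a + 2 * s * rho = 1.
Proof.
have := einstein_rescaling_ric; set N := \sum_a v 0 a * u 0 a.
set L := \tr (G *m H); set chi := (X in _ = X *: g -> _) => E0.
have chiD : chi = - t * L + (n%:R - 1) * t ^+ 2 * (N - 1) by [].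
clearbody chi.
have [m nE] : exists m, n = m.+3 by case: n n_ge3 => [|[|[|m]]] // _; exists m.
have n0 (x : A) : n%:R * x = 0 -> x = 0 by rewrite nE; apply: natK.
have n1 (x : A) : (n%:R - 1) * x = 0 -> x = 0.
  by rewrite nE -natr1 addrK; apply: natK.
have n2 (x : A) : (n%:R - 2) * x = 0 -> x = 0.
  by rewrite nE -addn2 natrD addrK; apply: natK.
have tr0 : 2 * (n%:R - 1) * J + (n%:R - 2) * t * \tr (G *m H) = n%:R * chi.
  have := congr1 (fun m : 'M_n => \tr (G *m m)) E0.
  rewrite mulmxDr raddfD /= -!scalemxAr (Gg gG) !mxtraceZ mxtrace1 -JE => ->.
  by rewrite mulrC.
have sE : s * (t * \tr (G *m H)) = \tr (G *m H) by rewrite mulrA st mul1r.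
have r0 := rhoE; rewrite -/L in tr0 sE r0.
(* The trace of the equation determines chi: s (chi - J) = -(n - 2) rho, so the pure trace part
   becomes the term rho g. The factors n, n - 1, n - 2 are carried along and cancelled by [natK],
   since their inverses need not lie in the ring. *)
have chiE : n%:R * (s * (chi - J)) = (n%:R - 2) * - (n%:R * rho).
  have -> : - (n%:R * rho) = L + J * s by rewrite -[LHS]addr0 -r0; ring.
  rewrite -{1}sE; transitivity (s * (n%:R * chi) - n%:R * s * J); first by ring.
  by rewrite -tr0; ring.
split.
  apply/matrixP => a b; rewrite [RHS]mxE; apply/n0/n2.
  rewrite !addmxE !scalemxE.
  have := congr1 (fun m : 'M_n => m a b) PE.
  have := congr1 (fun m : 'M_n => m a b) E0.
  rewrite addmxE !scalemxE => e1.
  rewrite addmxE oppmxE !scalemxE => e2.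
  transitivity (n%:R * (s * ((n%:R - 2) * P a b)) + n%:R * (n%:R - 2) * H a b
    - ((n%:R - 2) * - (n%:R * rho)) * g a b); first by ring.
  have Hst : H a b = s * (t * H a b) by rewrite mulrA st mul1r.
  rewrite e2 -chiE Hst.
  transitivity (n%:R * s * (ric g G a b + (n%:R - 2) * t * H a b - chi * g a b)).
    by ring.
  by rewrite e1; ring.
apply: (@addIr _ (- 1)); rewrite subrr; apply/n0/n1.
(* Now chi is taken from its definition, which contains the squared length [N]; comparison with its
   value from the trace is the length equation. *)
have chi2 : s * (s * chi) = - s * L + (n%:R - 1) * (N - 1).
  have -> : (n%:R - 1) * (N - 1) = (n%:R - 1) * (s * t) * (s * t) * (N - 1).
    by rewrite st !mulr1.
  by rewrite -sE chiD; ring.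
have e1 : n%:R * (s * (s * chi)) = s * (2 * (n%:R - 1) * (s * J) + (n%:R - 2) * L).
  by rewrite -sE; transitivity (s * s * (n%:R * chi)); [ring | rewrite -tr0; ring].
have e2 : s * L + s * J * s = - (s * (n%:R * rho)).
  by rewrite -[LHS]addr0 -[0 in LHS](mulr0 s) -[0 in LHS]oppr0 -r0; ring.
transitivity (n%:R * ((n%:R - 1) * (N - 1)) + 2 * (n%:R - 1) * (s * (n%:R * rho))).
  by ring.
have -> : (n%:R - 1) * (N - 1) = s * (s * chi) + s * L by rewrite chi2; ring.
rewrite mulrDr e1 -[s * (n%:R * rho)]opprK -e2; ring.
Qed.

End EinsteinRescaling.
End Ricci.

From mathcomp Require Import all_classical all_reals all_analysis.
Require Import Defs.
Import numFieldNormedType.Exports.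
Local Open Scope classical_set_scope.
Local Open Scope ring_scope.

(** * Smooth functions on the half-space *)

Section SecondDifference.
Context {R : realType} {W : normedModType R}.
Implicit Types (f : W -> R) (x u v : W).

Lemma is_derive_line f x u (a : R) : derivable f (a *: u + x) u ->
  is_derive a (1 : R) (fun s : R => f (s *: u + x)) ('D_u f (a *: u + x)).
Proof.
have E : (fun h : R =>
    h^-1 *: (((fun s : R => f (s *: u + x)) \o shift a) (h *: 1) - f (a *: u + x)))
    = (fun h : R => h^-1 *: ((f \o shift (a *: u + x)) (h *: u) - f (a *: u + x))).
  apply/funext => h /=; congr (_ *: (f _ - _)).
  by rewrite -[h *: 1]/(h * 1) mulr1 scalerDl addrA.
by move=> df; apply: DeriveDef; rewrite /derivable /derive /= E.
Qed.

(** The mean value theorem along u for the increment of f in the direction t v, and then along v for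
    the derivative so obtained. *)
Lemma second_difference f x u v (t : R) : 0 < t ->
  (forall a b, 0 <= a <= t -> 0 <= b <= t ->
     derivable f (b *: v + (a *: u + x)) u /\
     derivable ('D_u f) (b *: v + (a *: u + x)) v) ->
  exists a b, [/\ 0 <= a <= t, 0 <= b <= t
    & f (t *: v + (t *: u + x)) - f (t *: u + x) - f (t *: v + x) + f x
      = t * t * 'D_v ('D_u f) (b *: v + (a *: u + x))].
Proof.
move=> t0 df.
have tt : 0 <= t <= t by rewrite lexx ltW.
have zt : 0 <= (0 : R) <= t by rewrite lexx ltW.
pose phi (a : R) := f (a *: u + (t *: v + x)) - f (a *: u + x).
have dphi a : 0 <= a <= t ->
    is_derive a (1 : R) phi ('D_u f (a *: u + (t *: v + x)) - 'D_u f (a *: u + x)).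
  move=> at_; apply: is_deriveB; apply: is_derive_line.
    by rewrite addrCA; exact: (df a t at_ tt).1.
  by have := (df a 0 at_ zt).1; rewrite scale0r add0r.
have [a /[!in_itv]/= /andP[a0 at_] phiE] :
    exists2 a, a \in `]0, t[%R & phi t - phi 0 =
      ('D_u f (a *: u + (t *: v + x)) - 'D_u f (a *: u + x)) * (t - 0).
  apply: (@MVT R phi (fun a => 'D_u f (a *: u + (t *: v + x)) - 'D_u f (a *: u + x))
    0 t t0).
    by move=> a /[!in_itv]/= /andP[a0 at_]; apply: dphi; rewrite !ltW.
  apply: derivable_within_continuous => a /[!in_itv]/= at_.
  by have [] := dphi a at_.
have a0t : 0 <= a <= t by rewrite !ltW.
pose psi (b : R) := 'D_u f (b *: v + (a *: u + x)).
have dpsi b : 0 <= b <= t ->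
    is_derive b (1 : R) psi ('D_v ('D_u f) (b *: v + (a *: u + x))).
  by move=> bt; apply: is_derive_line; exact: (df a b a0t bt).2.
have [b /[!in_itv]/= /andP[b0 bt] psiE] :
    exists2 b, b \in `]0, t[%R & psi t - psi 0 =
      'D_v ('D_u f) (b *: v + (a *: u + x)) * (t - 0).
  apply: (@MVT R psi (fun b => 'D_v ('D_u f) (b *: v + (a *: u + x))) 0 t t0).
    by move=> b /[!in_itv]/= /andP[b0 bt]; apply: dpsi; rewrite !ltW.
  apply: derivable_within_continuous => b /[!in_itv]/= bt.
  by have [] := dpsi b bt.
exists a, b; split => //; first by rewrite !ltW.
move: phiE psiE; rewrite /phi /psi !scale0r !add0r !subr0 [a *: u + (_ + _)]addrCA.
rewrite [t *: u + (t *: v + x)]addrCA => e1 e2.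
transitivity (f (t *: v + (t *: u + x)) - f (t *: u + x) - (f (t *: v + x) - f x)).
  by ring.
by rewrite e1 e2; ring.
Qed.

(** The second difference over the parallelogram spanned by t u and t v does not depend on the order
    of u and v, so the two mixed derivatives take a common value at points arbitrarily close to x;
    continuity does the rest. *)
Lemma schwarz f x u v :
  (\forall y \near x, [/\ derivable f y u, derivable f y v,
     derivable ('D_u f) y v & derivable ('D_v f) y u]) ->
  {for x, continuous ('D_v ('D_u f))} -> {for x, continuous ('D_u ('D_v f))} ->
  'D_v ('D_u f) x = 'D_u ('D_v f) x.
Proof.
move=> df cvu cuv; apply/eqP; rewrite -subr_eq0 -normr_le0.
apply/ler_addgt0Pl => eps eps0; rewrite addr0.
have eps2 : 0 < eps / 2 by rewrite divr_gt0.
have nvu : \forall y \near x, `|'D_v ('D_u f) x - 'D_v ('D_u f) y| < eps / 2.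
  by move/cvgrPdist_lt : cvu; apply.
have nuv : \forall y \near x, `|'D_u ('D_v f) x - 'D_u ('D_v f) y| < eps / 2.
  by move/cvgrPdist_lt : cuv; apply.
have [r /= r0 near_r] := (nbhs_ballP _ _).1 (filterI df (filterI nvu nuv)).
pose m := `|u| + `|v| + 1.
have m0 : 0 < m by rewrite ltr_wpDl // addr_ge0.
(* Small enough for the whole parallelogram to lie in the ball of radius r; the 1 in [m] keeps the
   denominator positive when u and v vanish. *)
pose t := r / 2 / m.
have t0 : 0 < t by rewrite !divr_gt0.
have in_ball a b : 0 <= a <= t -> 0 <= b <= t -> ball x r (b *: v + (a *: u + x)).
  move=> /andP[a0 at_] /andP[b0 bt]; rewrite -ball_normE /= addrA opprD addrCA subrr addr0.
  rewrite normrN (le_lt_trans (ler_normD _ _)) // !normrZ !ger0_norm //.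
  have : b * `|v| + a * `|u| <= t * m.
    rewrite /m !mulrDr addrC mulr1 -[leLHS]addr0 lerD //; last exact: ltW.
    by rewrite lerD // ler_wpM2r.
  move=> /le_lt_trans; apply; rewrite /t divfK ?gt_eqF // ltr_pdivrMr //; lra.
have tw a b : 0 <= a <= t -> 0 <= b <= t -> ball x r (b *: u + (a *: v + x)).
  by move=> at_ bt; rewrite addrCA; exact: in_ball.
have [a [b [at_ bt e1]]] : exists a b, [/\ 0 <= a <= t, 0 <= b <= t
    & f (t *: v + (t *: u + x)) - f (t *: u + x) - f (t *: v + x) + f x
      = t * t * 'D_v ('D_u f) (b *: v + (a *: u + x))].
  apply: (second_difference t0) => a b at_ bt.
  by have [[d1 d2 d3 d4] _] := near_r _ (in_ball _ _ at_ bt).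
have [a' [b' [at_' bt' e2]]] : exists a b, [/\ 0 <= a <= t, 0 <= b <= t
    & f (t *: u + (t *: v + x)) - f (t *: v + x) - f (t *: u + x) + f x
      = t * t * 'D_u ('D_v f) (b *: u + (a *: v + x))].
  apply: (second_difference t0) => a' b' at_' bt'.
  by have [[d1 d2 d3 d4] _] := near_r _ (tw _ _ at_' bt').
have [_ [n1 _]] := near_r _ (in_ball _ _ at_ bt).
have [_ [_ n2]] := near_r _ (tw _ _ at_' bt').
have val_eq : 'D_v ('D_u f) (b *: v + (a *: u + x)) = 'D_u ('D_v f) (b' *: u + (a' *: v + x)).
  apply: (@mulfI _ (t * t)); first by rewrite mulf_neq0 // gt_eqF.
  rewrite (addrCA (t *: v)) in e1.
  apply: etrans (esym e1) _; apply: etrans _ e2; congr (_ + _); exact: addrAC.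
rewrite /= val_eq in n1; rewrite /= in n2.
apply: le_trans (ler_distD _ _ _) _; last first.
  by rewrite [leRHS]splitr; apply: lerD; [exact: ltW n1 | rewrite distrC; exact: ltW n2].
Qed.

End SecondDifference.

Section SmoothFunctions.
Context {R : realType} {n : nat}.
Local Notation d := n.+1.
Local Notation vec := 'rV[R]_d.
Local Notation e := (@basis_vec R n).
Implicit Types (V U : set vec) (f g h : vec -> R) (x : vec) (i j : 'I_d).

Definition C1_at V f : Prop := forall x, V x ->
  {for x, continuous f} /\ forall i, derivable f x (e i).

(** [Cinfty] adds derivatives on the outside. Taking them off from the inside gives an induction on
    the order under which sums, products and inverses are stable. *)
Fixpoint Cn V (k : nat) f : Prop :=
  C1_at V f /\ if k is k'.+1 then forall i, Cn V k' ('D_(e i) f) else True.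

Lemma iter_partial_rcons s i f :
  iter_partial (rcons s i) f = iter_partial s ('D_(e i) f).
Proof. by elim: s => [//|j s IH] /=; rewrite IH. Qed.

Lemma CnP V f : Cinfty V f <-> forall k, Cn V k f.
Proof.
split=> [Cf k|Cf s].
  elim: k f Cf => [|k IH] f Cf; split => //; try by move=> x; apply: (Cf [::]).
  by move=> i; apply: IH => s x Vx; rewrite -iter_partial_rcons; apply: Cf.
have [k] := ubnP (size s); elim: k s f Cf => [//|k IH] s f Cf; case/lastP: s => [_|s i].
  by move=> x Vx; have [+ _] := Cf 0; apply.
rewrite size_rcons => sk x Vx; rewrite iter_partial_rcons.
by apply: IH => // l; have [_] := Cf l.+1; apply.
Qed.

Lemma Cn_W V k f : Cn V k.+1 f -> Cn V k f.
Proof.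
elim: k f => [|k IH] f [H1 H2]; split => // i; by apply: IH; apply: H2.
Qed.

Lemma near_open V f g x : open V -> (forall y, V y -> f y = g y) -> V x ->
  \forall y \near x, f y = g y.
Proof. by move=> oV fg Vx; apply: filterS (open_nbhs_nbhs (conj oV Vx)). Qed.

Lemma C1_eq V f g : open V -> (forall x, V x -> f x = g x) -> C1_at V f -> C1_at V g.
Proof.
move=> oV fg Cf x Vx; have [cf df] := Cf x Vx; split=> [|i].
  rewrite /prop_for /continuous_at -(fg _ Vx).
  exact: (cvg_trans (near_eq_cvg (near_open oV fg Vx)) cf).
by apply: near_eq_derivable (df i); exact: near_open oV fg Vx.
Qed.

Lemma derive_eq V f g v x : open V -> (forall y, V y -> f y = g y) -> V x ->
  'D_v f x = 'D_v g x.
Proof. by move=> oV fg Vx; apply: near_eq_derive; exact: near_open oV fg Vx. Qed.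

Lemma Cn_eq V k f g : open V -> (forall x, V x -> f x = g x) -> Cn V k f -> Cn V k g.
Proof.
move=> oV; elim: k f g => [|k IH] f g fg [Cf Df].
  by split; first exact: C1_eq oV fg Cf.
split; first exact: C1_eq oV fg Cf.
by move=> i; apply: IH (Df i) => x Vx; apply: derive_eq oV fg Vx.
Qed.

Lemma C1_cst V (a : R) : C1_at V (cst a).
Proof.
by move=> x _; split=> [|i]; [exact: cst_continuous | exact: derivable_cst].
Qed.

Lemma C1_add V f g : C1_at V f -> C1_at V g -> C1_at V (f + g).
Proof.
move=> Cf Cg x Vx; have [cf df] := Cf x Vx; have [cg dg] := Cg x Vx.
by split=> [|i]; [exact: continuousD cf cg | exact: derivableD (df i) (dg i)].
Qed.

Lemma C1_mul V f g : C1_at V f -> C1_at V g -> C1_at V (f * g).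
Proof.
move=> Cf Cg x Vx; have [cf df] := Cf x Vx; have [cg dg] := Cg x Vx.
by split=> [|i]; [exact: continuousM cf cg | exact: derivableM (df i) (dg i)].
Qed.

Lemma C1_inv V f : (forall x, V x -> f x != 0) -> C1_at V f ->
  C1_at V (fun x => (f x)^-1).
Proof.
move=> f0 Cf x Vx; have [cf df] := Cf x Vx; have fx := f0 x Vx.
by split=> [|i]; [exact: continuousV fx cf | exact: derivableV fx (df i)].
Qed.

Lemma Cn_cst V k (a : R) : Cn V k (cst a).
Proof.
elim: k a => [|k IH] a; split; rewrite //; try exact: C1_cst.
move=> i; rewrite (_ : 'D_(e i) _ = cst 0); first exact: IH.
by apply/funext => x; rewrite derive_cst.
Qed.

Lemma Cn_add V k f g : open V -> Cn V k f -> Cn V k g -> Cn V k (f + g).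
Proof.
move=> oV; elim: k f g => [|k IH] f g [Cf Df] [Cg Dg].
  by split; first exact: C1_add.
split=> [|i]; first exact: C1_add.
apply: Cn_eq oV _ (IH _ _ (Df i) (Dg i)) => x Vx.
by rewrite (deriveD ((Cf x Vx).2 i) ((Cg x Vx).2 i)).
Qed.

Lemma Cn_mul V k f g : open V -> Cn V k f -> Cn V k g -> Cn V k (f * g).
Proof.
move=> oV; elim: k f g => [|k IH] f g Hf Hg; have [Cf Df] := Hf; have [Cg Dg] := Hg.
  by split; first exact: C1_mul.
split=> [|i]; first exact: C1_mul.
have := Cn_add oV (IH _ _ (Cn_W Hf) (Dg i)) (IH _ _ (Cn_W Hg) (Df i)).
apply: Cn_eq oV _ => x Vx.
by rewrite (deriveM ((Cf x Vx).2 i) ((Cg x Vx).2 i)).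
Qed.

Lemma Cn_opp V k f : open V -> Cn V k f -> Cn V k (- f).
Proof.
move=> oV Cf; apply: Cn_eq oV _ (Cn_mul oV (Cn_cst V k (-1)) Cf) => x _.
by rewrite /GRing.mul /= mulN1r.
Qed.

Lemma Cn_inv V k f : open V -> (forall x, V x -> f x != 0) -> Cn V k f ->
  Cn V k (fun x => (f x)^-1).
Proof.
move=> oV f0; elim: k => [|k IH] Hf; have [Cf Df] := Hf.
  by split; first exact: C1_inv.
split=> [|i]; first exact: C1_inv.
have Ci := IH (Cn_W Hf).
apply: Cn_eq oV _ (Cn_opp oV (Cn_mul oV (Cn_mul oV Ci Ci) (Df i))) => x Vx.
rewrite (deriveV (f0 x Vx) ((Cf x Vx).2 i)).
by rewrite expr2 invfM scaleNr.
Qed.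

Lemma Cinfty_derive V f i : Cinfty V f -> Cinfty V ('D_(e i) f).
Proof. by move=> /CnP Cf; apply/CnP => k; have [_] := Cf k.+1; apply. Qed.

Lemma Cinfty_schwarz V f i j x : open V -> Cinfty V f -> V x ->
  'D_(e i) ('D_(e j) f) x = 'D_(e j) ('D_(e i) f) x.
Proof.
move=> oV Cf Vx; apply: schwarz.
- apply: filterS (open_nbhs_nbhs (conj oV Vx)) => y Vy; split.
  + exact: (Cf [::] y Vy).2.
  + exact: (Cf [::] y Vy).2.
  + exact: (Cf [:: j] y Vy).2.
  + exact: (Cf [:: i] y Vy).2.
- exact: (Cf [:: i; j] x Vx).1.
- exact: (Cf [:: j; i] x Vx).1.
Qed.

End SmoothFunctions.

Section HalfSpaceDerivatives.
Context {R : realType} {n : nat}.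
Local Notation d := n.+1.
Local Notation vec := 'rV[R]_d.
Local Notation e := (@basis_vec R n).
Implicit Types (V U : set vec) (f g h : vec -> R) (x : vec) (i j : 'I_d).

Lemma line_cvg i x : (fun t : R => t *: e i + x) @ 0 --> x.
Proof.
rewrite -[X in _ --> X]add0r -(scale0r (e i)).
by apply: cvgD; [exact: scalel_continuous | exact: cvg_cst].
Qed.

Lemma halfspace_line i x (t : R) : halfspace x -> 0 <= t -> halfspace (t *: e i + x).
Proof.
rewrite /halfspace /= => x0 t0; by rewrite !mxE addr_ge0 // mulr_ge0.
Qed.

(** Positive steps stay in the half-space in every coordinate direction. Properness is what makes
    the limit in [pd] unique. *)
Lemma pd_filter_proper x i : halfspace x ->
  ProperFilter (within [set t | halfspace (t *: e i + x)] (0 : R)^').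
Proof.
move=> hx; apply: Build_ProperFilter => P.
have [r /= r0 near_r] := (nbhs_ballP _ _).1 P.
apply: (near_r (r / 2)).
- rewrite -ball_normE /= sub0r normrN ger0_norm ?divr_ge0 ?(ltW r0) //.
  by rewrite ltr_pdivrMr // ltr_pMr // ltr1n.
- by rewrite gt_eqF // divr_gt0.
- by apply: halfspace_line => //; rewrite divr_ge0 ?(ltW r0).
Qed.

Definition rel_open U := exists2 V0, open V0 & U = V0 `&` halfspace.

(** The one-sided derivative agrees with the full derivative of any local smooth extension. All
    rules for [pd] are reduced to ordinary calculus through it. *)
Lemma pd_eq U V f h x i : rel_open U -> open V -> U x -> V x ->
  (forall y, V y -> U y -> h y = f y) -> derivable h x (e i) ->
  pd i f x = 'D_(e i) h x.
Proof.
move=> [V0 oV0 UE] oV Ux Vx hf dh.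
have hx : halfspace x by move: Ux; rewrite UE => -[].
have PF := pd_filter_proper i hx.
apply: cvg_lim => //.
have cvgh : (fun t : R => t^-1 * (h (t *: e i + x) - h x)) @
    within [set t | halfspace (t *: e i + x)] (0 : R)^' --> 'D_(e i) h x.
  exact: cvg_trans (cvg_app _ (cvg_within _)) dh.
apply: cvg_trans cvgh; apply: near_eq_cvg.
have V0x : (V0 `&` V) x by split => //; move: Ux; rewrite UE => -[].
have nearV : \forall t \near (0 : R), (V0 `&` V) (t *: e i + x).
  by apply: line_cvg; apply: open_nbhs_nbhs; split => //; exact: openI.
have : \forall t \near (0 : R)^', (V0 `&` V) (t *: e i + x) by exact: nbhs_dnbhs.
apply: filterS => t [V0t Vt] /= Ht.
by rewrite (hf _ Vt) ?(hf _ Vx) // UE.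
Qed.

Lemma smooth_pd U f i : rel_open U -> smooth_on U f -> smooth_on U (pd i f).
Proof.
move=> oU sf x Ux; have [V [h [oV Vx Ch hf]]] := sf x Ux.
exists V, ('D_(e i) h); split; [exact oV | exact Vx | exact: Cinfty_derive |].
by move=> z Vz Uz; rewrite (pd_eq oU oV Uz Vz hf) //; exact: (Ch [::] z Vz).2.
Qed.

Lemma pd_ext U f g x i : rel_open U -> (forall y, U y -> f y = g y) -> U x ->
  pd i f x = pd i g x.
Proof.
move=> [V0 oV0 UE] fg Ux.
have nearV : \forall t \near (0 : R)^', V0 (t *: e i + x).
  apply: nbhs_dnbhs; apply: line_cvg; apply: open_nbhs_nbhs; split => //.
  by move: Ux; rewrite UE => -[].
(* No differentiability is at hand, so the two image filters are shown to be equal; the limits then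
   agree even where they are junk. *)
rewrite /pd; congr (lim _); rewrite eqEsubset.
by split; apply: near_eq_cvg; apply: filterS nearV => t V0t /= Ht;
  rewrite !fg // UE.
Qed.

Lemma smooth_ext U f g : (forall y, U y -> f y = g y) -> smooth_on U f ->
  smooth_on U g.
Proof.
move=> fg sf x Ux; have [V [h [oV Vx Ch hf]]] := sf x Ux.
by exists V, h; split => // z Vz Uz; rewrite hf // fg.
Qed.

Lemma smooth_cst U (a : R) : smooth_on U (cst a).
Proof.
move=> x Ux; exists setT, (cst a); split => //; first exact: openT.
by apply/CnP => k; exact: Cn_cst.
Qed.

Lemma Cinfty_sub V V' f : V' `<=` V -> Cinfty V f -> Cinfty V' f.
Proof. by move=> sub Cf s x /sub; exact: Cf. Qed.

Lemma smooth_add U f g : smooth_on U f -> smooth_on U g -> smooth_on U (f + g).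
Proof.
move=> sf sg x Ux; have [V [h [oV Vx Ch hf]]] := sf x Ux.
have [V' [h' [oV' Vx' Ch' hg]]] := sg x Ux.
exists (V `&` V'), (h + h'); split => //; first exact: openI.
  apply/CnP => k; apply: Cn_add; first exact: openI.
    exact: ((CnP _ _).1 (Cinfty_sub (@subIsetl _ V V') Ch) k).
  exact: ((CnP _ _).1 (Cinfty_sub (@subIsetr _ V V') Ch') k).
by move=> z [Vz Vz'] Uz; rewrite /GRing.add /= /GRing.add /= hf // hg.
Qed.

Lemma smooth_mul U f g : smooth_on U f -> smooth_on U g -> smooth_on U (f * g).
Proof.
move=> sf sg x Ux; have [V [h [oV Vx Ch hf]]] := sf x Ux.
have [V' [h' [oV' Vx' Ch' hg]]] := sg x Ux.
exists (V `&` V'), (h * h'); split => //; first exact: openI.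
  apply/CnP => k; apply: Cn_mul; first exact: openI.
    exact: ((CnP _ _).1 (Cinfty_sub (@subIsetl _ V V') Ch) k).
  exact: ((CnP _ _).1 (Cinfty_sub (@subIsetr _ V V') Ch') k).
by move=> z [Vz Vz'] Uz; rewrite /GRing.mul /= hf // hg.
Qed.

Lemma smooth_inv U f : (forall x, U x -> f x != 0) -> smooth_on U f ->
  smooth_on U (fun x => (f x)^-1).
Proof.
move=> f0 sf x Ux; have [V [h [oV Vx Ch hf]]] := sf x Ux.
pose V' := V `&` [set y | h y != 0].
have oV' : open V'.
  rewrite openE => y [Vy hy]; apply: filterI.
    by apply: open_nbhs_nbhs.
  have [ch _] := Ch [::] y Vy.
  have : \forall z \near h y, z != 0.
    exact: (@cvgr_neq0 R R^o _ (nbhs (h y)) _ id _ cvg_id hy).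
  by move/ch.
exists V', (fun y => (h y)^-1); split => //.
- by split => //=; rewrite hf // f0.
- apply/CnP => k; apply: Cn_inv => // [y []//|].
  exact: ((CnP _ _).1 (Cinfty_sub (@subIsetl _ V _) Ch) k).
- by move=> z [Vz _] Uz; rewrite hf.
Qed.

Lemma pd_cst U (a : R) x i : rel_open U -> U x -> pd i (cst a) x = 0.
Proof.
move=> oU Ux; rewrite (@pd_eq U setT _ (cst a) _ _ oU openT Ux I (fun _ _ _ => erefl)).
  by rewrite derive_cst.
exact: derivable_cst.
Qed.

Lemma pd_add U f g x i : rel_open U -> smooth_on U f -> smooth_on U g -> U x ->
  pd i (f + g) x = pd i f x + pd i g x.
Proof.
move=> oU sf sg Ux; have [V [h [oV Vx Ch hf]]] := sf x Ux.
have [V' [h' [oV' Vx' Ch' hg]]] := sg x Ux.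
have dh : derivable h x (e i) by exact: (Ch [::] x Vx).2.
have dh' : derivable h' x (e i) by exact: (Ch' [::] x Vx').2.
rewrite (pd_eq oU oV Ux Vx hf dh) (pd_eq oU oV' Ux Vx' hg dh') -deriveD //.
apply: (pd_eq oU (openI oV oV') Ux (conj Vx Vx')); last exact (derivableD dh dh').
by move=> z [Vz Vz'] Uz; rewrite /GRing.add /= /GRing.add /= hf // hg.
Qed.

Lemma pd_mul U f g x i : rel_open U -> smooth_on U f -> smooth_on U g -> U x ->
  pd i (f * g) x = pd i f x * g x + f x * pd i g x.
Proof.
move=> oU sf sg Ux; have [V [h [oV Vx Ch hf]]] := sf x Ux.
have [V' [h' [oV' Vx' Ch' hg]]] := sg x Ux.
have dh : derivable h x (e i) by exact: (Ch [::] x Vx).2.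
have dh' : derivable h' x (e i) by exact: (Ch' [::] x Vx').2.
rewrite (pd_eq oU oV Ux Vx hf dh) (pd_eq oU oV' Ux Vx' hg dh').
transitivity ('D_(e i) (h * h') x).
  apply: (pd_eq oU (openI oV oV') Ux (conj Vx Vx')); last exact (derivableM dh dh').
  by move=> z [Vz Vz'] Uz; rewrite /GRing.mul /= hf // hg.
by rewrite (deriveM dh dh') -(hf x Vx Ux) -(hg x Vx' Ux) addrC [_ *: 'D_(e i) h x]mulrC.
Qed.

Lemma pd_comm U f x i j : rel_open U -> smooth_on U f -> U x ->
  pd i (pd j f) x = pd j (pd i f) x.
Proof.
move=> oU sf Ux; have [V [h [oV Vx Ch hf]]] := sf x Ux.
have pdE k z : V z -> U z -> 'D_(e k) h z = pd k f z.
  by move=> Vz Uz; rewrite (pd_eq oU oV Uz Vz hf) //; exact: (Ch [::] z Vz).2.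
rewrite (pd_eq oU oV Ux Vx (pdE j)) ?(pd_eq oU oV Ux Vx (pdE i)).
- exact: Cinfty_schwarz oV Ch Vx.
- exact: (Ch [:: i] x Vx).2.
- exact: (Ch [:: j] x Vx).2.
Qed.

End HalfSpaceDerivatives.

(** * The ring of smooth functions on a relatively open subset of the half-space *)

Section DomainFunctions.
Context {R : realType} {n : nat}.
Local Notation d := n.+1.
Local Notation vec := 'rV[R]_d.
Local Notation e := (@basis_vec R n).

(* A point is required so that the functions on the domain form a nonzero ring. *)
Record domain := Domain {
  dom_set :> set vec;
  dom_rel : rel_open dom_set;
  dom_pt : vec;
  dom_ptP : dom_set dom_pt
}.

(** Every point of U is approached along the inward normal by points of positive first coordinate.
    This both extends the Einstein equation to the boundary and makes sigma a nonzerodivisor. *)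
Lemma smooth_vanish (U : set vec) (f : vec -> R) : rel_open U -> smooth_on U f ->
  (forall x, U x -> 0 < x 0 ord0 -> f x = 0) -> forall x, U x -> f x = 0.
Proof.
move=> [V0 oV0 UE] sf f0 x Ux; have [V [h [oV Vx Ch hf]]] := sf x Ux.
have [V0x hx] : (V0 `&` halfspace) x by rewrite -UE.
apply/eqP/negP => /negP fx; rewrite -(hf x Vx Ux) in fx.
have [ch _] := Ch [::] x Vx.
have h_near : \forall y \near x, h y != 0.
  have : \forall z \near h x, z != 0.
    exact: (@cvgr_neq0 R R^o _ (nbhs (h x)) _ id _ cvg_id fx).
  by move/ch.
have : \forall t \near (0 : R), [/\ V0 (t *: e ord0 + x), V (t *: e ord0 + x) &
    h (t *: e ord0 + x) != 0].
  have l := @line_cvg R n ord0 x.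
  have n1 : \forall t \near (0 : R), V0 (t *: e ord0 + x).
    by apply: l; apply: open_nbhs_nbhs.
  have n2 : \forall t \near (0 : R), V (t *: e ord0 + x).
    by apply: l; apply: open_nbhs_nbhs.
  have n3 : \forall t \near (0 : R), h (t *: e ord0 + x) != 0 by exact: l h_near.
  by apply: filterS3 n1 n2 n3.
move=> /(nbhs_ballP _ _).1 [r /= r0 near_r].
have rr : 0 < r / 2 by rewrite divr_gt0.
have [] := near_r (r / 2).
  by rewrite -ball_normE /= sub0r normrN ger0_norm ?ltW // ltr_pdivrMr // ltr_pMr // ltr1n.
move=> z1 z2; rewrite hf //; last first.
  by rewrite UE; split => //; apply: halfspace_line; rewrite // ltW.
rewrite f0 ?eqxx //; first by rewrite UE; split => //; apply: halfspace_line; rewrite // ltW.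
rewrite !mxE !eqxx mulr1 ltr_wpDr //.
Qed.

Variable D : domain.
Local Notation U := (dom_set D).

(* The value off the domain is fixed in order that functions which agree on the
   domain be equal. *)
Record smfun := SmFun {
  sval_fun :> vec -> R;
  smfun_smooth : smooth_on U sval_fun;
  smfun_out : forall x, ~ U x -> sval_fun x = 0
}.

HB.instance Definition _ := gen_eqMixin smfun.
HB.instance Definition _ := gen_choiceMixin smfun.

Lemma smfunP (f g : smfun) : (forall x, U x -> f x = g x) -> f = g.
Proof.
move=> fg; have : sval_fun f = sval_fun g.
  apply/funext => x; have [/fg //|nx] := pselect (U x).
  by rewrite !smfun_out.
case: f g {fg} => f sf of' [g sg og] /= E; rewrite -E in sg og *.
by congr SmFun; exact: Prop_irrelevance.
Qed.

Definition cut (f : vec -> R) (x : vec) : R := if `[< U x >] then f x else 0.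

Lemma cutE f x : U x -> cut f x = f x.
Proof. by move=> Dx; rewrite /cut asboolT. Qed.

Lemma cut_out f x : ~ U x -> cut f x = 0.
Proof. by move=> Dx; rewrite /cut asboolF. Qed.

Lemma cut_smooth f : smooth_on U f -> smooth_on U (cut f).
Proof. by apply: smooth_ext => x Dx; rewrite cutE. Qed.

Definition restr f (sf : smooth_on U f) : smfun := SmFun (cut_smooth sf) (@cut_out f).

Lemma restrE f (sf : smooth_on U f) x : U x -> restr sf x = f x.
Proof. exact: cutE. Qed.

Implicit Types f g h : smfun.

Definition sadd f g : smfun := restr (smooth_add (smfun_smooth f) (smfun_smooth g)).
Definition smul2 f g : smfun := restr (smooth_mul (smfun_smooth f) (smfun_smooth g)).
Definition scst (a : R) : smfun := restr (@smooth_cst R n U a).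
Definition sscale (a : R) f : smfun := smul2 (scst a) f.

Lemma saddE f g x : U x -> sadd f g x = f x + g x.
Proof. by move=> Ux; rewrite restrE. Qed.
Lemma smulE f g x : U x -> smul2 f g x = f x * g x.
Proof. by move=> Ux; rewrite restrE. Qed.
Lemma scstE a x : U x -> scst a x = a.
Proof. by move=> Ux; rewrite restrE. Qed.
Lemma sscaleE a f x : U x -> sscale a f x = a * f x.
Proof. by move=> Ux; rewrite smulE // scstE. Qed.

Local Definition sE := (saddE, smulE, sscaleE, scstE).
Ltac pw := intros; apply: smfunP => x Ux; rewrite !sE //.

Fact saddA : associative sadd.
Proof. by move=> f g h; pw; rewrite addrA. Qed.
Fact saddC : commutative sadd.
Proof. by move=> f g; pw; rewrite addrC. Qed.
Fact sadd0 : left_id (scst 0) sadd.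
Proof. by move=> f; pw; rewrite add0r. Qed.
Fact saddN : left_inverse (scst 0) (sscale (-1)) sadd.
Proof. by move=> f; pw; rewrite mulN1r addNr. Qed.
HB.instance Definition _ := GRing.isZmodule.Build smfun saddA saddC sadd0 saddN.

Fact smulA : associative smul2.
Proof. by move=> f g h; pw; rewrite mulrA. Qed.
Fact smulC : commutative smul2.
Proof. by move=> f g; pw; rewrite mulrC. Qed.
Fact smul1 : left_id (scst 1) smul2.
Proof. by move=> f; pw; rewrite mul1r. Qed.
Fact smulDl : left_distributive smul2 sadd.
Proof. by move=> f g h; pw; rewrite mulrDl. Qed.
Fact s1_neq0 : scst 1 != scst 0 :> smfun.
Proof.
apply/eqP => /(congr1 (fun f : smfun => f (dom_pt D))).
by rewrite !scstE; [apply/eqP; rewrite oner_eq0 | exact: dom_ptP..].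
Qed.
HB.instance Definition _ := GRing.Zmodule_isComNzRing.Build smfun
  smulA smulC smul1 smulDl s1_neq0.

Fact sscaleA a b f : sscale a (sscale b f) = sscale (a * b) f.
Proof. by pw; rewrite mulrA. Qed.
Fact sscale1 : left_id 1 sscale.
Proof. by move=> f; pw; rewrite mul1r. Qed.
Fact sscaleDr : right_distributive sscale +%R.
Proof. by move=> a f g; apply: smfunP => x Ux; rewrite !sE // mulrDr. Qed.
Fact sscaleDl f : {morph sscale^~ f : a b / a + b}.
Proof. by move=> a b; apply: smfunP => x Ux; rewrite !sE // mulrDl. Qed.
HB.instance Definition _ := GRing.Zmodule_isLmodule.Build R smfun
  sscaleA sscale1 sscaleDr sscaleDl.

Fact sscaleAl (a : R) (f g : smfun) : a *: (f * g) = (a *: f) * g.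
Proof. by apply: smfunP => x Ux; rewrite !sE // mulrA. Qed.
HB.instance Definition _ := GRing.Lmodule_isLalgebra.Build R smfun sscaleAl.
HB.instance Definition _ := GRing.Lalgebra_isComAlgebra.Build R smfun.

Lemma smfunDE f g x : U x -> (f + g) x = f x + g x. Proof. exact: saddE. Qed.
Lemma smfunME f g x : U x -> (f * g) x = f x * g x. Proof. exact: smulE. Qed.
Lemma smfunZE (a : R) f x : U x -> (a *: f) x = a * f x. Proof. exact: sscaleE. Qed.
Lemma smfun0E x : U x -> (0 : smfun) x = 0. Proof. exact: scstE. Qed.
Lemma smfun1E x : U x -> (1 : smfun) x = 1. Proof. exact: scstE. Qed.
Lemma smfunNE f x : U x -> (- f) x = - f x.
Proof. by move=> Ux; rewrite [LHS]sscaleE // mulN1r. Qed.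
Lemma smfun_natE m x : U x -> (m%:R : smfun) x = m%:R.
Proof.
move=> Ux; elim: m => [|m IH]; first exact: smfun0E.
by rewrite -natr1 smfunDE // IH smfun1E // natr1.
Qed.
Lemma smfun_algE (a : R) x : U x -> (a%:A : smfun) x = a.
Proof. by move=> Ux; rewrite smfunZE // smfun1E // mulr1. Qed.
Lemma smfun_sumE (I : Type) (r : seq I) (P : pred I) (F : I -> smfun) x : U x ->
  (\sum_(i <- r | P i) F i) x = \sum_(i <- r | P i) F i x.
Proof.
move=> Ux; apply: (big_morph (fun f : smfun => f x)); last exact: smfun0E.
by move=> f g; exact: smfunDE.
Qed.

Definition spd (i : 'I_d) f : smfun := restr (smooth_pd i (dom_rel D) (smfun_smooth f)).

Lemma spdE i f x : U x -> spd i f x = pd i f x.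
Proof. by move=> Ux; rewrite restrE. Qed.

Lemma spdD i f g : spd i (f + g) = spd i f + spd i g.
Proof.
apply: smfunP => x Ux; rewrite smfunDE // !spdE //.
rewrite -(pd_add i (dom_rel D) (smfun_smooth f) (smfun_smooth g) Ux).
by apply: (pd_ext i (dom_rel D)) => // y Uy; rewrite smfunDE.
Qed.

Fact spd_additive i : zmod_morphism (spd i).
Proof.
by move=> f g; apply: (@addIr _ (spd i g)); rewrite -spdD !subrK.
Qed.
HB.instance Definition _ i := GRing.isZmodMorphism.Build smfun smfun (spd i) (spd_additive i).

Lemma spdM i f g : spd i (f * g) = spd i f * g + f * spd i g.
Proof.
apply: smfunP => x Ux; rewrite smfunDE // !smfunME // !spdE //.
rewrite -(pd_mul i (dom_rel D) (smfun_smooth f) (smfun_smooth g) Ux).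
by apply: (pd_ext i (dom_rel D)) => // y Uy; rewrite smfunME.
Qed.

Lemma spdC i j f : spd i (spd j f) = spd j (spd i f).
Proof.
have spd2 k l x : U x -> spd k (spd l f) x = pd k (pd l f) x.
  by move=> Ux; apply: etrans (spdE _ _ Ux) (pd_ext k (dom_rel D) (spdE l f) Ux).
apply: smfunP => x Ux; apply: etrans (spd2 _ _ _ Ux) (etrans _ (esym (spd2 _ _ _ Ux))).
exact: (pd_comm i j (dom_rel D) (smfun_smooth f) Ux).
Qed.

Lemma spd_alg i (a : R) : spd i (a%:A) = 0.
Proof.
apply: smfunP => x Ux; rewrite spdE // smfun0E // -(pd_cst a i (dom_rel D) Ux).
by apply: (pd_ext i (dom_rel D)) => // y Uy; rewrite smfun_algE.
Qed.

End DomainFunctions.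

Section ConcreteForms.
Context {A : comNzRingType} {n : nat}.
Local Notation Om := {ffun {set 'I_n} -> A^o}.

Definition form_fermions : fermions Om n :=
  @Fermions A Om n (fun i => @eE A n i) (fun i => @eI A n i)
    (@eE_eE A n) (@eI_eI A n) (@eE_eI A n).

End ConcreteForms.

Section ConcreteDerivations.
Context {R : realType} {n : nat}.
Variable D : @domain R n.
Local Notation A := (smfun D).
Local Notation Om := {ffun {set 'I_n.+1} -> A^o}.

Definition form_pd (i : 'I_n.+1) (F : Om) : Om := [ffun S => spd i (F S)].

Fact form_pd_additive i : zmod_morphism (form_pd i).
Proof. by move=> F G; apply/ffunP => S; rewrite !ffunE raddfB. Qed.
HB.instance Definition _ i :=
  GRing.isZmodMorphism.Build Om Om (form_pd i) (form_pd_additive i).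

Lemma spd_sign i k : spd i ((-1) ^+ k : A) = 0.
Proof.
have -> : (-1) ^+ k = ((-1) ^+ k : R)%:A :> A; last exact: spd_alg.
by rewrite -in_algE rmorphXn rmorphN1.
Qed.

Fact form_pdZ i (x : A) (F : Om) : form_pd i (x *: F) = spd i x *: F + x *: form_pd i F.
Proof. by apply/ffunP => S; rewrite !ffunE spdM. Qed.

Fact form_pdE i j (F : Om) : form_pd i (eE j F) = eE j (form_pd i F).
Proof.
apply/ffunP => S; rewrite !ffunE; case: ifP => _; last by rewrite raddf0.
by rewrite spdM spd_sign mul0r add0r.
Qed.

Fact form_pdI i j (F : Om) : form_pd i (eI j F) = eI j (form_pd i F).
Proof.
apply/ffunP => S; rewrite !ffunE; case: ifP => _; first by rewrite raddf0.
by rewrite spdM spd_sign mul0r add0r.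
Qed.

Fact form_pdC i j (F : Om) : form_pd i (form_pd j F) = form_pd j (form_pd i F).
Proof.
apply/ffunP => S; rewrite [LHS]ffunE [in LHS]ffunE [RHS]ffunE [in RHS]ffunE.
exact: spdC.
Qed.

Definition domain_derivations : form_derivations (@form_fermions A n.+1) :=
  @FormDerivations A Om n.+1 form_fermions (fun i => @spd R n D i) form_pd
    (@spdM R n D) (@spdC R n D) form_pdZ form_pdC form_pdE form_pdI.

End ConcreteDerivations.

(** * From rings of functions to charts *)

Section Transport.
Context {R : realType} {n : nat}.
Local Notation d := n.+1.
Local Notation vec := 'rV[R]_d.
Variable D : @domain R n.
Local Notation U := (dom_set D).
Local Notation A := (smfun D).
Local Notation Om := {ffun {set 'I_d} -> A^o}.
Local Notation Z := (@form_fermions A d).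
Local Notation Y := (domain_derivations D).
Local Notation hf := ((2^-1 : R)%:A : A).

(** Evaluation carries the proof that x lies in the domain because it is a ring morphism only there:
    off the domain even 1 takes the value 0. *)
Definition ev (x : vec) (Ux : U x) (f : A) : R := f x.

Fact ev_additive x (Ux : U x) : zmod_morphism (ev Ux).
Proof. by move=> f f'; rewrite /ev smfunDE // smfunNE. Qed.
HB.instance Definition _ x (Ux : U x) :=
  GRing.isZmodMorphism.Build A R (ev Ux) (ev_additive Ux).

Fact ev_multiplicative x (Ux : U x) : monoid_morphism (ev Ux).
Proof. by split=> [|f f']; rewrite /ev ?smfun1E // smfunME. Qed.
HB.instance Definition _ x (Ux : U x) :=
  GRing.isMonoidMorphism.Build A R (ev Ux) (ev_multiplicative Ux).

Lemma spd_rel i (f : A) (f0 : vec -> R) x : (forall y, U y -> f y = f0 y) -> U x ->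
  spd i f x = pd i f0 x.
Proof. by move=> ff0 Ux; rewrite spdE //; exact: (pd_ext i (dom_rel D)). Qed.

Variable g : lmetric R n.
Hypothesis g_smooth : forall i j, smooth_on U (fun x => g x i j).
Hypothesis g_tr : forall x, U x -> (g x)^T = g x.
Hypothesis g_unit : forall x, U x -> g x \in unitmx.

Definition gA : 'M[A]_d := \matrix_(i, j) restr (g_smooth i j).

Lemma gAE i j x : U x -> gA i j x = g x i j.
Proof. by move=> Ux; rewrite mxE restrE. Qed.

Lemma map_gA x (Ux : U x) : map_mx (ev Ux) gA = g x.
Proof. by apply/matrixP => i j; rewrite mxE /ev gAE. Qed.

Lemma det_gA x : U x -> (\det gA) x = \det (g x).
Proof. by move=> Ux; rewrite -(map_gA Ux) (det_map_mx (ev Ux)). Qed.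

Fact det_gA_neq0 x : U x -> (\det gA) x != 0.
Proof. by move=> Ux; rewrite det_gA // -unitfE -unitmxE g_unit. Qed.

(** [invmx] requires a unit ring, which [smfun] is not declared to be; the adjugate formula also
    shows that the entries of the inverse are smooth. *)
Definition GA : 'M[A]_d :=
  restr (smooth_inv det_gA_neq0 (smfun_smooth (\det gA))) *: \adj gA.

Lemma gA_GA : gA *m GA = 1%:M.
Proof.
rewrite /GA -scalemxAr mul_mx_adj scale_scalar_mx; congr (_%:M).
by apply: smfunP => x Ux; rewrite smfunME // restrE // mulVf ?smfun1E // det_gA_neq0.
Qed.

Lemma gA_tr : gA^T = gA.
Proof.
by apply/matrixP => i j; apply: smfunP => x Ux; rewrite mxE !gAE // -{1}(g_tr Ux) mxE.
Qed.

Lemma GA_tr : GA^T = GA.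
Proof.
have := congr1 trmx gA_GA; rewrite trmx_mul trmx1 gA_tr => e.
by rewrite -[LHS]mulmx1 -gA_GA mulmxA e mul1mx.
Qed.

Lemma map_GA x (Ux : U x) : map_mx (ev Ux) GA = invmx (g x).
Proof.
have := congr1 (map_mx (ev Ux)) gA_GA; rewrite map_mxM map_mx1 map_gA => e.
by rewrite -[LHS]mul1mx -(mulVmx (g_unit Ux)) -mulmxA e mulmx1.
Qed.

Lemma GAE i j x : U x -> GA i j x = invmx (g x) i j.
Proof. by move=> Ux; rewrite -(map_GA Ux) [RHS]mxE. Qed.

Local Notation gam := (chr Y hf gA GA).

Lemma chr_rel a b c x : U x -> gam a b c x = christoffel g c a b x.
Proof.
move=> Ux; rewrite mxE smfun_sumE // /christoffel mulr_sumr; apply: eq_bigr => i _.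
have -> : chrL Y hf gA a b i
    = hf * (spd a (gA i b) + spd b (gA i a) - spd i (gA a b)) by rewrite mxE.
rewrite smfunME // smfunME // smfun_algE // smfunDE // smfunDE // smfunNE //.
rewrite (spd_rel a (gAE i b)) // (spd_rel b (gAE i a)) // (spd_rel i (gAE a b)) //.
have -> : GA i c = GA c i by rewrite -{1}GA_tr [LHS]mxE.
by rewrite GAE // mulrAC -mulrA.
Qed.

Lemma pA_domain i f : pA Y i f = spd i f. Proof. by []. Qed.

Lemma ric_rel a b x : U x -> ric Y hf gA GA a b x = ricci g x a b.
Proof.
move=> Ux; rewrite [ric _ _ _ _ _ _]mxE [ricci _ _ _ _]mxE smfun_sumE //; apply: eq_bigr => c _.
rewrite smfunDE // smfunDE // smfunNE // smfun_sumE // !pA_domain.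
congr (_ - _ + _).
- exact (spd_rel c (chr_rel a b c) Ux).
- exact (spd_rel b (chr_rel a c c) Ux).
- apply: eq_bigr => i _; rewrite (smfunDE _ _ Ux) (smfunNE _ Ux).
  rewrite (smfunME _ _ Ux) (smfunME (gam b i c) _ Ux).
  exact (congr2 (fun u v => u - v)
    (congr2 *%R (chr_rel c i c Ux) (chr_rel a b i Ux))
    (congr2 *%R (chr_rel b i c Ux) (chr_rel a c i Ux))).
Qed.

Definition ricA : 'M[A]_d := ric Y hf gA GA.
Definition JA : A := ((2 * (d%:R - 1))^-1 : R) *: \tr (GA *m ricA).
Definition PA : 'M[A]_d :=
  \matrix_(i, j) (((d%:R - 2)^-1 : R) *: (ricA i j - JA * gA i j)).

Lemma J_rel x : U x -> JA x = schoutenJ g x.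
Proof.
move=> Ux; rewrite smfunZE // /schoutenJ mulrC; congr (_ / _).
rewrite -[LHS]/(ev Ux (\tr _)) -trace_map_mx map_mxM map_GA; congr (\tr (_ *m _)).
by apply/matrixP => i j; rewrite [LHS]mxE; exact (ric_rel i j Ux).
Qed.

Lemma P_rel i j x : U x -> PA i j x = schouten g x i j.
Proof.
move=> Ux; rewrite /schouten scalemxE addmxE oppmxE scalemxE [PA i j]mxE.
rewrite (smfunZE _ _ Ux) (smfunDE _ _ Ux) (smfunNE _ Ux) (smfunME _ _ Ux).
rewrite (J_rel Ux) (gAE _ _ Ux); congr (_ * (_ - _)); exact (ric_rel i j Ux).
Qed.

Variable s : lscalar R n.
Hypothesis s_smooth : smooth_on U s.
Definition sA : A := restr s_smooth.

Lemma sAE x : U x -> sA x = s x. Proof. exact: restrE. Qed.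

Definition HA : 'M[A]_d := hessian Y gA GA sA.
Definition rhoA : A := - ((d%:R)^-1 : R) *: (\tr (GA *m HA) + JA * sA).

Definition hess (a b : 'I_d) (x : vec) : R :=
  pd a (pd b s) x - \sum_c christoffel g c a b x * pd c s x.

Lemma H_rel a b x : U x -> HA a b x = hess a b x.
Proof.
move=> Ux.
have -> : HA a b = spd a (spd b sA) - \sum_c gam a b c * spd c sA by rewrite mxE.
rewrite (smfunDE _ _ Ux) (smfunNE _ Ux) (smfun_sumE _ _ _ Ux).
rewrite (spd_rel a (f0 := pd b s) _ Ux); last by move=> y Uy; exact: spd_rel sAE Uy.
congr (_ - _); apply: eq_bigr => c _.
rewrite (smfunME _ _ Ux) (spd_rel c sAE Ux).
exact (congr1 (fun z => z * _) (chr_rel a b c Ux)).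
Qed.

Lemma rho_rel x : U x -> rhoA x = rho g s x.
Proof.
move=> Ux; rewrite smfunZE // smfunDE // smfunME // J_rel // sAE //; congr (_ * (_ + _)).
rewrite mxtrace_mulC smfun_sumE // /laplacian; apply: eq_bigr => a _.
rewrite mxE smfun_sumE //; apply: eq_bigr => b _.
have -> : GA b a = GA a b by rewrite -{1}GA_tr [LHS]mxE.
by rewrite (smfunME _ _ Ux) (GAE _ _ Ux) mulrC (H_rel a b Ux).
Qed.

Definition sq_length (x : vec) : R :=
  \sum_a (\sum_b pd b s x * invmx (g x) b a) * pd a s x.

Lemma sq_length_rel x : U x ->
  (\sum_a ((\row_b spd b sA) *m GA) 0 a * (\row_b spd b sA) 0 a) x = sq_length x.
Proof.
move=> Ux; rewrite (smfun_sumE _ _ _ Ux); apply: eq_bigr => a _.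
have -> : (\row_b spd b sA) 0 a = spd a sA by rewrite mxE.
rewrite (smfunME _ _ Ux) (spd_rel a sAE Ux); congr (_ * _).
rewrite [(_ *m GA) 0 a]mxE (smfun_sumE _ _ _ Ux); apply: eq_bigr => b _.
have -> : (\row_b spd b sA) 0 b = spd b sA by rewrite mxE.
by rewrite (smfunME _ _ Ux) (spd_rel b sAE Ux) (GAE _ _ Ux).
Qed.

Lemma smfun_natK (m : nat) (f : A) : m.+1%:R * f = 0 -> f = 0.
Proof.
move=> e; apply: smfunP => x Ux; rewrite (smfun0E Ux).
have := congr1 (fun f : A => f x) e.
rewrite (smfunME _ _ Ux) (smfun_natE _ Ux) (smfun0E Ux) => /eqP.
by rewrite mulf_eq0 pnatr_eq0 => /eqP.
Qed.

Lemma trace_rhoA : d%:R * rhoA + (\tr (GA *m HA) + JA * sA) = 0.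
Proof.
apply: smfunP => x Ux; rewrite (smfunDE _ _ Ux) (smfunME _ _ Ux) (smfun_natE _ Ux).
rewrite (smfunZE _ _ Ux) (smfun0E Ux) mulrA mulrN divff ?pnatr_eq0 // mulN1r.
exact: addNr.
Qed.

Hypothesis n_ge2 : (2 <= n)%N.

Fact trace_JA : 2 * (d%:R - 1) * JA = \tr (GA *m ricA).
Proof.
apply: smfunP => x Ux; rewrite /JA -scalerAr (smfunZE _ _ Ux) (smfunME _ _ Ux).
rewrite (smfunME _ _ Ux) (smfunDE d%:R (- 1) Ux) (smfunNE _ Ux) (smfun1E Ux) !(smfun_natE _ Ux).
have -> : d%:R - 1 = n%:R :> R by rewrite -natr1 addrK.
by rewrite mulrA mulVf ?mul1r // mulf_neq0 // pnatr_eq0 -lt0n ltnW.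
Qed.

Fact schouten_PA : (d%:R - 2) *: PA = ricA - JA *: gA.
Proof.
apply/matrixP => i j; apply: smfunP => x Ux.
rewrite scalemxE addmxE oppmxE scalemxE [PA i j]mxE -scalerAr (smfunZE _ _ Ux).
rewrite (smfunME _ _ Ux) (smfunDE d%:R (- 2) Ux) (smfunNE _ Ux) !(smfun_natE _ Ux).
by rewrite mulrA mulVf ?mul1r // subr_eq0 eqr_nat eqSS gtn_eqF.
Qed.

End Transport.

(** * The Einstein equation in the interior and up to the boundary *)

Section Interior.
Context {R : realType} {n : nat}.
Local Notation d := n.+1.
Local Notation vec := 'rV[R]_d.
Variable D : @domain R n.
Local Notation U := (dom_set D).
Local Notation A := (smfun D).
Local Notation Y := (domain_derivations D).
Local Notation hf := ((2^-1 : R)%:A : A).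
Variable g : lmetric R n.
Hypothesis g_smooth : forall i j, smooth_on U (fun x => g x i j).
Hypothesis g_tr : forall x, U x -> (g x)^T = g x.
Hypothesis g_unit : forall x, U x -> g x \in unitmx.
Variable s : lscalar R n.
Hypothesis s_smooth : smooth_on U s.
Hypothesis n_ge2 : (2 <= n)%N.
Hypothesis s_neq0 : forall x, U x -> s x != 0.
Let go : lmetric R n := fun x => s x ^- 2 *: g x.
Hypothesis go_einstein : forall x, U x -> ricci go x = - n%:R *: go x.

Let s' : A := sA s_smooth.
Let t : A := restr (smooth_inv s_neq0 s_smooth).

Let tE x : U x -> t x = (s x)^-1. Proof. by move=> Ux; rewrite restrE. Qed.

Let st : s' * t = 1.
Proof.
by apply: smfunP => x Ux; rewrite (smfunME _ _ Ux) tE // sAE // mulfV ?s_neq0 // smfun1E.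
Qed.

Let t2g : 'M[A]_d := t ^+ 2 *: gA g_smooth.

Let t2gE i j x : U x -> t2g i j x = go x i j.
Proof.
move=> Ux; rewrite /t2g scalemxE (smfunME _ _ Ux) (smfunME _ _ Ux) tE // gAE //.
by rewrite /go scalemxE -exprVn expr2.
Qed.

Let go_smooth i j : smooth_on U (fun x => go x i j).
Proof. by apply: smooth_ext (smfun_smooth (t2g i j)) => x Ux; rewrite t2gE. Qed.

Let go_tr x : U x -> (go x)^T = go x.
Proof. by move=> Ux; rewrite /go linearZ /= g_tr. Qed.

Let go_unit x : U x -> go x \in unitmx.
Proof.
move=> Ux; rewrite /go unitmxZ ?g_unit // unitfE invr_eq0 expf_eq0 /=.
by rewrite s_neq0.
Qed.

Let gA_go : gA go_smooth = t2g.
Proof. by apply/matrixP => i j; apply: smfunP => x Ux; rewrite gAE // t2gE. Qed.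

Let GA_go : GA go_smooth go_unit = s' ^+ 2 *: GA g_smooth g_unit.
Proof.
have e : gA go_smooth *m (s' ^+ 2 *: GA g_smooth g_unit) = 1%:M.
  rewrite gA_go /t2g -scalemxAr -scalemxAl gA_GA scalerA -exprMn st expr1n.
  by rewrite scale1r.
by rewrite -[LHS]mulmx1 -e mulmxA (mulmx1C (gA_GA go_smooth go_unit)) mul1mx.
Qed.

(** Where sigma has no zeros it is invertible in the ring, so sigma^-2 g is itself a metric over
    that ring and [einstein_rescaling] applies. *)
Lemma interior_einstein :
  HA g_smooth g_unit s_smooth + s' *: PA g_smooth g_unit
    + rhoA g_smooth g_unit s_smooth *: gA g_smooth = 0 /\
  \sum_a ((\row_b spd b s') *m GA g_smooth g_unit) 0 a * (\row_b spd b s') 0 a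
    + 2 * s' * rhoA g_smooth g_unit s_smooth = 1.
Proof.
apply: (@einstein_rescaling _ _ _ _ Y hf _ _ _ (gA_tr g_smooth g_tr)
  (GA_tr g_smooth g_tr g_unit) (gA_GA g_smooth g_unit) _ _ st _ _ _ (@smfun_natK R n D) n_ge2
  (trace_rhoA g_smooth g_unit s_smooth) (trace_JA g_smooth g_unit n_ge2)
  (schouten_PA g_smooth g_unit n_ge2)).
  by rewrite -scalerDl -[2^-1 in X in X + _]mul1r -[2^-1 in X in _ + X]mul1r -splitr scale1r.
rewrite -GA_go -/t2g -gA_go; apply/matrixP => a b; apply: smfunP => x Ux.
rewrite (ric_rel go_smooth go_tr go_unit a b Ux) (go_einstein Ux).
rewrite !scalemxE (smfunME _ _ Ux) (gAE _ _ _ Ux) (smfunNE _ Ux) (smfunDE d%:R (- 1) Ux).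
rewrite (smfunNE _ Ux) (smfun1E Ux) (smfun_natE _ Ux); congr (- _ * _).
by rewrite -natr1 addrK.
by rewrite /go scalemxE.
Qed.

End Interior.

Section Einstein.
Context {R : realType} {n : nat}.
Local Notation d := n.+1.
Local Notation vec := 'rV[R]_d.

Lemma open_positive : open [set x : vec | 0 < x 0 ord0].
Proof.
apply: (@open_comp vec R^o (fun x => x 0 ord0) [set t | 0 < t]); last exact: open_gt.
by move=> x _; exact: matrix_normedtype.coord_continuous.
Qed.

Lemma smooth_sub (U U' : set vec) f : U' `<=` U -> smooth_on U f -> smooth_on U' f.
Proof.
by move=> s sf x /s /sf [V [h [oV Vx Ch hf]]]; exists V, h; split=> // z Vz /s; exact: hf.
Qed.

Section Values.
Variable D : @domain R n.
Local Notation U := (dom_set D).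
Variable g : lmetric R n.
Hypothesis g_smooth : forall i j, smooth_on U (fun x => g x i j).
Hypothesis g_tr : forall x, U x -> (g x)^T = g x.
Hypothesis g_unit : forall x, U x -> g x \in unitmx.
Variable s : lscalar R n.
Hypothesis s_smooth : smooth_on U s.

Lemma einstein_tensor_rel a b x : U x ->
  (HA g_smooth g_unit s_smooth + sA s_smooth *: PA g_smooth g_unit
     + rhoA g_smooth g_unit s_smooth *: gA g_smooth) a b x
  = hess g s a b x + s x * schouten g x a b + rho g s x * g x a b.
Proof.
move=> Ux; rewrite !addmxE !scalemxE (smfunDE _ _ Ux) (smfunDE (HA _ _ _ _ _) _ Ux).
rewrite (smfunME _ _ Ux) (smfunME (rhoA _ _ _) _ Ux).
rewrite (H_rel g_smooth g_tr g_unit s_smooth a b Ux).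
rewrite (rho_rel g_smooth g_tr g_unit s_smooth Ux) (sAE s_smooth Ux).
rewrite (P_rel g_smooth g_tr g_unit a b Ux) (gAE g_smooth a b Ux).
by rewrite [schouten g x a b]scalemxE.
Qed.

Lemma unit_length_rel x : U x ->
  (\sum_a ((\row_b spd b (sA s_smooth)) *m GA g_smooth g_unit) 0 a
       * (\row_b spd b (sA s_smooth)) 0 a
    + 2 * sA s_smooth * rhoA g_smooth g_unit s_smooth) x
  = sq_length g s x + 2 * s x * rho g s x.
Proof.
move=> Ux; rewrite (smfunDE _ _ Ux) (sq_length_rel g_smooth g_unit s_smooth Ux).
congr (_ + _); rewrite (smfunME (2 * sA s_smooth) _ Ux) (smfunME 2 _ Ux).
by rewrite (rho_rel g_smooth g_tr g_unit s_smooth Ux) (sAE s_smooth Ux) (smfun_natE 2 Ux).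
Qed.

End Values.

Variable D : @domain R n.
Local Notation U := (dom_set D).
Local Notation A := (smfun D).
Variable g : lmetric R n.
Hypothesis g_smooth : forall i j, smooth_on U (fun x => g x i j).
Hypothesis g_tr : forall x, U x -> (g x)^T = g x.
Hypothesis g_unit : forall x, U x -> g x \in unitmx.
Variable s : lscalar R n.
Hypothesis s_smooth : smooth_on U s.
Hypothesis n_ge2 : (2 <= n)%N.
Hypothesis s_neq0 : forall x, U x -> 0 < x 0 ord0 -> s x != 0.
Hypothesis go_einstein : forall x, U x -> 0 < x 0 ord0 ->
  let go : lmetric R n := fun x => s x ^- 2 *: g x in ricci go x = - n%:R *: go x.

Fact interior_rel_open : rel_open (U `&` [set x : vec | 0 < x 0 ord0]).
Proof.
have [V0 oV0 UE] := dom_rel D.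
exists (V0 `&` [set x : vec | 0 < x 0 ord0]).
  exact: openI open_positive.
by rewrite UE -!setIA; congr (_ `&` _); rewrite setIC.
Qed.

(** Passes to the ring of the interior part of the domain. The tensors are built by local operators,
    so their values at a point are the same from either ring, and only such values are compared. *)
Fact interior_values x : U x -> 0 < x 0 ord0 ->
  (forall a b, hess g s a b x + s x * schouten g x a b + rho g s x * g x a b = 0) /\
  sq_length g s x + 2 * s x * rho g s x = 1.
Proof.
move=> Ux x0.
pose Di := Domain interior_rel_open (conj Ux x0 : (U `&` [set x : vec | 0 < x 0 ord0]) x).
have gs i j : smooth_on (dom_set Di) (fun x => g x i j).
  exact: smooth_sub (@subIsetl _ _ _) (g_smooth i j).
have gt y : dom_set Di y -> (g y)^T = g y by case=> Uy _; exact: g_tr.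
have gu y : dom_set Di y -> g y \in unitmx by case=> Uy _; exact: g_unit.
have ss : smooth_on (dom_set Di) s.
  exact: smooth_sub (@subIsetl _ _ _) s_smooth.
have s0 y : dom_set Di y -> s y != 0 by case; exact: s_neq0.
have ge y : dom_set Di y -> ricci (fun x => s x ^- 2 *: g x) y = - n%:R *: (s y ^- 2 *: g y).
  by case; exact: go_einstein.
have Dx : dom_set Di x by [].
have [e1 e2] := interior_einstein gs gt gu ss n_ge2 s0 ge; split=> [a b|].
  rewrite -(einstein_tensor_rel gs gt gu ss a b Dx) e1 [_ a b]mxE; exact: smfun0E.
by rewrite -(unit_length_rel gs gt gu ss Dx) e2; exact: smfun1E.
Qed.

Lemma domain_einstein :
  HA g_smooth g_unit s_smooth + sA s_smooth *: PA g_smooth g_unit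
     + rhoA g_smooth g_unit s_smooth *: gA g_smooth = 0.
Proof.
apply/matrixP => a b; rewrite [RHS]mxE; apply: smfunP => x Ux; rewrite (smfun0E Ux).
apply: (smooth_vanish (dom_rel D) (smfun_smooth _)) x Ux => x Ux x0.
by rewrite einstein_tensor_rel //; apply: (interior_values Ux x0).1.
Qed.

Lemma domain_unit_length :
  \sum_a ((\row_b spd b (sA s_smooth)) *m GA g_smooth g_unit) 0 a
       * (\row_b spd b (sA s_smooth)) 0 a
    + 2 * sA s_smooth * rhoA g_smooth g_unit s_smooth = 1.
Proof.
apply/eqP; rewrite -subr_eq0; apply/eqP; apply: smfunP => x Ux; rewrite (smfun0E Ux).
apply: (smooth_vanish (dom_rel D) (smfun_smooth _)) x Ux => x Ux x0.
rewrite (smfunDE _ _ Ux) (smfunNE _ Ux) (smfun1E Ux) unit_length_rel //.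
by rewrite (interior_values Ux x0).2 subrr.
Qed.

(** sigma is nonzero at interior points, so f vanishes there, and then everywhere by continuity. *)
Lemma domain_regular (f : A) : sA s_smooth * f = 0 -> f = 0.
Proof.
move=> e; apply: smfunP => x Ux; rewrite (smfun0E Ux).
apply: (smooth_vanish (dom_rel D) (smfun_smooth _)) x Ux => x Ux x0.
have := congr1 (fun h : A => h x) e; rewrite (smfunME _ _ Ux) (smfun0E Ux) (sAE _ Ux).
by move/eqP; rewrite mulf_eq0 (negbTE (s_neq0 Ux x0)) => /eqP.
Qed.

End Einstein.

(** * Invariance of the boundary, and the metrics of the conformal class in charts *)

Section Minimum.
Context {R : realType} {n : nat}.
Local Notation vec := 'rV[R]_n.+1.
Local Notation e := (@basis_vec R n).

(** Fermat's criterion: at x both signs of the step are allowed, and the two one-sided estimates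
    have opposite signs. *)
Lemma pd_minimum (U : set vec) (f : vec -> R) x i : rel_open U -> smooth_on U f ->
  U x -> 0 < x 0 ord0 -> (forall y, U y -> f x <= f y) -> pd i f x = 0.
Proof.
move=> Uo sf Ux x0 fmin; have [V [h [oV Vx Ch hf]]] := sf x Ux.
have dh : derivable h x (e i) by have [_ ] := Ch [::] x Vx; exact.
rewrite (pd_eq Uo oV Ux Vx hf dh).
have [V0 oV0 UE] := Uo.
have near_U : \forall t \near (0 : R), f x <= h (t *: e i + x).
  have V0x : V0 x by move: Ux; rewrite UE => -[].
  have l := @line_cvg R n i x.
  have n1 : \forall t \near (0 : R), V0 (t *: e i + x) by apply: l; apply: open_nbhs_nbhs.
  have n2 : \forall t \near (0 : R), V (t *: e i + x) by apply: l; apply: open_nbhs_nbhs.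
  have n3 : \forall t \near (0 : R), 0 < (t *: e i + x : vec) 0 ord0.
    exact (l [set y : vec | 0 < y 0 ord0] (open_nbhs_nbhs (conj open_positive x0))).
  apply: filterS3 n1 n2 n3 => t V0t Vt t0.
  have Ut : U (t *: e i + x) by rewrite UE; split=> //; exact: ltW.
  by rewrite hf //; exact: fmin.
have cvg_side (F : set_system R) : F `=>` (0 : R)^' ->
    (fun t => t^-1 *: (h (t *: e i + x) - h x)) @ F --> 'D_(e i) h x.
  by move=> F0; exact: cvg_trans (cvg_app _ F0) dh.
have fx : h x = f x by exact: hf.
apply/eqP; rewrite eq_le; apply/andP; split.
- have F0 : (0 : R)^'- `=>` (0 : R)^'.
    by apply: within_subset => t /= t0; rewrite lt_eqF.
  apply: (cvgr_to_le (cvg_side _ F0)).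
  move: near_U; apply: filterS => t ht t0.
  by rewrite -oppr_ge0 -mulNr mulr_ge0 // ?subr_ge0 ?fx // oppr_ge0 invr_le0 ltW.
- have F0 : (0 : R)^'+ `=>` (0 : R)^'.
    by apply: within_subset => t /= t0; rewrite gt_eqF.
  apply: (cvgr_to_ge (cvg_side _ F0)).
  move: near_U; apply: filterS => t ht t0.
  by rewrite mulr_ge0 // ?subr_ge0 ?fx // invr_ge0 ltW.
Qed.

End Minimum.

Section Charts.
Context {R : realType} {n : nat}.
Variable M : manifold R n.
Local Notation d := n.+1.
Local Notation vec := 'rV[R]_d.
Local Notation coord := Defs.coord.
Local Notation im a := (coord a @` dom a).
Implicit Types (a b : chart M) (p : M).

Lemma image_rel_open a : rel_open (im a).
Proof. by have [V oV e] := coord_image a; exists V. Qed.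

Lemma overlap_rel_open a b : rel_open (coord a @` (dom a `&` dom b)).
Proof.
have [V oV VE] := image_rel_open a.
have op := (continuousP _).1 (@Defs.icoord_continuous _ _ M a) _ (dom_open b).
have [W oW WE] := (open_subspaceP _ _).1 op.
exists (W `&` V); first exact: openI.
rewrite -setIA -VE WE; apply/seteqP; split=> [x [p [ap bp] <-]|x [bx [p ap px]]].
  by split; [exact (eq_ind_r (dom b) bp (coordK ap)) | exists p].
exists p => //; split=> //; rewrite -(coordK ap).
exact (eq_ind_r (fun z => dom b (icoord a z)) bx px).
Qed.

(** The first coordinate of [b] is nonnegative, so a zero of it is a minimum. At a point which is
    interior in [a] its gradient therefore vanishes, and the Jacobian has a zero column. *)
Lemma degenerate_overlap a b p : dom a p -> dom b p -> 0 < coord a p 0 ord0 ->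
  coord b p 0 ord0 = 0 -> \det (jac a b (coord a p)) = 0.
Proof.
move=> ap bp a0 b0; rewrite -det_tr; apply/eqP/det0P; exists (delta_mx 0 ord0).
  by apply/eqP => /matrixP/(_ 0 ord0); rewrite !mxE !eqxx => /eqP; rewrite oner_eq0.
rewrite -rowE; apply/rowP => i; rewrite !mxE.
apply: (@pd_minimum R n _ _ (coord a p) i (overlap_rel_open a b)
  (@transition_smooth _ _ M a b ord0) _ a0).
- by exists p.
- move=> _ [q [aq bq] <-]; rewrite !coordK // b0.
  have [V _ VE] := coord_image b.
  have : (coord b @` dom b) (coord b q) by exists q.
  by rewrite VE => -[].
Qed.

Variable c : set (metric M).
Hypothesis conf : conformal_class c.

Fact posdef_unit (m : nat) (B : 'M[R]_m) :
  (forall v : 'rV[R]_m, v != 0 -> 0 < (v *m B *m v^T) 0 0) -> B \in unitmx.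
Proof.
move=> pos; rewrite unitmxE unitfE; apply/negP => /det0P [v v0 vB].
by have := pos v v0; rewrite vB mul0mx mxE ltxx.
Qed.

(** A point of positive first coordinate in one chart cannot be on the boundary in another: the
    transformation law of a nondegenerate metric makes the Jacobian invertible, against
    [degenerate_overlap]. *)
Lemma interior_point a p : dom a p -> 0 < coord a p 0 ord0 -> ~ bdry p.
Proof.
move=> ap a0 [b [bp b0]]; have [g0 [_ _ pos tr] _] := conf.
have := posdef_unit (pos a (coord a p) (ex_intro2 _ _ p ap erefl)).
rewrite (tr a b p ap bp) !unitmx_mul => /andP [/andP []].
by rewrite unitmxE (degenerate_overlap ap bp a0 b0) unitr0.
Qed.

Variable g : metric M.
Hypothesis cg : c g.

Lemma conformal_smooth a i j : smooth_on (im a) (fun x => g a x i j).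
Proof.
have [g0 [sm _ _ _] cE] := conf; have [Om [sOm _ gE]] := (cE g).1 cg.
apply: smooth_ext (smooth_mul (smooth_mul (sOm a) (sOm a)) (sm a i j)).
move=> x [p ap <-]; rewrite gE // [RHS]mxE expr2 /=.
by rewrite -[LHS]/(Om (icoord a (coord a p)) * Om (icoord a (coord a p)) * _) coordK.
Qed.

Lemma conformal_tr a x : im a x -> (g a x)^T = g a x.
Proof.
have [g0 [_ sym _ _] cE] := conf; have [Om [_ _ gE]] := (cE g).1 cg.
by move=> [p ap <-]; rewrite gE // linearZ /= sym //; exists p.
Qed.

Lemma conformal_unit a x : im a x -> g a x \in unitmx.
Proof.
have [g0 [_ _ pos _] cE] := conf; have [Om [_ Om0 gE]] := (cE g).1 cg.
move=> [p ap <-]; rewrite gE // unitmxZ; last by rewrite unitfE expf_neq0 // gt_eqF.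
by apply: posdef_unit; apply: pos; exists p.
Qed.

End Charts.

(** * Components in a chart and their abstract counterparts *)

Section FormTransport.
Context {R : realType} {n : nat}.
Local Notation d := n.+1.
Local Notation vec := 'rV[R]_d.
Variable D : @domain R n.
Local Notation U := (dom_set D).
Local Notation A := (smfun D).
Local Notation Om := {ffun {set 'I_d} -> A^o}.
Local Notation Z := (@form_fermions A d).
Local Notation Y := (domain_derivations D).
Local Notation hf := ((2^-1 : R)%:A : A).
Implicit Types (f : Om) (F : lform R n) (x : vec).

Definition form_value x f : ealg R n := [ffun S => (f S : A) x].

Section AtPoint.
Variables (x : vec) (Ux : U x).
Local Notation val := (form_value x).

Lemma form_valueD f f' : val (f + f') = val f + val f'.
Proof. by apply/ffunP => S; rewrite !ffunE; exact: smfunDE. Qed.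

Lemma form_valueN f : val (- f) = - val f.
Proof. by apply/ffunP => S; rewrite !ffunE; exact: smfunNE. Qed.

Lemma form_value0 : val 0 = 0.
Proof. by apply/ffunP => S; rewrite !ffunE; exact: smfun0E. Qed.

Lemma form_valueZ (a : A) f : val (a *: f) = a x *: val f.
Proof. by apply/ffunP => S; rewrite !ffunE; exact: smfunME. Qed.

Lemma form_value_sum (I : Type) (r : seq I) (P : pred I) (f : I -> Om) :
  val (\sum_(i <- r | P i) f i) = \sum_(i <- r | P i) val (f i).
Proof. by apply: (big_morph val); [exact: form_valueD | exact: form_value0]. Qed.

Lemma smfun_sign m : (((-1) ^+ m : A) : vec -> R) x = (-1) ^+ m.
Proof. by rewrite -[LHS]/(ev Ux _) rmorphXn rmorphN1. Qed.

Lemma wedge_basis i (F : ealg R n) S :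
  wedge (basis_vec i) F S = if i \in S then ins_sign i S * F (S :\ i)%SET else 0.
Proof.
rewrite ffunE; case: ifP => iS.
  rewrite (bigD1 i) //= !mxE !eqxx mulr1 big1 ?addr0 // => j /andP [_ /negbTE ji].
  by rewrite mxE ji mulr0 mul0r.
rewrite big1 // => j jS; rewrite mxE /=; have [ji|] := eqVneq j i.
  by rewrite -ji jS in iS.
by rewrite mulr0 mul0r.
Qed.

Lemma contract_basis i (F : ealg R n) S :
  contract (basis_vec i) F S = if i \in S then 0 else ins_sign i S * F (i |: S)%SET.
Proof.
rewrite ffunE; case: ifPn => iS.
  rewrite big1 // => j jS; rewrite mxE /=; have [ji|] := eqVneq j i.
    by rewrite -ji (negbTE jS) in iS.
  by rewrite mulr0 mul0r.
rewrite (bigD1 i) //= !mxE !eqxx mulr1 big1 ?addr0 // => j /andP [_ /negbTE ji].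
by rewrite mxE ji mulr0 mul0r.
Qed.

Lemma wedge_sum u (F : ealg R n) : wedge u F = \sum_i u 0 i *: wedge (basis_vec i) F.
Proof.
apply/ffunP => S; rewrite sum_ffunE [LHS]ffunE [RHS](bigID (mem S)) /= [X in _ + X]big1 ?addr0.
  apply: eq_bigr => i iS; rewrite [RHS]ffunE wedge_basis iS -mulrA; exact: mulrCA.
by move=> i /negbTE iS; rewrite ffunE wedge_basis iS; exact: mulr0.
Qed.

Lemma contract_sum u (F : ealg R n) :
  contract u F = \sum_i u 0 i *: contract (basis_vec i) F.
Proof.
apply/ffunP => S; rewrite sum_ffunE [LHS]ffunE [RHS](bigID (mem S)) /= [X in X + _]big1 ?add0r.
  apply: eq_bigr => i /negbTE iS; rewrite [RHS]ffunE contract_basis iS -mulrA.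
  exact: mulrCA.
by move=> i iS; rewrite ffunE contract_basis iS; exact: mulr0.
Qed.

Lemma form_value_E i f : val (eE i f) = wedge (basis_vec i) (val f).
Proof.
apply/ffunP => S; rewrite wedge_basis ffunE [eE i f S]ffunE; case: ifP => _.
  by rewrite (smfunME _ _ Ux) [in RHS]ffunE; congr (_ * _); exact: smfun_sign.
exact: smfun0E.
Qed.

Lemma form_value_I i f : val (eI i f) = contract (basis_vec i) (val f).
Proof.
apply/ffunP => S; rewrite contract_basis ffunE [eI i f S]ffunE; case: ifP => _.
  exact: smfun0E.
by rewrite (smfunME _ _ Ux) [in RHS]ffunE; congr (_ * _); exact: smfun_sign.
Qed.

Lemma form_value_W (u : 'rV[A]_d) (u' : vec) f : (forall i, u 0 i x = u' 0 i) ->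
  val (eW Z u f) = wedge u' (val f).
Proof.
move=> uE; rewrite wedge_sum form_value_sum; apply: eq_bigr => i _.
by rewrite form_valueZ uE; congr (_ *: _); exact: form_value_E.
Qed.

Lemma form_value_C (u : 'rV[A]_d) (u' : vec) f : (forall i, u 0 i x = u' 0 i) ->
  val (eC Z u f) = contract u' (val f).
Proof.
move=> uE; rewrite contract_sum form_value_sum; apply: eq_bigr => i _.
by rewrite form_valueZ uE; congr (_ *: _); exact: form_value_I.
Qed.

End AtPoint.

(** A relation and not an equality, because components off the domain are arbitrary while the
    elements of [smfun] vanish there. *)
Definition represents f F := forall x, U x -> form_value x f = F x.

Lemma representsE f F S x : represents f F -> U x -> f S x = F x S.
Proof. by move=> fF Ux; rewrite -(fF x Ux) ffunE. Qed.

Lemma represents0 : represents 0 0.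
Proof. by move=> x Ux; exact: form_value0. Qed.

Lemma representsD f F f' F' :
  represents f F -> represents f' F' -> represents (f + f') (F + F').
Proof. by move=> fF fF' x Ux; rewrite (form_valueD Ux) fF // fF'. Qed.

Lemma representsN f F : represents f F -> represents (- f) (- F).
Proof. by move=> fF x Ux; rewrite (form_valueN Ux) fF. Qed.

Lemma represents_smul (a : A) (a' : lscalar R n) f F : (forall x, U x -> a x = a' x) ->
  represents f F -> represents (a *: f) (smul a' F).
Proof. by move=> aa fF x Ux; rewrite (form_valueZ Ux) fF // aa. Qed.

Lemma representsZ (a : R) f F :
  represents f F -> represents (a *: (f : restrict_scalars Om)) (a *: F).
Proof.
by move=> fF x Ux; rewrite [LHS](form_valueZ Ux) (smfun_algE a Ux) fF.
Qed.

Variable g : lmetric R n.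
Hypothesis g_smooth : forall i j, smooth_on U (fun x => g x i j).
Hypothesis g_tr : forall x, U x -> (g x)^T = g x.
Hypothesis g_unit : forall x, U x -> g x \in unitmx.
Local Notation gA := (gA g_smooth).
Local Notation GA := (GA g_smooth g_unit).
Variable s : lscalar R n.
Hypothesis s_smooth : smooth_on U s.
Local Notation sA := (sA s_smooth).

Lemma represents_nabla a f F : represents f F ->
  represents (nab Y hf gA GA a f) (nabla g a F).
Proof.
move=> fF x Ux; rewrite (form_valueD Ux) (form_valueN Ux); congr (_ - _).
  apply/ffunP => S; rewrite [LHS]ffunE [RHS]ffunE [in LHS]ffunE.
  by apply: (spd_rel a) => // y Uy; exact: representsE.
rewrite (form_value_sum Ux); apply: eq_bigr => b _.
rewrite (form_value_sum Ux); apply: eq_bigr => e _.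
rewrite (form_valueZ Ux) (chr_rel g_smooth g_tr g_unit a b e Ux); congr (_ *: _).
by rewrite [LHS](form_value_E Ux) [in LHS](form_value_I Ux) fF.
Qed.

Lemma represents_d f F : represents f F -> represents (gd Y hf gA GA f) (dform g F).
Proof.
move=> fF x Ux; rewrite (form_value_sum Ux); apply: eq_bigr => a _.
rewrite [LHS](form_value_E Ux); congr (wedge _ _).
exact (represents_nabla a fF Ux).
Qed.

Lemma represents_codiff f F : represents f F ->
  represents (gdel Y hf gA GA f) (codiff g F).
Proof.
move=> fF x Ux; rewrite (form_value_sum Ux); apply: eq_bigr => a _.
rewrite [LHS](form_value_C Ux (u' := basis_vec a *m invmx (g x))).
  by congr (contract _ _); exact (represents_nabla a fF Ux).
by move=> i; rewrite -rowE [row _ _ _ _]mxE [RHS]mxE; exact: (GAE g_smooth g_unit).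
Qed.

Lemma represents_Q f F : represents f F ->
  represents (gQ (Z := Z) GA (JA g_smooth g_unit) (PA g_smooth g_unit) f : Om) (JmP g F).
Proof.
move=> fF x Ux; rewrite (form_valueD Ux) (form_valueN Ux) (form_valueZ Ux).
rewrite (J_rel g_smooth g_tr g_unit Ux) fF //; congr (_ - _).
rewrite (form_valueZ Ux) (smfun_natE 2 Ux); congr (_ *: _).
rewrite eop_row (form_value_sum Ux); apply: eq_bigr => b _.
rewrite [LHS](form_value_E Ux); congr (wedge _ _).
rewrite (form_value_C Ux (u' := row b (schouten g x *m invmx (g x)))) ?fF //.
move=> i; rewrite [row _ _ _ _]mxE [RHS]mxE [(PA _ _ *m GA) b i]mxE [RHS]mxE (smfun_sumE _ _ _ Ux).
apply: eq_bigr => j _; rewrite (smfunME _ _ Ux).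
by rewrite (P_rel g_smooth g_tr g_unit _ _ Ux) (GAE g_smooth g_unit _ _ Ux).
Qed.

Fact nu_value x : U x -> forall i, (\row_a spd a sA) 0 i x = gradient s x 0 i.
Proof.
move=> Ux i; rewrite [RHS]mxE; have -> : (\row_a spd a sA) 0 i = spd i sA by rewrite mxE.
exact: (spd_rel i (sAE s_smooth)).
Qed.

Lemma represents_eps f F : represents f F ->
  represents (eW Z (\row_a spd a sA) f) (eps (gradient s) F).
Proof.
by move=> fF x Ux; rewrite (form_value_W Ux (u' := gradient s x)) ?fF //; exact: nu_value.
Qed.

Lemma represents_iot f F : represents f F ->
  represents (eC Z (\row_a spd a sA *m GA) f) (iot g (gradient s) F).
Proof.
move=> fF x Ux; rewrite (form_value_C Ux (u' := gradient s x *m invmx (g x))) ?fF //.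
move=> i; rewrite [RHS]mxE [(_ *m _) 0 i]mxE (smfun_sumE _ _ _ Ux); apply: eq_bigr => j _.
by rewrite (smfunME _ _ Ux) nu_value // (GAE g_smooth g_unit _ _ Ux).
Qed.

End FormTransport.

(** What the transport of tractor operators requires of a representation relation; with it, each
    such operator is transported by a search along its expression ([reps]). *)
Record operator_transport {R : realType} {n : nat} (V : lmodType R)
    (rep : V -> lform R n -> Prop) (g : lmetric R n) (s : lscalar R n)
    (C : form_calculus V (n.+1%:R : R)) : Prop := OperatorTransport {
  rep0 : rep 0 0;
  repD : forall f F f' F', rep f F -> rep f' F' -> rep (f + f') (F + F');
  repN : forall f F, rep f F -> rep (- f) (- F);
  repZ : forall a f F, rep f F -> rep (a *: f) (a *: F);
  rep_d : forall f F, rep f F -> rep (fd C f) (dform g F);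
  rep_del : forall f F, rep f F -> rep (fdel C f) (codiff g F);
  rep_nu : forall f F, rep f F -> rep (fnu C f) (eps (gradient s) F);
  rep_iota : forall f F, rep f F -> rep (fiota C f) (iot g (gradient s) F);
  rep_s : forall f F, rep f F -> rep (fs C f) (smul s F);
  rep_rho : forall f F, rep f F -> rep (frho C f) (smul (rho g s) F);
  rep_Q : forall f F, rep f F -> rep (fQ C f) (JmP g F)
}.

Section TractorTransport.
Context {R : realType} {n : nat} {V : lmodType R}.
Local Notation T := (V * V * V * V)%type.
Context {rep : V -> lform R n -> Prop} {g : lmetric R n} {s : lscalar R n}.
Context {C : form_calculus V (n.+1%:R : R)}.
Variable H : operator_transport rep g s C.

Fact repB f F f' F' : rep f F -> rep f' F' -> rep (f - f') (F - F').
Proof. by move=> fF /(repN H); exact: (repD H). Qed.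

Ltac reps := repeat first
  [ assumption | exact (rep0 H) | apply: repB | apply: (repD H) | apply: (repN H)
  | apply: (repZ H) | apply: (rep_d H) | apply: (rep_del H) | apply: (rep_nu H)
  | apply: (rep_iota H) | apply: (rep_s H) | apply: (rep_rho H) | apply: (rep_Q H) ].

Definition trep (t : T) (T' : ltractor R n) : Prop :=
  [/\ rep t.1.1.1 (north T'), rep t.1.1.2 (west T'), rep t.1.2 (east T')
    & rep t.2 (south T')].

Lemma trepD t u T' U' : trep t T' -> trep u U' -> trep (t + u) (T' + U').
Proof.
by case=> a1 a2 a3 a4 [b1 b2 b3 b4];
  split; [exact (repD H a1 b1) | exact (repD H a2 b2)
    | exact (repD H a3 b3) | exact (repD H a4 b4)].
Qed.

Lemma trepN t T' : trep t T' -> trep (- t) (- T').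
Proof.
by case=> a1 a2 a3 a4;
  split; [exact (repN H a1) | exact (repN H a2) | exact (repN H a3) | exact (repN H a4)].
Qed.

Lemma trepZ (a : R) t T' : trep t T' -> trep (a *: t) (a *: T').
Proof.
by case=> a1 a2 a3 a4;
  split; [exact (repZ H a a1) | exact (repZ H a a2) | exact (repZ H a a3) | exact (repZ H a a4)].
Qed.

Lemma trep_X t T' : trep t T' -> trep (aX t) (lX T').
Proof. by case: t => [[[? ?] ?] ?] [? ? ? ?]; split; reps. Qed.

Lemma trep_Xs t T' : trep t T' -> trep (aXs t) (lXs T').
Proof. by case: t => [[[? ?] ?] ?] [? ? ? ?]; split; reps. Qed.

Lemma trep_I t T' : trep t T' -> trep (aI C t) (lI g s T').
Proof. by case: t => [[[? ?] ?] ?] [? ? ? ?]; split; reps. Qed.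

Lemma trep_Is t T' : trep t T' -> trep (aIs C t) (lIs g s T').
Proof. by case: t => [[[? ?] ?] ?] [? ? ? ?]; split; reps. Qed.

Lemma trep_D w (k : int) t T' : trep t T' -> trep (aD C w k%:~R t) (lD g w k T').
Proof. by case: t => [[[? ?] ?] ?] [? ? ? ?]; split; reps. Qed.

Lemma trep_Ds w (k : int) t T' : trep t T' -> trep (aDs C w k%:~R t) (lDs g w k T').
Proof. by case: t => [[[? ?] ?] ?] [? ? ? ?]; split; reps. Qed.

Lemma trep_y w (k : int) t T' : trep t T' -> trep (ay C w k%:~R t) (ly g s w k T').
Proof.
move=> tT; apply: trepN; apply: trepD; first by apply: trep_Is; exact: trep_D.
have -> : k%:~R - 1 = (k - 1)%:~R :> R by rewrite rmorphB.
by apply: trep_D; exact: trep_Is.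
Qed.

Lemma trep_ypow w (k : int) m t T' : trep t T' ->
  trep (ypow (tractor_ladder C) w k%:~R m t) (lypow g s w k m T').
Proof. by elim: m w t T' => [//|m IH] w t T' tT; apply: IH; exact: trep_y. Qed.

Lemma trep_ypow_star w (k : int) m t T' : trep t T' ->
  trep (ypow (tractor_ladder_star C) w k%:~R m t) (lypow g s w k m T').
Proof. by elim: m w t T' => [//|m IH] w t T' tT; apply: IH; exact: trep_y. Qed.

Lemma trep_Dbar w (k : int) t T' : w != 1 - n%:R / 2 -> trep t T' ->
  trep (Dbar (tractor_ladder C) w k%:~R t) (lDbar g s w k T').
Proof.
move=> /negbTE w0 tT; rewrite /lDbar w0; apply: trepZ; apply: trepD; last first.
  by apply: trepZ; apply: trep_X; exact: trep_ypow.
by apply: trepD; [exact: trep_D | apply: trep_I; exact: trep_y].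
Qed.

Lemma trep_Dbars w (k : int) t T' : w != 1 - n%:R / 2 -> trep t T' ->
  trep (Dbar (tractor_ladder_star C) w k%:~R t) (lDbars g s w k T').
Proof.
move=> /negbTE w0 tT; rewrite /lDbars w0; apply: trepZ; apply: trepD; last first.
  by apply: trepZ; apply: trep_Xs; exact: trep_ypow_star.
by apply: trepD; [exact: trep_Ds | apply: trep_Is; exact: trep_y].
Qed.

End TractorTransport.

Section DomainCalculus.
Context {R : realType} {n : nat}.
Local Notation d := n.+1.
Local Notation vec := 'rV[R]_d.
Variable D : @domain R n.
Local Notation U := (dom_set D).
Local Notation A := (smfun D).
Local Notation Om := {ffun {set 'I_d} -> A^o}.
Local Notation V := (restrict_scalars (K := R) (A := A) Om).
Local Notation Z := (@form_fermions A d).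
Local Notation Y := (domain_derivations D).
Variable g : lmetric R n.
Hypothesis g_smooth : forall i j, smooth_on U (fun x => g x i j).
Hypothesis g_tr : forall x, U x -> (g x)^T = g x.
Hypothesis g_unit : forall x, U x -> g x \in unitmx.
Variable s : lscalar R n.
Hypothesis s_smooth : smooth_on U s.
Hypothesis n_ge2 : (2 <= n)%N.
Hypothesis s_neq0 : forall x, U x -> 0 < x 0 ord0 -> s x != 0.
Hypothesis go_einstein : forall x, U x -> 0 < x 0 ord0 ->
  let go : lmetric R n := fun x => s x ^- 2 *: g x in ricci go x = - n%:R *: go x.

Definition form_restr (F : lform R n)
    (sm : forall S : {set 'I_d}, smooth_on U (fun x => F x S)) : V :=
  [ffun S => restr (sm S)].

Lemma represents_restr (F : lform R n) (sm : forall S : {set 'I_d}, smooth_on U (fun x => F x S)) :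
  represents (form_restr sm) F.
Proof. by move=> x Ux; apply/ffunP => S; rewrite ffunE [form_restr _ _]ffunE restrE. Qed.

(** The i-th summand E_i I_i returns the component at S if i lies in S, and 0 otherwise. *)
Lemma eop1_card (f : Om) S : eop Z 1%:M f S = #|S|%:R * (f S : A).
Proof.
rewrite eop_row sum_ffunE (bigID (mem S)) /= [X in _ + X]big1 ?addr0; last first.
  by move=> i /negbTE iS; rewrite ffunE iS.
transitivity (\sum_(i in S) (f S : A)); last by rewrite sumr_const mulr_natl.
apply: eq_bigr => i iS; rewrite ffunE iS.
have -> : eC Z (row i 1%:M) f = eI i f.
  rewrite /eC (bigD1 i) //= !mxE eqxx scale1r big1 ?addr0 // => j /negbTE ji.
  by rewrite !mxE eq_sym ji scale0r.
rewrite ffunE !inE eqxx /= finset.setD1K // mulrA.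
by rewrite [esgn i S](esgn_setD1 i iS) ltnn mul1r esgn_sqr mul1r.
Qed.

(** Translates homogeneity into the eigenvalue equation used by [of_degree]. The degree is an
    integer because the slots of a tractor k-form go down to degree k - 2. *)
Lemma homogeneous_degree (k : int) (F : lform R n)
    (sm : forall S : {set 'I_d}, smooth_on U (fun x => F x S)) :
  (forall x, U x -> homogeneous k (F x)) ->
  eop Z 1%:M (form_restr sm : Om) = k%:~R *: form_restr sm.
Proof.
move=> hF; apply/ffunP => S; rewrite eop1_card restrict_scaleE [RHS]ffunE.
rewrite [form_restr _ _]ffunE; apply: smfunP => x Ux.
rewrite (smfunME _ _ Ux) (smfun_natE _ Ux) [RHS](smfunME _ _ Ux) (smfun_algE _ Ux) restrE //.
have [<-//|kS] := eqVneq (#|S| : int) k.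
by rewrite hF // !mulr0.
Qed.

Lemma domain_calculus : exists C : form_calculus V (d%:R : R),
  [/\ @operator_transport R n V (@represents R n D) g s C,
      forall F, fN C F = eop Z 1%:M F
    & forall F, fs C F = sA s_smooth *: (F : Om)].
Proof.
have [C [[dE delE] [nuE iotaE] [sE rhoE] [QE NE]]] :=
  @einstein_calculus R A Om d Z Y (@spd_alg R n D) _ _ (gA_tr g_smooth g_tr)
    (GA_tr g_smooth g_tr g_unit) (gA_GA g_smooth g_unit) _ _ (JA g_smooth g_unit) _
    (@domain_regular R n D s s_smooth s_neq0)
    (domain_einstein g_smooth g_tr g_unit s_smooth n_ge2 s_neq0 go_einstein)
    (domain_unit_length g_smooth g_tr g_unit s_smooth n_ge2 s_neq0 go_einstein)
    (etrans (esym (addrA _ _ _)) (trace_rhoA g_smooth g_unit s_smooth)).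
exists C; split=> //; split.
- exact (@represents0 R n D).
- exact (@representsD R n D).
- exact (@representsN R n D).
- exact (@representsZ R n D).
- by move=> f F fF; rewrite dE; exact (represents_d g_smooth g_tr g_unit fF).
- by move=> f F fF; rewrite delE; exact (represents_codiff g_smooth g_tr g_unit fF).
- by move=> f F fF; rewrite nuE; exact (represents_eps s_smooth fF).
- by move=> f F fF; rewrite iotaE; exact (represents_iot g_smooth g_unit s_smooth fF).
- by move=> f F fF; rewrite sE; exact (represents_smul (sAE s_smooth) fF).
- move=> f F fF; rewrite rhoE.
  exact (represents_smul (rho_rel g_smooth g_tr g_unit s_smooth) fF).
- by move=> f F fF; rewrite QE; exact (represents_Q g_smooth g_tr g_unit fF).
Qed.

End DomainCalculus.

(** * The four identities at a boundary point of a chart *)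

Section LocalIdentities.
Context {R : realType} {n : nat}.
Local Notation d := n.+1.
Local Notation vec := 'rV[R]_d.
Variable D : @domain R n.
Local Notation U := (dom_set D).
Local Notation A := (smfun D).
Local Notation Om := {ffun {set 'I_d} -> A^o}.
Local Notation V := (restrict_scalars (K := R) (A := A) Om).
Local Notation Z := (@form_fermions A d).
Variable g : lmetric R n.
Hypothesis g_smooth : forall i j, smooth_on U (fun x => g x i j).
Hypothesis g_tr : forall x, U x -> (g x)^T = g x.
Hypothesis g_unit : forall x, U x -> g x \in unitmx.
Variable s : lscalar R n.
Hypothesis s_smooth : smooth_on U s.
Hypothesis n_ge2 : (2 <= n)%N.
Hypothesis s_neq0 : forall x, U x -> 0 < x 0 ord0 -> s x != 0.
Hypothesis go_einstein : forall x, U x -> 0 < x 0 ord0 ->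
  let go : lmetric R n := fun x => s x ^- 2 *: g x in ricci go x = - n%:R *: go x.

Definition slots_agree (x : vec) (T1 T2 : ltractor R n) : Prop :=
  [/\ north T1 x = north T2 x, west T1 x = west T2 x, east T1 x = east T2 x
    & south T1 x = south T2 x].

Local Notation rep := (@represents R n D : V -> lform R n -> Prop).
Local Notation trep := (@trep R n V rep).

Definition smooth_form (k : int) (F : lform R n) : Prop :=
  (forall S : {set 'I_d}, smooth_on U (fun x => F x S)) /\
  (forall x, U x -> homogeneous k (F x)).

Definition smooth_tractor (k : int) (T : ltractor R n) : Prop :=
  [/\ smooth_form (k - 1) (north T), smooth_form k (west T),
      smooth_form (k - 2) (east T) & smooth_form (k - 1) (south T)].

Section Calculus.
Variable C : form_calculus V (d%:R : R).
Hypothesis H : operator_transport rep g s C.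
Hypothesis NE : forall F, fN C F = eop Z 1%:M F.
Hypothesis sE : forall F, fs C F = sA s_smooth *: (F : Om).

(** The remainders left by the abstract identities lie in the image of [aS], multiplication by
    sigma, and so vanish at x. *)
Lemma slots_agree_boundary x t u v T1 T2 : U x -> s x = 0 ->
  trep t T1 -> trep u T2 -> t = u + aS C v -> slots_agree x T1 T2.
Proof.
move=> Ux sx tT uT e.
have slot (f f' w : V) F F' : rep f F -> rep f' F' -> f = f' + fs C w -> F x = F' x.
  move=> fF fF' fE; rewrite -(fF x Ux) -(fF' x Ux) fE sE [LHS](form_valueD Ux).
  by rewrite (form_valueZ Ux) (sAE s_smooth Ux) sx scale0r addr0.
rewrite {}e in tT; case: t u v tT uT => [[[? ?] ?] ?] [[[u1 u2] u3] u4] [[[v1 v2] v3] v4].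
move=> [t1 t2 t3 t4] [h1 h2 h3 h4].
by split; [exact (slot _ _ v1 _ _ t1 h1 erefl) | exact (slot _ _ v2 _ _ t2 h2 erefl)
  | exact (slot _ _ v3 _ _ t3 h3 erefl) | exact (slot _ _ v4 _ _ t4 h4 erefl)].
Qed.

Lemma smooth_tractor_lift (k : int) T : smooth_tractor k T ->
  exists t, trep t T /\ of_degree C k%:~R t.
Proof.
move=> [[sn hn] [sw hw] [se he] [ss hs]].
exists (form_restr sn, form_restr sw, form_restr se, form_restr ss); split.
  by split; exact: represents_restr.
have kE (m : nat) : k%:~R - m%:R = (k - m%:Z)%:~R :> R by rewrite rmorphB /=.
rewrite /of_degree !NE (kE 1) (kE 2).
by split; apply: homogeneous_degree.
Qed.

Variables (x : vec) (Ux : U x) (sx : s x = 0).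
Variables (w : R) (k : int) (h : nat).
Hypotheses (h_odd : odd h) (h_ge3 : (3 <= h)%N) (hE : d%:R + 2 * w = h%:R).

(** Parity keeps every denominator h - 2j of the commutation formula away from 0. *)
Fact odd_neq0 (j : nat) : d%:R + 2 * w - 2 * j%:R != 0.
Proof.
rewrite hE -natrM subr_eq0 eqr_nat; apply/eqP => e.
by move: h_odd; rewrite e mul2n odd_double.
Qed.

Fact odd_pred_neq0 (j : nat) : d%:R + 2 * (w - 1) - 2 * j%:R != 0.
Proof.
rewrite (_ : _ - _ = d%:R + 2 * w - 2 * j.+1%:R); first exact: odd_neq0.
by rewrite -[j.+1%:R]natr1; ring.
Qed.

Fact special_weight v : (v == 1 - n%:R / 2) = (d%:R + 2 * v == 3 :> R).
Proof.
apply/eqP/eqP => [->|e]; first by rewrite -natr1; field.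
apply: (@mulfI R 2); first by rewrite pnatr_eq0.
by apply: (@addrI _ d%:R); rewrite e -natr1; field.
Qed.

Lemma X_ypow_boundary T : smooth_tractor k T ->
  slots_agree x (lX (lypow g s w k (h - 1) T))
    (- (h%:R - 2) ^+ 2 *: lypow g s (w - 1) (k + 1) (h - 3) (lDbar g s w k T)).
Proof.
case: h h_odd h_ge3 hE odd_neq0 => [|[|[|[|m]]]] // _ _ hE' hn0 /smooth_tractor_lift [t [tT deg]].
  (* The case h = 3: no power of y is left on the right, (h - 2)^2 = 1, and [lDbar] takes its
     exceptional value, so both sides are the same tractor. *)
  rewrite /lDbar special_weight hE' eqxx /=.
  have -> : - (3 - 2) ^+ 2 *: - lX (lypow g s w k 2 T) = lX (lypow g s w k 2 T).
    by rewrite (_ : - _ = -1); [rewrite scaleN1r opprK | ring].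
  by [].
have w3 : w != 1 - n%:R / 2 by rewrite special_weight hE' eqr_nat.
have [v e] := X_ypow_Dbar (Y := tractor_ladder C) deg hE' hn0.
have kE : k%:~R + 1 = (k + 1)%:~R :> R by rewrite rmorphD.
rewrite kE hE' in e.
rewrite (_ : m.+4 - 1 = m.+3)%N ?subn1 // (_ : m.+4 - 3 = m.+1)%N //.
apply: (slots_agree_boundary Ux sx _ _ e).
  by apply: (trep_X H); exact: (trep_ypow H).
by apply: (trepZ H); apply: (trep_ypow H); exact: (trep_Dbar H).
Qed.

Lemma Xs_ypow_boundary T : smooth_tractor k T ->
  slots_agree x (lXs (lypow g s w k (h - 1) T))
    (- (h%:R - 2) ^+ 2 *: lypow g s (w - 1) (k - 1) (h - 3) (lDbars g s w k T)).
Proof.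
case: h h_odd h_ge3 hE odd_neq0 => [|[|[|[|m]]]] // _ _ hE' hn0 /smooth_tractor_lift [t [tT deg]].
  rewrite /lDbars special_weight hE' eqxx /=.
  have -> : - (3 - 2) ^+ 2 *: - lXs (lypow g s w k 2 T) = lXs (lypow g s w k 2 T).
    by rewrite (_ : - _ = -1); [rewrite scaleN1r opprK | ring].
  by [].
have w3 : w != 1 - n%:R / 2 by rewrite special_weight hE' eqr_nat.
have [v e] := X_ypow_Dbar (Y := tractor_ladder_star C) deg hE' hn0.
have kE : k%:~R - 1 = (k - 1)%:~R :> R by rewrite rmorphB.
rewrite kE hE' in e.
rewrite (_ : m.+4 - 1 = m.+3)%N ?subn1 // (_ : m.+4 - 3 = m.+1)%N //.
apply: (slots_agree_boundary Ux sx _ _ e).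
  by apply: (trep_Xs H); exact: (trep_ypow_star H).
by apply: (trepZ H); apply: (trep_ypow_star H); exact: (trep_Dbars H).
Qed.

(** For an argument of weight w - 1 the relevant number is h - 2 = m + 1. After m applications of y
    it is 1 - m, which is never 3, so [lDbar] is evaluated in its generic branch. *)
Fact lower_weight (m : nat) : h = m.+3 ->
  [/\ d%:R + 2 * (w - 1) = m.+1%:R, d%:R + 2 * (w - 1) = h%:R - 2 & w - 1 - m%:R != 1 - n%:R / 2].
Proof.
move=> hm; have e : d%:R + 2 * (w - 1) = h%:R - 2 by rewrite -hE; ring.
have e1 : d%:R + 2 * (w - 1) = m.+1%:R by rewrite e hm -[m.+3]addn2 natrD addrK.
split=> //; rewrite special_weight mulrBr addrA e1 -natr1.
apply/eqP => e3; have : m%:R + 2 = 0 :> R by lra.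
by rewrite -natrD => /eqP; rewrite pnatr_eq0 addn2.
Qed.

Lemma ypow_X_boundary T : smooth_tractor k T ->
  slots_agree x (lypow g s w (k + 1) (h - 1) (lX T))
    (- (h%:R - 2) ^+ 2 *:
       lDbar g s (w - 1 - (h - 3)%:R) k (lypow g s (w - 1) k (h - 3) T)).
Proof.
move=> /smooth_tractor_lift [t [tT deg]].
have hm : h = (h - 3).+3 by rewrite -{1}(subnK h_ge3) addn3.
have [e1 e2 w3] := lower_weight hm.
have [v e] := ypow_X_Dbar (Y := tractor_ladder C) deg e1 odd_pred_neq0.
have kE : k%:~R + 1 = (k + 1)%:~R :> R by rewrite rmorphD.
rewrite kE subrK e2 in e.
rewrite (_ : h - 1 = (h - 3).+2)%N; last by rewrite [in LHS]hm subn1.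
apply: (slots_agree_boundary Ux sx _ _ e).
  by apply: (trep_ypow H); exact: (trep_X H).
apply: (trepZ H).
exact (trep_Dbar H k w3 (trep_ypow H (w - 1) k (h - 3) tT)).
Qed.

Lemma ypow_Xs_boundary T : smooth_tractor k T ->
  slots_agree x (lypow g s w (k - 1) (h - 1) (lXs T))
    (- (h%:R - 2) ^+ 2 *:
       lDbars g s (w - 1 - (h - 3)%:R) k (lypow g s (w - 1) k (h - 3) T)).
Proof.
move=> /smooth_tractor_lift [t [tT deg]].
have hm : h = (h - 3).+3 by rewrite -{1}(subnK h_ge3) addn3.
have [e1 e2 w3] := lower_weight hm.
have [v e] := ypow_X_Dbar (Y := tractor_ladder_star C) deg e1 odd_pred_neq0.
have kE : k%:~R - 1 = (k - 1)%:~R :> R by rewrite rmorphB.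
rewrite kE subrK e2 in e.
rewrite (_ : h - 1 = (h - 3).+2)%N; last by rewrite [in LHS]hm subn1.
apply: (slots_agree_boundary Ux sx _ _ e).
  by apply: (trep_ypow_star H); exact: (trep_Xs H).
apply: (trepZ H).
exact (trep_Dbars H k w3 (trep_ypow_star H (w - 1) k (h - 3) tT)).
Qed.

End Calculus.

End LocalIdentities.

(** * From the charts to the manifold *)

Section ManifoldIdentities.
Context {R : realType} {n : nat}.
Hypothesis n_ge2 : (2 <= n)%N.
Variables (M : manifold R n) (c : set (metric M)) (sigma : metric M -> M -> R).
Hypothesis hPE : poincare_einstein c sigma.
Variables (g : metric M) (a : chart M) (p : M).
Hypotheses (cg : c g) (ap : dom a p) (bp : bdry p).
Local Notation coord := Defs.coord.
Local Notation U := (coord a @` dom a).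
Local Notation s := (in_chart (sigma g) a).

Definition chart_domain : @domain R n :=
  Domain (image_rel_open a) (ex_intro2 _ _ p ap erefl : U (coord a p)).

Local Notation chart_forms := {ffun {set 'I_n.+1} -> (smfun chart_domain)^o}.
Local Notation V := (restrict_scalars (K := R) (A := smfun chart_domain) chart_forms).

Lemma chart_calculus :
  exists (s_smooth : smooth_on U s) (C : form_calculus V (n.+1%:R : R)),
  [/\ @operator_transport R n V (@represents R n chart_domain) (g a) s C,
      forall F, fN C F = eop form_fermions 1%:M F
    & forall F, fs C F = sA (D := chart_domain) s_smooth *: (F : chart_forms)].
Proof.
have [conf [dens _] pos bd ein] := hPE.
have s_smooth : smooth_on U s := dens g cg a.
have s_neq0 y : U y -> 0 < y 0 ord0 -> s y != 0.
  move=> [q aq <-] q0; rewrite /in_chart coordK // gt_eqF //.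
  by apply: pos => //; exact (interior_point conf aq q0).
have go_einstein y : U y -> 0 < y 0 ord0 ->
    ricci (fun x => s x ^- 2 *: g a x) y = - n%:R *: (s y ^- 2 *: g a y).
  by move=> [q aq <-] q0; apply: ein => //; exact (interior_point conf aq q0).
exists s_smooth.
exact (@domain_calculus R n chart_domain (g a) (fun i j => conformal_smooth conf cg (a := a) i j)
  (conformal_tr conf cg (a := a)) (conformal_unit conf cg (a := a)) s s_smooth n_ge2 s_neq0
  go_einstein).
Qed.

Fact boundary_scale : s (coord a p) = 0.
Proof.
have [_ _ _ bd _] := hPE; have [e _] := bd g p cg bp.
by rewrite /in_chart coordK.
Qed.

Lemma chart_smooth_tractor (k : int) w (T : tractor M) : is_tractor c k w T ->
  smooth_tractor chart_domain k (T g a).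
Proof.
by move=> [+ _] => /(_ g cg) [[s1 h1 _] [s2 h2 _] [s3 h3 _] [s4 h4 _]]; split; split;
  [exact: s1 | exact: h1 | exact: s2 | exact: h2 | exact: s3 | exact: h3 | exact: s4 | exact: h4].
Qed.

End ManifoldIdentities.

Theorem theorem6p13 (R : realType) (n : nat) (hn : (2 <= n)%N)
  (M : manifold R n) (c : set (metric M)) (sigma : metric M -> M -> R)
  (hPE : poincare_einstein c sigma)
  (k : nat) (w0 : R) (h0 : nat) (hodd : odd h0) (h0_ge3 : (3 <= h0)%N)
  (h0E : n.+1%:R + 2 * w0 = h0%:R)
  (A F : tractor M)
  (hA : is_tractor c k%:Z w0 A) (hF : is_tractor c k%:Z (w0 - 1) F) :
  [/\ eq_along_bdry c
        (tX (typow sigma w0 k%:Z (h0 - 1) A))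
        (- (h0%:R - 2) ^+ 2 *:
           typow sigma (w0 - 1) (k%:Z + 1) (h0 - 3) (tDbar sigma w0 k%:Z A)),
      eq_along_bdry c
        (tXs (typow sigma w0 k%:Z (h0 - 1) A))
        (- (h0%:R - 2) ^+ 2 *:
           typow sigma (w0 - 1) (k%:Z - 1) (h0 - 3) (tDbars sigma w0 k%:Z A)),
      eq_along_bdry c
        (typow sigma w0 (k%:Z + 1) (h0 - 1) (tX F))
        (- (h0%:R - 2) ^+ 2 *:
           tDbar sigma (w0 - 1 - (h0 - 3)%:R) k%:Z
             (typow sigma (w0 - 1) k%:Z (h0 - 3) F))
    & eq_along_bdry c
        (typow sigma w0 (k%:Z - 1) (h0 - 1) (tXs F))
        (- (h0%:R - 2) ^+ 2 *:
           tDbars sigma (w0 - 1 - (h0 - 3)%:R) k%:Z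
             (typow sigma (w0 - 1) k%:Z (h0 - 3) F))].
Proof.
split=> g a p cg ap bp; have [s_smooth [C [H NE sE]]] := chart_calculus hn hPE cg ap;
  have Ux : dom_set (chart_domain ap) (Defs.coord a p) by [exists p];
  have sx := boundary_scale hPE cg ap bp.
- exact (X_ypow_boundary H NE sE Ux sx hodd h0_ge3 h0E (chart_smooth_tractor cg ap hA)).
- exact (Xs_ypow_boundary H NE sE Ux sx hodd h0_ge3 h0E (chart_smooth_tractor cg ap hA)).
- exact (ypow_X_boundary H NE sE Ux sx hodd h0_ge3 h0E (chart_smooth_tractor cg ap hF)).
- exact (ypow_Xs_boundary H NE sE Ux sx hodd h0_ge3 h0E (chart_smooth_tractor cg ap hF)).
Qed.
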